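(* Let $\mathcal{Q}_1\to\mathcal{Q}_2\to\dots\to\mathcal{Q}_n\to\dots\to\mathcal{Q}$ be a sequence of small categories and functors. Assume that the functors $T_n:\mathcal{Q}_{n-1}\to\mathcal{Q}_n$ are cellular and that $\mathcal{Q}=\varinjlim\mathcal{Q}_n$. Write $\mathbf{F}_n$ for the functor $\mathbf{F}_{T_n}:\mathcal{Q}_n\to\mathbf{Cat}$, $d\mapsto T_n\downarrow d$. Then, for any abelian group $A$, there is a spectral sequence of homological type $$E^1_{p,q}=H_{p+q-1}(\mathcal{Q}_p-\mathcal{Q}_{p-1},\tilde{\mathbf{F}}_p;A)\Rightarrow H_{p+q}(\mathcal{Q},A).$$
   Context: A functor $T:\mathcal{C}\to\mathcal{D}$ is called cellular if (1) $T$ is fully faithful and (2) for any object $d$ of $\mathcal{D}$ not in the image of $T$ and any object $c$ of $\mathcal{C}$, $\mathcal{D}(d,T(c))=\emptyset$. $\mathcal{D}-\mathcal{C}$ denotes the full subcategory of $\mathcal{D}$ given by the objects not in the image of $\mathcal{C}$. The colimit $\varinjlim\mathcal{Q}_n$ is the naive one, defined objectwise and morphismwise. One sets $\mathcal{Q}_0=\emptyset$ and $E^1_{p,q}=0$ for $p\le 0$. $T\downarrow d$ is the comma category of pairs $(c,f:T(c)\to d)$. Homology of a category $\mathcal{E}$: $C_*(\mathcal{E})$ is the chain complex of the free simplicial abelian group on the nerve of $\mathcal{E}$, and $H_i(\mathcal{E},A)=H_i(C_*(\mathcal{E})\otimes A)$. For a functor $\mathbf{F}:\mathcal{E}\to\mathbf{Cat}$,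 let $N(\mathcal{E},\mathbf{F})$ be the bisimplicial set with $N_{p,q}(\mathcal{E},\mathbf{F})=\coprod_{d_0\to\dots\to d_p}N_q(\mathbf{F}(d_0))$ ($N_q$ being the $q$-simplices of the nerve), and let $C_*(\mathcal{E},\mathbf{F})$ be the chain complex of the free simplicial abelian group on its diagonal. If $\mathbf{F}(d)\ne\emptyset$ for all $d$, put $C_*(\mathcal{E},\tilde{\mathbf{F}};A)=\mathrm{Ker}(C_*(\mathcal{E},\mathbf{F})\to C_*(\mathcal{E}))\otimes A$, the map being induced by $\mathbf{F}\to *$; in general, $C_*(\mathcal{E},\tilde{\mathbf{F}};A)$ denotes the complex $\mathrm{cone}(C_*(\mathcal{E},\mathbf{F})\to C_*(\mathcal{E}))[-1]\otimes A$, which is homotopy equivalent to the former when $\mathbf{F}$ is everywhere nonempty. Here $[-1]$ is normalised so that $H_i(C[-1])=H_{i+1}(C)$. Finally $H_i(\mathcal{E},\tilde{\mathbf{F}};A)=H_i(C_*(\mathcal{E},\tilde{\mathbf{F}};A))$. $\mathbf{F}_p$ is restricted to $\mathcal{Q}_p-\mathcal{Q}_{p-1}$. *)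

(* Defs.v *)
From HB Require Import structures.
From mathcomp Require Import all_boot all_order all_algebra.
From mathcomp Require Import boolp.
From mathcomp Require Import zify.
From mathcomp.multinomials Require Import freeg.

Set Implicit Arguments.
Unset Strict Implicit.
Unset Printing Implicit Defensive.

Import Order.TTheory GRing.Theory Num.Theory.
Local Open Scope ring_scope.
Local Obligation Tactic := try done.

Record category := Category {
  ob :> Type;
  hom : ob -> ob -> Type;
  idm : forall x, hom x x;
  cmp : forall x y z, hom y z -> hom x y -> hom x z;
  cmp_idl : forall x y (f : hom x y), cmp (idm y) f = f;
  cmp_idr : forall x y (f : hom x y), cmp f (idm x) = f;
  cmpA : forall w x y z (h : hom y z) (g : hom x y) (f : hom w x),
    cmp h (cmp g f) = cmp (cmp h g) f }.

Arguments hom {c} x y.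
Arguments idm {c} x.
Arguments cmp {c x y z} g f : rename.

Record functor (C D : category) := Functor {
  fob :> C -> D;
  fmap : forall x y, hom x y -> hom (fob x) (fob y);
  fmap_id : forall x, fmap (idm x) = idm (fob x);
  fmap_cmp : forall x y z (g : hom y z) (f : hom x y),
    fmap (cmp g f) = cmp (fmap g) (fmap f) }.

Arguments fmap {C D} T {x y} f : rename.

Record arrow (C : category) := Arrow { src : C; tgt : C; arr : hom src tgt }.

Definition amap (C D : category) (T : functor C D) (a : arrow C) : arrow D :=
  Arrow (fmap T (arr a)).

Lemma Arrow_inj (C : category) (x y : C) (f g : hom x y) :
  Arrow f = Arrow g -> f = g.
Proof.
suff gen (a b : arrow C) : a = b -> forall (e1 : src a = src b) (e2 : tgt a = tgt b),
    ecast z (hom z _) e1 (ecast z (hom _ z) e2 (arr a)) = arr b.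
  by move=> /gen /(_ erefl erefl).
by move=> <- e1 e2; rewrite (Prop_irrelevance e1 erefl) (Prop_irrelevance e2 erefl).
Qed.

Lemma functor_ext (C D : category) (S T : functor C D) :
  (forall x y (f : hom x y), amap S (Arrow f) = amap T (Arrow f)) -> S = T.
Proof.
move=> eST.
have eob : fob S = fob T.
  by apply: functional_extensionality_dep => x; exact (congr1 (@src D) (eST _ _ (idm x))).
case: S T eST eob => [S Sm Si Sc] [T Tm Ti Tc] /= eST eob; subst T.
have em : Sm = Tm.
  apply: functional_extensionality_dep => x; apply: functional_extensionality_dep => y.
  by apply: functional_extensionality_dep => f; apply: Arrow_inj; exact: eST.
by subst Tm; congr Functor; exact: Prop_irrelevance.
Qed.

Program Definition functor_id (C : category) : functor C C :=
  @Functor C C id (fun _ _ f => f) _ _.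

Program Definition functor_cmp (C D E : category) (T : functor D E)
    (S : functor C D) : functor C E :=
  @Functor C E (T \o S) (fun _ _ f => fmap T (fmap S f)) _ _.
Next Obligation. by move=> C D E T S x /=; rewrite !fmap_id. Qed.
Next Obligation. by move=> C D E T S x y z g f /=; rewrite !fmap_cmp. Qed.

Lemma functor_cmp_idl (C D : category) (T : functor C D) :
  functor_cmp (functor_id D) T = T.
Proof. exact: functor_ext. Qed.

Lemma functor_cmp_idr (C D : category) (T : functor C D) :
  functor_cmp T (functor_id C) = T.
Proof. exact: functor_ext. Qed.

Lemma functor_cmpA (B C D E : category) (T : functor D E) (S : functor C D)
  (R : functor B C) :
  functor_cmp T (functor_cmp S R) = functor_cmp (functor_cmp T S) R.
Proof. exact: functor_ext. Qed.

Definition in_image (C D : category) (T : functor C D) (d : D) : Prop :=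
  exists c, T c = d.

Definition fully_faithful (C D : category) (T : functor C D) : Prop :=
  forall x y : C, bijective (@fmap C D T x y).

Definition cellular (C D : category) (T : functor C D) : Prop :=
  fully_faithful T /\
  forall (d : D) (c : C), ~ in_image T d -> hom d (T c) -> False.

Definition full_subcat (D : category) (P : D -> Prop) : category :=
  @Category {d : D | P d} (fun x y => hom (sval x) (sval y))
    (fun x => idm (sval x)) (fun _ _ _ g f => cmp g f)
    (fun _ _ f => cmp_idl f) (fun _ _ f => cmp_idr f)
    (fun _ _ _ _ h g f => cmpA h g f).

Definition subcat_incl (D : category) (P : D -> Prop) :
    functor (full_subcat P) D :=
  @Functor (full_subcat P) D sval (fun _ _ f => f)
    (fun _ => erefl) (fun _ _ _ _ _ => erefl).

(* The category $\mathcal D - \mathcal C$ attached to $T : \mathcal C \to \mathcal D$. *)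
Definition complement (C D : category) (T : functor C D) : category :=
  full_subcat (fun d => ~ in_image T d).

Definition complement_incl (C D : category) (T : functor C D) :
  functor (complement T) D := subcat_incl _.

(* Functoriality is strict: equality of functors, not natural isomorphism. *)
Record catfunctor (E : category) := CatFunctor {
  cfob :> E -> category;
  cfmap : forall x y, hom x y -> functor (cfob x) (cfob y);
  cfmap_id : forall x, cfmap (idm x) = functor_id (cfob x);
  cfmap_cmp : forall x y z (g : hom y z) (f : hom x y),
    cfmap (cmp g f) = functor_cmp (cfmap g) (cfmap f) }.

Arguments cfmap {E} F {x y} f : rename.

Program Definition cf_precomp (D E : category) (F : catfunctor E)
    (T : functor D E) : catfunctor D :=
  @CatFunctor D (fun d => F (T d)) (fun _ _ f => cfmap F (fmap T f)) _ _.
Next Obligation. by move=> D E F T x /=; rewrite fmap_id cfmap_id. Qed.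
Next Obligation. by move=> D E F T x y z g f /=; rewrite fmap_cmp cfmap_cmp. Qed.

Section Comma.
Variables (C D : category) (T : functor C D).

Definition comma_ob (d : D) := {c : C & hom (T c) d}.

Definition comma_hom (d : D) (x y : comma_ob d) :=
  {h : hom (projT1 x) (projT1 y) | cmp (projT2 y) (fmap T h) = projT2 x}.

Lemma comma_hom_eq (d : D) (x y : comma_ob d) (f g : comma_hom x y) :
  sval f = sval g -> f = g.
Proof.
by case: f g => [f ef] [g eg] /= e; subst g; congr exist; exact: Prop_irrelevance.
Qed.

Program Definition comma (d : D) : category :=
  @Category (comma_ob d) (@comma_hom d) (fun x => exist _ (idm (projT1 x)) _)
    (fun x y z g f => exist _ (cmp (sval g) (sval f)) _) _ _ _.
Next Obligation. by move=> d x /=; rewrite fmap_id cmp_idr. Qed.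
Next Obligation.
by move=> d x y z [g eg] [f ef] /=; rewrite fmap_cmp cmpA eg.
Qed.
Next Obligation. by move=> d x y f; apply: comma_hom_eq; exact: cmp_idl. Qed.
Next Obligation. by move=> d x y f; apply: comma_hom_eq; exact: cmp_idr. Qed.
Next Obligation. by move=> d w x y z h g f; apply: comma_hom_eq; exact: cmpA. Qed.

Program Definition comma_map (d d' : D) (u : hom d d') :
    functor (comma d) (comma d') :=
  @Functor (comma d) (comma d')
    (fun x : comma_ob d => existT _ (projT1 x) (cmp u (projT2 x)) : comma_ob d')
    (fun x y f => exist _ (sval f) _) _ _.
Next Obligation. by move=> d d' u x y [f ef] /=; rewrite -cmpA ef. Qed.
Next Obligation. by move=> d d' u x; exact: comma_hom_eq. Qed.
Next Obligation. by move=> d d' u x y z g f; exact: comma_hom_eq. Qed.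

Lemma comma_arrow_eq (d : D) (c c' : C) (g1 g2 : hom (T c) d) (h1 h2 : hom (T c') d)
    (f : hom c c') (e1 : cmp h1 (fmap T f) = g1) (e2 : cmp h2 (fmap T f) = g2) :
  h1 = h2 ->
  @Arrow (comma d) (existT _ c g1) (existT _ c' h1) (exist _ f e1) =
  @Arrow (comma d) (existT _ c g2) (existT _ c' h2) (exist _ f e2).
Proof.
by move=> eh; subst h2; subst g1; subst g2.
Qed.

Program Definition comma_cf : catfunctor D :=
  @CatFunctor D comma (@comma_map) _ _.
Next Obligation.
move=> d; apply: functor_ext => -[c g] [c' g'] [f ef].
by apply: comma_arrow_eq; exact: cmp_idl.
Qed.
Next Obligation.
move=> d1 d2 d3 v u; apply: functor_ext => -[c g] [c' g'] [f ef].
by apply: comma_arrow_eq; rewrite /= cmpA.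
Qed.

End Comma.

Definition ordcat (n : nat) : category :=
  @Category 'I_n.+1 (fun i j => (i <= j)%N) (fun i => leqnn i)
    (fun i j k jk ij => leq_trans ij jk)
    (fun _ _ _ => bool_irrelevance _ _) (fun _ _ _ => bool_irrelevance _ _)
    (fun _ _ _ _ _ _ _ => bool_irrelevance _ _).

(* Morphisms [m] -> [n] of the simplex category: a functor between the
   ordinals [m] and [n] is the same thing as a nondecreasing map. *)
Notation Delta m n := (functor (ordcat m) (ordcat n)).

Definition coface (n : nat) (i : 'I_n.+2) : Delta n n.+1 :=
  @Functor (ordcat n) (ordcat n.+1) (fintype.lift i)
    (fun x y (xy : (x <= y)%N) => etrans (leq_bump2 i x y) xy)
    (fun _ => bool_irrelevance _ _) (fun _ _ _ _ _ => bool_irrelevance _ _).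

Record sset := SSet {
  spx :> nat -> Type;
  sact : forall m n, Delta m n -> spx n -> spx m;
  sact_id : forall n x, sact (functor_id (ordcat n)) x = x;
  sact_cmp : forall l m n (a : Delta m n) (b : Delta l m) x,
    sact (functor_cmp a b) x = sact b (sact a x) }.

Arguments sact X {m n} a x : rename.

Record smap (X Y : sset) := SMap {
  smap_fun :> forall n, X n -> Y n;
  smap_nat : forall m n (a : Delta m n) x,
    smap_fun (sact X a x) = sact Y a (smap_fun x) }.

Record bisset := BiSSet {
  bspx :> nat -> nat -> Type;
  bact : forall p p' q q', Delta p' p -> Delta q' q -> bspx p q -> bspx p' q';
  bact_id : forall p q x,
    bact (functor_id (ordcat p)) (functor_id (ordcat q)) x = x;
  bact_cmp : forall p p' p'' q q' q'' (a : Delta p' p) (a' : Delta p'' p')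
      (b : Delta q' q) (b' : Delta q'' q') x,
    bact (functor_cmp a a') (functor_cmp b b') x = bact a' b' (bact a b x) }.

Arguments bact X {p p' q q'} a b x : rename.

Definition diagonal (X : bisset) : sset :=
  @SSet (fun n => X n n) (fun _ _ a x => bact X a a x)
    (fun _ x => bact_id x) (fun _ _ _ a b x => bact_cmp a b a b x).

(* An n-simplex of the nerve, i.e. a chain $c_0\to\dots\to c_n$, is a functor [n] -> C. *)
Definition nerve (C : category) : sset :=
  @SSet (fun n => functor (ordcat n) C) (fun _ _ a s => functor_cmp s a)
    (fun _ s => functor_cmp_idr s) (fun _ _ _ a b s => functor_cmpA s a b).

Definition vertex0 (C : category) (n : nat) (s : nerve C n) : C := s ord0.

Section NerveCat.
Variables (E : category) (F : catfunctor E).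

Definition bnerve_spx (p q : nat) : Type :=
  {s : nerve E p & nerve (F (vertex0 s)) q}.

(* The arrow $s_0 \to s_{a(0)}$ of the chain [s]. *)
Definition vertex0_arrow (p p' : nat) (a : Delta p' p) (s : nerve E p) :
    hom (vertex0 s) (vertex0 (sact (nerve E) a s)) :=
  @fmap _ _ s ord0 (a ord0) (leq0n _).

(* $(s,t)\mapsto(s\circ a, \mathbf F(s_0\to s_{a(0)})\circ t\circ b)$; the transition
   functor is needed because the second component lives over the first vertex. *)
Definition bnerve_act (p p' q q' : nat) (a : Delta p' p) (b : Delta q' q)
    (x : bnerve_spx p q) : bnerve_spx p' q' :=
  existT (fun s : nerve E p' => (nerve (F (vertex0 s)) q' : Type))
    (sact (nerve E) a (projT1 x))
    (functor_cmp (cfmap F (vertex0_arrow a (projT1 x)))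
       (sact (nerve _) b (projT2 x))).

Lemma bnerve_eq (p q : nat) (d : E) (k : nerve (F d) q) (s s' : nerve E p)
    (u : hom d (vertex0 s)) (u' : hom d (vertex0 s')) :
  s = s' -> Arrow u = Arrow u' ->
  existT (fun s : nerve E p => (nerve (F (vertex0 s)) q : Type)) s
    (functor_cmp (cfmap F u) k) =
  existT (fun s : nerve E p => (nerve (F (vertex0 s)) q : Type)) s'
    (functor_cmp (cfmap F u') k).
Proof. by move=> es; subst s' => /Arrow_inj ->. Qed.

Lemma ordcat_hom_irr (n : nat) (i j : ordcat n) (f g : hom i j) : f = g.
Proof. exact: bool_irrelevance. Qed.

Program Definition bnerve : bisset := @BiSSet bnerve_spx bnerve_act _ _.
Next Obligation.
move=> p q [s k]; rewrite /bnerve_act /=.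
rewrite [RHS](_ : _ = existT _ s (functor_cmp (cfmap F (idm (vertex0 s))) k)).
  rewrite (functor_cmp_idr k); apply: bnerve_eq; first exact: functor_cmp_idr.
  rewrite /vertex0_arrow /vertex0 -(fmap_id s).
  by congr Arrow; congr fmap; exact: bool_irrelevance.
by rewrite cfmap_id functor_cmp_idl.
Qed.
Next Obligation.
move=> p p' p'' q q' q'' a a' b b' [s k]; rewrite /bnerve_act /=.
transitivity (existT (fun s : nerve E p'' => (nerve (F (vertex0 s)) q'' : Type))
  (sact (nerve E) a' (sact (nerve E) a s)) (functor_cmp
    (cfmap F (cmp (vertex0_arrow a' (sact (nerve E) a s)) (vertex0_arrow a s)))
    (sact (nerve _) (functor_cmp b b') k))).
  apply: bnerve_eq; first exact: functor_cmpA.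
  rewrite /vertex0_arrow /vertex0 /=.
  rewrite -fmap_cmp; congr Arrow; congr fmap; exact: bool_irrelevance.
by rewrite cfmap_cmp; apply: (congr1 (existT _ _)); exact: functor_ext.
Qed.

Program Definition bnerve_proj : smap (diagonal bnerve) (nerve E) :=
  @SMap _ _ (fun _ x => projT1 x) _.

End NerveCat.

Record subgrp (M : zmodType) (Z : zmodClosed M) :=
  SubGrp { sub_val : M; sub_valP : sub_val \in Z }.

HB.instance Definition _ (M : zmodType) (Z : zmodClosed M) :=
  [isSub for @sub_val M Z].
HB.instance Definition _ (M : zmodType) (Z : zmodClosed M) :=
  [Choice of subgrp Z by <:].
HB.instance Definition _ (M : zmodType) (Z : zmodClosed M) :=
  [SubChoice_isSubZmodule of subgrp Z by <:].

Section Subgroups.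
Variables (M N : zmodType).

Definition ker_pred (f : {additive M -> N}) (x : M) : bool := f x == 0.
Lemma ker_closed f : zmod_closed (ker_pred f).
Proof.
split=> [|x y]; rewrite !unfold_in /ker_pred; first by rewrite raddf0.
by move=> /eqP fx /eqP fy; rewrite raddfB fx fy subrr.
Qed.
HB.instance Definition _ f :=
  GRing.isZmodClosed.Build M (ker_pred f) (ker_closed f).

Definition im_pred (f : {additive M -> N}) (y : N) : bool :=
  `[< exists x, f x = y >].
Lemma im_closed f : zmod_closed (im_pred f).
Proof.
split=> [|x y]; rewrite !unfold_in /im_pred.
  by apply/asboolP; exists 0; rewrite raddf0.
move=> /asboolP[a <-] /asboolP[b <-]; apply/asboolP.
by exists (a - b); rewrite raddfB.
Qed.
HB.instance Definition _ f :=
  GRing.isZmodClosed.Build N (im_pred f) (im_closed f).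

Definition trace_pred (Z B : zmodClosed M) (x : subgrp Z) : bool :=
  sub_val x \in B.
Lemma trace_closed Z B : zmod_closed (@trace_pred Z B).
Proof.
split=> [|x y xB yB]; first by rewrite unfold_in /trace_pred; exact: rpred0.
rewrite unfold_in /trace_pred; exact: (rpredB (xB : sub_val x \in B) yB).
Qed.
HB.instance Definition _ Z B :=
  GRing.isZmodClosed.Build (subgrp Z) (@trace_pred Z B) (@trace_closed Z B).

Definition span_pred (S : M -> Prop) (x : M) : bool :=
  `[< forall Z : zmodClosed M, (forall y, S y -> y \in Z) -> x \in Z >].
Lemma span_closed S : zmod_closed (span_pred S).
Proof.
split=> [|x y]; rewrite !unfold_in /span_pred.
  by apply/asboolP => Z _; exact: rpred0.
move=> /asboolP hx /asboolP hy; apply/asboolP => Z hZ.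
by apply: rpredB; [exact: hx | exact: hy].
Qed.
HB.instance Definition _ S :=
  GRing.isZmodClosed.Build M (span_pred S) (span_closed S).

End Subgroups.

Definition kernel (M N : zmodType) (f : {additive M -> N}) : zmodClosed M :=
  GRing.ZmodClosed.clone M (ker_pred f) _.
Definition image_grp (M N : zmodType) (f : {additive M -> N}) : zmodClosed N :=
  GRing.ZmodClosed.clone N (im_pred f) _.
Definition span (M : zmodType) (S : M -> Prop) : zmodClosed M :=
  GRing.ZmodClosed.clone M (span_pred S) _.
Definition trace_grp (M : zmodType) (Z B : zmodClosed M) : zmodClosed (subgrp Z) :=
  GRing.ZmodClosed.clone (subgrp Z) (@trace_pred M Z B) _.

(* $Z/(B\cap Z)$; in all uses $B\subseteq Z$. *)
Definition subquot (M : zmodType) (Z B : zmodClosed M) : zmodType :=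
  Quotient.quot (trace_grp Z B).

Definition subquot_class (M : zmodType) (Z B : zmodClosed M) (x : M)
    (xZ : x \in Z) : subquot Z B :=
  \pi_(Quotient.quot (trace_grp Z B))%qT (SubGrp xZ).

Definition homology_at (L M N : zmodType) (f : {additive L -> M})
    (g : {additive M -> N}) : zmodType :=
  subquot (kernel g) (image_grp f).

Record zmod_iso (M N : zmodType) := ZmodIso {
  iso_fun :> {additive M -> N};
  iso_bij : bijective iso_fun }.

Section QuotLift.
Variables (M N : zmodType) (I : zmodClosed M) (g : {additive M -> N}).
Definition quot_lift (_ : forall x, x \in I -> g x = 0) (x : Quotient.quot I) : N :=
  g (repr x).

Lemma quot_liftE gI x : quot_lift gI (\pi_(Quotient.quot I)%qT x) = g x.
Proof.
apply/eqP; rewrite -subr_eq0 -raddfB; apply/eqP; apply: gI.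
by rewrite Quotient.idealrBE reprK.
Qed.

Lemma quot_lift_additive gI : zmod_morphism (quot_lift gI).
Proof.
move=> x y; rewrite -[x]reprK -[y]reprK -raddfB !quot_liftE.
exact: raddfB.
Qed.
HB.instance Definition _ gI := GRing.isZmodMorphism.Build
  (Quotient.quot I) N (quot_lift gI) (quot_lift_additive gI).
End QuotLift.

Lemma span_vanish (M N : zmodType) (S : M -> Prop) (g : {additive M -> N}) :
  (forall y, S y -> g y = 0) -> forall x, x \in span S -> g x = 0.
Proof.
move=> gS x; rewrite unfold_in /= => /asboolP /(_ (kernel g)) gx; apply/eqP.
by apply: gx => y /gS gy; rewrite unfold_in /= /ker_pred gy.
Qed.

Section FreeMap.
Variables (K L : choiceType) (f : K -> L).

Definition free_map : {freeg K / int} -> {freeg L / int} :=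
  fglift (fun x => (<< f x >> : {freeg L / int})).

HB.instance Definition _ := GRing.isZmodMorphism.Build
  {freeg K / int} {freeg L / int} free_map (lift_is_additive _).

Lemma free_mapU x : free_map << x >> = << f x >>.
Proof. by rewrite /free_map liftU scale1r. Qed.
End FreeMap.

Lemma free_ext (K : choiceType) (N : zmodType) (g h : {additive {freeg K / int} -> N}) :
  (forall x, g << x >> = h << x >>) -> g =1 h.
Proof.
move=> gh; elim/freeg_ind_dom0 => [|k x D _ _ IH]; first by rewrite !raddf0.
rewrite !raddfD IH; congr (_ + _).
suff -> : << k *g x >> = << x >> *~ k :> {freeg K / int} by rewrite !raddfMz gh.
rewrite -scaler_int intz; apply/eqP/freeg_eqP => y.
by rewrite coeffZ !coeffU mul1r.
Qed.

Section Tensor.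
Variable A : zmodType.

Definition bilinear_rel (M : zmodType) (x : {freeg (M * A)%type / int}) : Prop :=
  (exists m m' a, x = << (m + m', a) >> - << (m, a) >> - << (m', a) >>) \/
  (exists m a a', x = << (m, a + a') >> - << (m, a) >> - << (m, a') >>).

Definition tensor (M : zmodType) : zmodType :=
  Quotient.quot (span (@bilinear_rel M)).

Definition tens (M : zmodType) (m : M) (a : A) : tensor M :=
  \pi_(Quotient.quot (span (@bilinear_rel M)))%qT << (m, a) >>.

Section TensorMap.
Variables (M N : zmodType) (f : {additive M -> N}).

Definition tensor_map0 : {freeg (M * A)%type / int} -> tensor N :=
  \pi_(Quotient.quot (span (@bilinear_rel N)))%qT
    \o free_map (fun x : M * A => (f x.1, x.2)).
HB.instance Definition _ := GRing.Additive.copy tensor_map0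
  (\pi_(Quotient.quot (span (@bilinear_rel N)))%qT
    \o free_map (fun x : M * A => (f x.1, x.2))).

Lemma tensor_map0_rel x : x \in span (@bilinear_rel M) -> tensor_map0 x = 0.
Proof.
apply: span_vanish => {}x xrel; rewrite /tensor_map0 /=.
apply/eqP; rewrite -[0](raddf0 (\pi_(Quotient.quot (span (@bilinear_rel N))))%qT).
rewrite -Quotient.idealrBE subr0 unfold_in /=; apply/asboolP => Z; apply.
case: xrel => [[m [m' [a ->]]]|[m [a [a' ->]]]].
  by left; exists (f m), (f m'), a; rewrite !raddfB /= !free_mapU /= raddfD.
by right; exists (f m), a, a'; rewrite !raddfB /= !free_mapU.
Qed.

(* $f\otimes\mathrm{id}_A$ *)
Definition tensor_map : {additive tensor M -> tensor N} :=
  quot_lift tensor_map0_rel.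

Lemma tensor_mapE m a : tensor_map (tens m a) = tens (f m) a.
Proof.
apply: (etrans (quot_liftE tensor_map0_rel _)).
by rewrite /= /tensor_map0 /= free_mapU.
Qed.
End TensorMap.

Lemma tensor_ext (M N : zmodType) (g h : {additive tensor M -> N}) :
  (forall m a, g (tens m a) = h (tens m a)) -> g =1 h.
Proof.
move=> gh x; rewrite -[x]reprK.
set p := (\pi_(Quotient.quot (span (@bilinear_rel M))))%qT.
have := @free_ext _ _ (g \o p : {additive _ -> _}) (h \o p : {additive _ -> _}).
by apply=> -[m a]; exact: gh.
Qed.

Lemma tens0 (M : zmodType) a : tens (0 : M) a = 0.
Proof.
have e : tens (0 + 0 : M) a - tens (0 : M) a - tens (0 : M) a = 0.
  rewrite /tens -!raddfB; apply/eqP.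
  rewrite -[0 in X in _ == X](raddf0 (\pi_(Quotient.quot (span (@bilinear_rel M))))%qT).
  rewrite -Quotient.idealrBE subr0 unfold_in /=; apply/asboolP => Z; apply.
  by left; exists 0, 0, a.
by move: e; rewrite addr0 subrr sub0r => /eqP; rewrite oppr_eq0 => /eqP.
Qed.

End Tensor.

(* Homological grading by $\mathbf Z$. The differentials are given between any
   two degrees and vanish unless the degree drops by one, which avoids
   transporting along equalities of indices. *)
Record complex := Complex {
  cx :> int -> zmodType;
  cxd : forall i j, {additive cx i -> cx j};
  cx_deg : forall i j, j + 1 != i -> forall x, cxd i j x = 0;
  cxdd : forall i j k x, cxd j k (cxd i j x) = 0 }.

Arguments cxd C i j : rename.

Record chain_map (C D : complex) := ChainMap {
  chm :> forall i, {additive C i -> D i};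
  chm_comm : forall i j x, chm j (cxd C i j x) = cxd D i j (chm i x) }.

Definition homology (C : complex) (i : int) : zmodType :=
  homology_at (cxd C (i + 1) i) (cxd C i (i - 1)).

(* $C[-1]$, with $C[-1]_i = C_{i+1}$. *)
Program Definition shift (C : complex) : complex :=
  @Complex (fun i => C (i + 1))
    (fun i j => \- (cxd C (i + 1) (j + 1)) : {additive _ -> _}) _ _.
Next Obligation.
move=> C i j ij x /=; apply/eqP; rewrite oppr_eq0; apply/eqP.
by apply: cx_deg; apply: contra_neq ij => /addIr.
Qed.
Next Obligation. by move=> C i j k x /=; rewrite raddfN /= opprK cxdd. Qed.

Program Definition tensor_complex (C : complex) (A : zmodType) : complex :=
  @Complex (fun i => tensor A (C i)) (fun i j => tensor_map A (cxd C i j)) _ _.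
Next Obligation.
move=> C A i j ij; apply: (@tensor_ext _ _ _ _ \0) => m a.
by rewrite tensor_mapE cx_deg // tens0.
Qed.
Next Obligation.
move=> C A i j k x.
apply: (@tensor_ext _ _ _ (tensor_map A (cxd C j k) \o tensor_map A (cxd C i j)) \0).
move=> m a; change (tensor_map A (cxd C j k) (tensor_map A (cxd C i j) (tens m a)) = 0).
by rewrite !tensor_mapE cxdd tens0.
Qed.

Section Transport.
Variables (I : eqType) (X : I -> zmodType).

(* The identity of [X i] when [i = j], and zero otherwise. *)
Definition transport (i j : I) (x : X i) : X j :=
  if i =P j is ReflectT e then ecast k (X k) e x else 0.

Arguments transport : clear implicits.

Lemma transport_id i x : transport i i x = x.
Proof.
rewrite /transport; case: (i =P i) => // e.
by rewrite (eq_axiomK e).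
Qed.

Lemma transport_neq i j x : i != j -> transport i j x = 0.
Proof. by rewrite /transport; case: (i =P j). Qed.

Lemma transport_additive i j : zmod_morphism (transport i j).
Proof.
have [<-|ij] := eqVneq i j; first by move=> x y; rewrite !transport_id.
by move=> x y; rewrite !transport_neq // subrr.
Qed.
HB.instance Definition _ i j :=
  GRing.isZmodMorphism.Build (X i) (X j) (transport i j) (@transport_additive i j).
End Transport.

Arguments transport {I} X i j x.

(* The mapping cone of $f : C\to D$: $\mathrm{cone}(f)_i = C_{i-1}\oplus D_i$
   with $d(c,x) = (-dc, f(c)+dx)$. *)
Section Cone.
Variables (C D : complex) (f : chain_map C D).

Definition cone_d (i j : int) (x : (C (i - 1) * D i)%type) : (C (j - 1) * D j)%type :=
  (- cxd C (i - 1) (j - 1) x.1,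
   transport D (i - 1) j (f (i - 1) x.1) + cxd D i j x.2).

Lemma cone_d_additive i j : zmod_morphism (@cone_d i j).
Proof.
move=> x y; rewrite /cone_d /= !raddfB /=; congr pair.
by rewrite /= opprD addrACA.
Qed.
HB.instance Definition _ i j := GRing.isZmodMorphism.Build
  (C (i - 1) * D i)%type (C (j - 1) * D j)%type
  (@cone_d i j) (@cone_d_additive i j).

Program Definition cone : complex :=
  @Complex (fun i => (C (i - 1) * D i)%type) cone_d _ _.
Next Obligation.
move=> i j ij x; rewrite /= /cone_d cx_deg; last first.
  by apply: contra_neq ij; rewrite subrK => ->; rewrite subrK.
rewrite oppr0 cx_deg // addr0 transport_neq //.
by apply: contra_neq ij => <-; rewrite subrK.
Qed.
Next Obligation.
move=> i j k x; rewrite /= /cone_d /= raddfN /= opprK cxdd.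
congr pair; rewrite raddfD /= cxdd addr0.
have [ij|ij] := eqVneq (i - 1) j; last first.
  rewrite (transport_neq (X := D) _ ij) raddf0 addr0 cx_deg ?oppr0 ?raddf0 //.
  by rewrite subrK eq_sym.
subst j; rewrite transport_id.
have [jk|jk] := eqVneq (i - 1 - 1) k; last first.
  rewrite (transport_neq (X := D) _ jk) add0r cx_deg //.
  by apply: contra_neq jk => <-; rewrite addrK.
by subst k; rewrite transport_id raddfN /= chm_comm addNr.
Qed.
End Cone.

(* The complex with $C_n$ in degree $n\ge 0$ and zero in negative degrees. *)
Section NatComplex.
Variables (C : nat -> zmodType) (d : forall n, {additive C n.+1 -> C n}).
Hypothesis dd : forall n x, d n (d n.+1 x) = 0.

Definition nat_cx (i : int) : zmodType := if i is Posz n then C n else 'I_1.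

Definition nat_cxd (i j : int) : nat_cx i -> nat_cx j :=
  match i return nat_cx i -> nat_cx j with
  | Posz n.+1 => fun x => transport nat_cx (Posz n) j (d n x)
  | _ => fun _ => 0
  end.

Lemma nat_cxd_additive i j : zmod_morphism (@nat_cxd i j).
Proof. by case: i => [[|n]|n] x y /=; rewrite ?subr0 // !raddfB. Qed.
HB.instance Definition _ i j := GRing.isZmodMorphism.Build
  (nat_cx i) (nat_cx j) (@nat_cxd i j) (@nat_cxd_additive i j).

Program Definition nat_complex : complex :=
  @Complex nat_cx nat_cxd _ _.
Next Obligation.
case=> [[|n]|n] j //= ij x; apply: transport_neq.
by apply: contra_neq ij => <-; rewrite -PoszD addn1.
Qed.
Next Obligation.
case=> [[|n]|n] j k x //=; rewrite ?raddf0 //.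
have [<-|nj] := eqVneq (Posz n) j; last by rewrite transport_neq // raddf0.
by rewrite transport_id; case: n x => [|n] x //=; rewrite dd raddf0.
Qed.
End NatComplex.

Section NatComplexMap.
Variables (C D : nat -> zmodType).
Variables (dC : forall n, {additive C n.+1 -> C n}) (dD : forall n, {additive D n.+1 -> D n}).
Hypotheses (ddC : forall n x, dC n (dC n.+1 x) = 0) (ddD : forall n x, dD n (dD n.+1 x) = 0).
Variable f : forall n, {additive C n -> D n}.
Hypothesis fd : forall n x, f n (dC n x) = dD n (f n.+1 x).

Definition nat_cm (i : int) : nat_cx C i -> nat_cx D i :=
  match i return nat_cx C i -> nat_cx D i with Posz n => f n | Negz _ => id end.

Lemma nat_cm_additive i : zmod_morphism (@nat_cm i).
Proof. by case: i => [n|n] x y //=; rewrite raddfB. Qed.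
HB.instance Definition _ i := GRing.isZmodMorphism.Build
  (nat_cx C i) (nat_cx D i) (@nat_cm i) (@nat_cm_additive i).

Program Definition nat_chain_map : chain_map (nat_complex ddC) (nat_complex ddD) :=
  @ChainMap _ _ nat_cm _.
Next Obligation.
case=> [[|n]|n] j x /=; rewrite ?(raddf0 (@nat_cm j)) //.
have [<-|nj] := eqVneq (Posz n) j; last by rewrite !transport_neq // raddf0.
by rewrite !transport_id /= fd.
Qed.
End NatComplexMap.

Lemma ordcat_arrow_eq (n : nat) (a b : arrow (ordcat n)) :
  src a = src b -> tgt a = tgt b -> a = b.
Proof.
case: a b => [x y f] [x' y' g] /= ex ey; subst x' y'.
by congr Arrow; exact: ordcat_hom_irr.
Qed.

Lemma Delta_ext (m n : nat) (a b : Delta m n) : (forall i, a i = b i) -> a = b.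
Proof. by move=> ab; apply: functor_ext => x y f; apply: ordcat_arrow_eq; exact: ab. Qed.

Lemma coface_comm (n : nat) (i i' : 'I_n.+3) (j j' : 'I_n.+2) :
  (j < i)%N -> i' = j :> nat -> i = j'.+1 :> nat ->
  functor_cmp (coface i) (coface j) = functor_cmp (coface i') (coface j').
Proof.
move=> ji ei ej; apply: Delta_ext => k; apply: val_inj; rewrite /= ei ej.
move: ji; rewrite ej /bump /=; case: (leqP j k); case: (leqP j' k); lia.
Qed.

Section SimplicialChains.
Variable X : sset.

Definition chains (n : nat) : zmodType := {freeg {classic X n} / int}.

Definition face (n : nat) (i : 'I_n.+2) : {additive chains n.+1 -> chains n} :=
  @free_map {classic X n.+1} {classic X n} (sact X (coface i)).

Definition bdry (n : nat) (x : chains n.+1) : chains n :=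
  \sum_(i < n.+2) (-1) ^+ i *: face i x.

Lemma bdry_additive n : zmod_morphism (@bdry n).
Proof.
move=> x y; rewrite /bdry -sumrB; apply: eq_bigr => i _.
by rewrite raddfB scalerBr.
Qed.
HB.instance Definition _ n := GRing.isZmodMorphism.Build
  (chains n.+1) (chains n) (@bdry n) (@bdry_additive n).

Lemma faceU n (i : 'I_n.+2) (x : {classic X n.+1}) :
  face i << x >> = << (sact X (coface i) x : {classic X n}) >>.
Proof. exact: free_mapU. Qed.

Lemma face_faceE n (i : 'I_n.+2) (j : 'I_n.+3) (c : int) (x : {classic X n.+2}) :
  face i (c *: face j << x >>) =
  c *: << (sact X (functor_cmp (coface j) (coface i)) x : {classic X n}) >>.
Proof. by rewrite -[c]intz !scaler_int raddfMz !faceU sact_cmp. Qed.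

Lemma bdryK n x : @bdry n (@bdry n.+1 x) = 0.
Proof.
apply: (@free_ext _ _ (@bdry n \o @bdry n.+1) \0) => {}x.
change (bdry (bdry << x >>) = 0); rewrite /bdry.
under eq_bigr => i _.
  rewrite raddf_sum; under eq_bigr => j _ do rewrite face_faceE.
  rewrite scaler_sumr; under eq_bigr => j _ do rewrite scalerA -exprD.
over.
rewrite pair_bigA /= (bigID (fun p : 'I_n.+2 * 'I_n.+3 => (p.1 < p.2)%N)) /=.
pose h (p : 'I_n.+2 * 'I_n.+3) : 'I_n.+2 * 'I_n.+3 :=
  if (p.1 < p.2)%N then (inord p.2.-1, inord p.1) else (inord p.2, inord p.1.+1).
have hK p : h (h p) = p.
  case: p => i j; rewrite /h /=; have ii := ltn_ord i; have jj := ltn_ord j.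
  case: (ltnP i j) => ij /=; rewrite !inordK; try lia.
    rewrite ifF; last by lia.
    by congr pair; apply: val_inj; rewrite /= inordK; lia.
  rewrite ifT; last by lia.
  by congr pair; apply: val_inj; rewrite /= inordK; lia.
rewrite [X in _ + X](reindex_inj (can_inj hK)) /= addrC.
rewrite (eq_bigl (fun p : 'I_n.+2 * 'I_n.+3 => (p.1 < p.2)%N)); last first.
  case=> i j; rewrite /h /=; have ii := ltn_ord i; have jj := ltn_ord j.
  by case: (ltnP i j) => ij /=; rewrite !inordK; lia.
rewrite -big_split big1 // => -[i j] /= ij.
have ii := ltn_ord i; have jj := ltn_ord j.
rewrite /h /= ij /=.
rewrite (@coface_comm n j (inord i) i (inord j.-1)) ?inordK //; try lia.
have -> : (i + j)%N = (j.-1 + i).+1 by lia.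
by rewrite exprS mulN1r scaleNr addrN.
Qed.

End SimplicialChains.

Definition sset_complex (X : sset) : complex := nat_complex (@bdryK X).

Section SimplicialChainMap.
Variables (X Y : sset) (f : smap X Y).

Definition chains_map (n : nat) : {additive chains X n -> chains Y n} :=
  @free_map {classic X n} {classic Y n} (f n).

Lemma chains_mapU n (x : {classic X n}) :
  chains_map n << x >> = << (f n x : {classic Y n}) >>.
Proof. exact: free_mapU. Qed.

Lemma chains_map_bdry n x : chains_map n (@bdry X n x) = @bdry Y n (chains_map n.+1 x).
Proof.
apply: (@free_ext _ _ (chains_map n \o @bdry X n) (@bdry Y n \o chains_map n.+1)) => {}x.
change (chains_map n (bdry (<< x >> : chains X n.+1)) = bdry (chains_map n.+1 << x >>)).
rewrite chains_mapU /bdry raddf_sum; apply: eq_bigr => i _.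
rewrite -[(-1) ^+ i]intz !scaler_int raddfMz !faceU; congr (_ *~ _).
by rewrite chains_mapU smap_nat.
Qed.

Definition sset_chain_map : chain_map (sset_complex X) (sset_complex Y) :=
  nat_chain_map (@bdryK X) (@bdryK Y) chains_map_bdry.
End SimplicialChainMap.

Definition cat_homology (E : category) (A : zmodType) (i : int) : zmodType :=
  homology (tensor_complex (sset_complex (nerve E)) A) i.

(* The map of complexes induced by the natural transformation from $\mathbf F$
   to the constant functor [pt], the terminal category: as the nerve of [pt] has
   one simplex in each degree, the diagonal of $N(\mathcal E,pt)$ is
   $N(\mathcal E)$ and the map forgets the second component. *)
Definition aug (E : category) (F : catfunctor E) :
    chain_map (sset_complex (diagonal (bnerve F))) (sset_complex (nerve E)) :=
  sset_chain_map (bnerve_proj F).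

(* The mapping-cone definition is used for every [F], including those with all
   values nonempty, where it is homotopy equivalent to the kernel of [aug F]. *)
Definition reduced_complex (E : category) (F : catfunctor E) (A : zmodType) : complex :=
  tensor_complex (shift (cone (aug F))) A.

Definition reduced_homology (E : category) (F : catfunctor E) (A : zmodType)
    (i : int) : zmodType :=
  homology (reduced_complex F A) i.

(* Homological type: $d^r$ has bidegree $(-r,r-1)$. Only the pages $r\ge 1$ are
   part of the spectral sequence: [page 0] plays no role. *)
Record spectral_sequence := SpectralSequence {
  page :> nat -> int -> int -> zmodType;
  ssd : forall r p q p' q', {additive page r p q -> page r p' q'};
  ssd_deg : forall r p q p' q',
    (p' != p - r%:Z) || (q' != q + r%:Z - 1) -> forall x, ssd r p q p' q' x = 0;
  ssdd : forall r p q p' q' p'' q'' x,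
    ssd r p' q' p'' q'' (ssd r p q p' q' x) = 0;
  next_page : forall r p q, (0 < r)%N ->
    zmod_iso
      (homology_at (ssd r (p + r%:Z) (q - r%:Z + 1) p q)
                   (ssd r p q (p - r%:Z) (q + r%:Z - 1)))
      (page r.+1 p q) }.

Arguments ssd E r p q p' q' : rename.
Arguments next_page : clear implicits.

Section Einfty.
Variables (E : spectral_sequence) (p q : int).

(* [survives k x y]: the element [x] of $E^1_{p,q}$ lies in the kernel of
   $d^1,\dots,d^k$ and represents the element [y] of $E^{k+1}_{p,q}$. *)
Fixpoint survives (k : nat) : E 1%N p q -> E k.+1 p q -> Prop :=
  match k return E 1%N p q -> E k.+1 p q -> Prop with
  | 0 => fun x y => x = y
  | k'.+1 => fun x y => exists z, survives x z /\
      exists zK : z \in kernel (ssd E k'.+1 p q (p - k'.+1%:Z) (q + k'.+1%:Z - 1)),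
        next_page E k'.+1 p q isT
          (subquot_class (image_grp (ssd E k'.+1 (p + k'.+1%:Z) (q - k'.+1%:Z + 1) p q)) zK)
        = y
  end.

Lemma survivesB k x x' y y' :
  @survives k x y -> @survives k x' y' -> survives (x - x') (y - y').
Proof.
elim: k y y' => [|k IH] y y' /=; first by move=> -> ->.
move=> [z [xz [zK <-]]] [z' [xz' [zK' <-]]]; exists (z - z'); split; first exact: IH.
exists (rpredB zK zK'); rewrite -raddfB /subquot_class -raddfB.
by congr (next_page _ _ _ _ _ (\pi_(_)%qT _)); apply: val_inj.
Qed.

Lemma survives_step0 k x : @survives k x 0 -> @survives k.+1 x 0.
Proof.
move=> xk; exists 0; split=> //; exists (rpred0 _).
rewrite -[RHS](raddf0 (next_page E k.+1 p q isT)); congr (next_page _ _ _ _ _ _).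
rewrite /subquot_class -[RHS](raddf0 (\pi_(Quotient.quot _))%qT).
by congr (\pi_(_)%qT _); apply: val_inj.
Qed.

Lemma survives_add0 k m x : @survives k x 0 -> @survives (m + k) x 0.
Proof. by move=> xk; elim: m => // m; exact: survives_step0. Qed.

Lemma survives0 k : @survives k 0 0.
Proof. by elim: k => // k; exact: survives_step0. Qed.

(* $Z^\infty_{p,q} = \bigcap_r Z^r_{p,q}$ and
   $B^\infty_{p,q} = \bigcup_r B^r_{p,q}$ as subgroups of $E^1_{p,q}$. *)
Definition Zinf_pred (x : E 1%N p q) : bool :=
  `[< forall k, exists y, @survives k x y >].
Definition Binf_pred (x : E 1%N p q) : bool :=
  `[< exists k, @survives k x 0 >].

Lemma Zinf_closed : zmod_closed Zinf_pred.
Proof.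
split=> [|x y]; rewrite !unfold_in /Zinf_pred.
  by apply/asboolP => k; exists 0; exact: survives0.
move=> /asboolP xZ /asboolP yZ; apply/asboolP => k.
have [[x' hx] [y' hy]] := (xZ k, yZ k).
by exists (x' - y'); exact: survivesB.
Qed.
HB.instance Definition _ := GRing.isZmodClosed.Build (E 1%N p q) Zinf_pred Zinf_closed.

Lemma Binf_closed : zmod_closed Binf_pred.
Proof.
split=> [|x y]; rewrite !unfold_in /Binf_pred.
  by apply/asboolP; exists 0%N.
move=> /asboolP[k xk] /asboolP[l yl]; apply/asboolP; exists (l + k)%N.
rewrite -[0]subr0; apply: survivesB; first exact: survives_add0.
by rewrite addnC; exact: survives_add0.
Qed.
HB.instance Definition _ := GRing.isZmodClosed.Build (E 1%N p q) Binf_pred Binf_closed.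

Definition Einfty : zmodType :=
  subquot (GRing.ZmodClosed.clone (E 1%N p q) Zinf_pred _)
          (GRing.ZmodClosed.clone (E 1%N p q) Binf_pred _).

End Einfty.

(* $E\Rightarrow H$ by means of an exhaustive filtration, bounded below in each
   degree (hence Hausdorff and complete). *)
Definition converges (E : spectral_sequence) (H : int -> zmodType) : Prop :=
  exists F : forall n : int, int -> zmodClosed (H n),
    [/\ forall n p x, x \in F n p -> x \in F n (p + 1),
        forall n, exists p, forall x, x \in F n p -> x = 0,
        forall n x, exists p, x \in F n p
      & forall p q, inhabited
          (zmod_iso (Einfty E p q) (subquot (F (p + q) p) (F (p + q) (p - 1))))].

Definition is_set_colimit (X : nat -> Type) (t : forall n, X n -> X n.+1)
    (L : Type) (j : forall n, X n -> L) : Prop :=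
  (forall n x, j n.+1 (t n x) = j n x) /\
  forall (M : Type) (k : forall n, X n -> M),
    (forall n x, k n.+1 (t n x) = k n x) ->
    exists! u : L -> M, forall n x, u (j n x) = k n x.

(* The naive colimit: both the set of objects and the set of morphisms are the
   colimits of the corresponding sequences of sets. *)
Definition is_naive_colimit (Q : nat -> category) (T : forall n, functor (Q n) (Q n.+1))
    (L : category) (J : forall n, functor (Q n) L) : Prop :=
  is_set_colimit (fun n => fob (T n)) (fun n => fob (J n)) /\
  is_set_colimit (fun n => amap (T n)) (fun n => amap (J n)).

(* Main.v *)
(* Filter the chains on the nerve of $\mathcal Q$ by the level of their last vertex. As
   the $T_n$ are cellular, the objects of level $\le p$ form a sieve, so these are
   subcomplexes, and the spectral sequence of the filtration converges. It remains to
   compare the graded piece $G$, whose generators are the chains with last vertex of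
   level exactly $p$, with the cone of $C_*(\mathcal E,\mathbf F_p)\to C_*(\mathcal E)$
   for $\mathcal E=\mathcal Q_p-\mathcal Q_{p-1}$. A simplex of the diagonal of
   $N(\mathcal E,\mathbf F_p)$ is a chain $c_0\to\dots\to c_m\to d_0\to\dots\to d_m$ with
   $c_j\in\mathcal Q_{p-1}$ and $d_j\in\mathcal E$, and every chain of $G$ is uniquely
   $c_1\to\dots\to c_a\to e_0\to\dots\to e_B$. Both span subcomplexes of one total
   complex, whose further generators are $c_0\to\dots\to c_m\to d_0\to\dots\to d_m\to
   e_1\to\dots\to e_B$ and $d_0\to\dots\to d_m\to e_1\to\dots\to e_B$. Prepending $d_m$
   to the $e$'s contracts these along $B$ and leaves $G$; for $B>0$, replacing the $d$'s
   by copies of $e_1$ contracts them along $m$ and leaves the cone. Since the functors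
   need not be injective on objects, the vertices $c_j$ and $d_j$ carry a lift to
   $\mathcal Q_{p-1}$ and $\mathcal E$, whereas those of the chains of $G$ do not. *)

From HB Require Import structures.
From mathcomp Require Import all_boot all_order all_algebra.
From mathcomp Require Import boolp zify.
From mathcomp.multinomials Require Import freeg.
Require Import Defs.

Set Implicit Arguments.
Unset Strict Implicit.
Unset Printing Implicit Defensive.

Import Order.TTheory GRing.Theory Num.Theory.
Local Open Scope ring_scope.

(** * Subquotients *)

(** A diagonal simplex of degree $m$ has $2m+2$ vertices, whereas the chains of $G$ it should
    correspond to have $m+2$; so the comparison is not simplexwise. In the total complex every
    structure map merely forgets, deletes or repeats vertices. No spectral sequence of a double
    complex is invoked: for each of the two subcomplexes it is shown that a homogeneous element
    whose boundary lies in the subcomplex can be moved into it by subtracting a boundary. Being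
    homologous in the total complex is then an additive relation between relative cycles of $G$ and
    cycles of the cone, and it induces the isomorphism. The words starting with $c$'s cannot be
    contracted along $m$ by an extra degeneracy, because $c_i$ and $d_i$ are deleted together while
    the $c$'s survive and the $d$'s collapse; a genuine simplicial homotopy is needed. It must also
    replace the lifts of the $c_j$ by chosen ones, as $G$ remembers none. Finally, $\mathcal Q$ is
    known only through a universal property for sets, so full faithfulness of $\mathcal
    Q_n\to\mathcal Q$ and the sieve property have to be derived from it. *)

Lemma kernelE (M N : zmodType) (f : {additive M -> N}) x : (x \in kernel f) = (f x == 0).
Proof. by rewrite unfold_in. Qed.

Lemma image_grpP (M N : zmodType) (f : {additive M -> N}) y :
  reflect (exists x, f x = y) (y \in image_grp f).
Proof. by rewrite [y \in _]unfold_in; exact: asboolP. Qed.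

Lemma addrKl (M : zmodType) (x y : M) : x + y - x = y.
Proof. by rewrite addrC addKr. Qed.

Section Subquotients.
Variables (M : zmodType) (Z B : zmodClosed M).

Lemma subquot_class_eq x y (xZ : x \in Z) (yZ : y \in Z) :
  x = y -> subquot_class B xZ = subquot_class B yZ.
Proof. by move=> e; subst y; rewrite (bool_irrelevance xZ yZ). Qed.

Lemma subquot_classB x y (xZ : x \in Z) (yZ : y \in Z) :
  subquot_class B (rpredB xZ yZ) = subquot_class B xZ - subquot_class B yZ.
Proof. by rewrite /subquot_class -raddfB; congr (\pi_(_)%qT _); apply: val_inj. Qed.

Lemma subquot_class0 x (xZ : x \in Z) : (subquot_class B xZ == 0) = (x \in B).
Proof.
rewrite /subquot_class -[0](raddf0 (\pi_(Quotient.quot (trace_grp Z B)))%qT).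
by rewrite -Quotient.idealrBE subr0.
Qed.

Lemma subquot_class_eqE x y (xZ : x \in Z) (yZ : y \in Z) :
  (subquot_class B xZ == subquot_class B yZ) = (x - y \in B).
Proof. by rewrite -subr_eq0 -subquot_classB subquot_class0. Qed.

Lemma subquot_surj (xi : subquot Z B) : exists x (xZ : x \in Z), xi = subquot_class B xZ.
Proof.
exists (sub_val (repr xi)), (sub_valP (repr xi)).
rewrite -[LHS]reprK /subquot_class; congr (\pi_(_)%qT _); exact: val_inj.
Qed.

End Subquotients.

Section SubquotientMap.
Variables (M N : zmodType) (Z B : zmodClosed M) (Z' B' : zmodClosed N).
Variable f : {additive M -> N}.
Hypothesis fZ : forall x, x \in Z -> f x \in Z'.
Hypothesis fB : forall x, x \in Z -> x \in B -> f x \in B'.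

Let g (x : subgrp Z) : subquot Z' B' := subquot_class B' (fZ (sub_valP x)).

Let g_additive : zmod_morphism g.
Proof.
move=> x y; rewrite /g -subquot_classB; apply: subquot_class_eq.
exact: raddfB.
Qed.
HB.instance Definition _ := GRing.isZmodMorphism.Build (subgrp Z) (subquot Z' B') g g_additive.

Let g_trace x : x \in trace_grp Z B -> g x = 0.
Proof. by move=> xB; apply/eqP; rewrite subquot_class0 fB // sub_valP. Qed.

Definition subquot_map : {additive subquot Z B -> subquot Z' B'} := quot_lift g_trace.

Lemma subquot_mapE x (xZ : x \in Z) :
  subquot_map (subquot_class B xZ) = subquot_class B' (fZ xZ).
Proof. by apply: etrans (quot_liftE g_trace _) _; exact: subquot_class_eq. Qed.
End SubquotientMap.

(* Additive relations instead of maps, since several of the isomorphisms below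
   are induced by zigzags. *)
Lemma subquot_rel_iso (M N : zmodType) (Z B : zmodClosed M) (Z' B' : zmodClosed N)
    (R : M -> N -> Prop) :
  (forall x x' y y', R x y -> R x' y' -> R (x - x') (y - y')) ->
  (forall x, x \in Z -> exists2 y, y \in Z' & R x y) ->
  (forall y, y \in Z' -> exists2 x, x \in Z & R x y) ->
  (forall x y, x \in Z -> y \in Z' -> R x y -> (x \in B <-> y \in B')) ->
  {phi : zmod_iso (subquot Z B) (subquot Z' B') |
    forall x y (xZ : x \in Z) (yZ : y \in Z'), R x y ->
      phi (subquot_class B xZ) = subquot_class B' yZ}.
Proof.
move=> RB Rl Rr Rc.
(* Closure of [R] under differences reduces equality of classes to membership in [B] and [B']. This
   yields both that [phi] is well defined and that it is injective. *)
have wd x x' y y' (xZ : x \in Z) (x'Z : x' \in Z) (yZ : y \in Z') (y'Z : y' \in Z') :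
    R x y -> R x' y' -> (subquot_class B xZ == subquot_class B x'Z) =
      (subquot_class B' yZ == subquot_class B' y'Z).
  move=> xy xy'; rewrite !subquot_class_eqE.
  by apply/idP/idP; apply Rc; rewrite ?rpredB //; exact: RB.
have ex (xi : subquot Z B) : exists eta : subquot Z' B', exists x y (xZ : x \in Z)
    (yZ : y \in Z'), [/\ R x y, xi = subquot_class B xZ & eta = subquot_class B' yZ].
  have [x [xZ ->]] := subquot_surj xi; have [y yZ xy] := Rl _ xZ.
  by exists (subquot_class B' yZ), x, y, xZ, yZ.
have [phi phiP] := choice ex.
have phiE x y (xZ : x \in Z) (yZ : y \in Z') : R x y ->
    phi (subquot_class B xZ) = subquot_class B' yZ.
  move=> xy; have [x' [y' [x'Z [y'Z [xy' ex' ->]]]]] := phiP (subquot_class B xZ).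
  by apply/eqP; rewrite -(wd _ _ _ _ x'Z xZ y'Z yZ xy' xy) ex'.
have phiB : zmod_morphism phi.
  move=> xi eta; have [x [y [xZ [yZ [xy -> ->]]]]] := phiP xi.
  have [x' [y' [x'Z [y'Z [xy' -> ->]]]]] := phiP eta.
  by rewrite -!subquot_classB; apply: phiE; exact: RB.
pose phi' : {additive subquot Z B -> subquot Z' B'} :=
  HB.pack phi (GRing.isZmodMorphism.Build _ _ phi phiB).
have inj : injective phi'.
  move=> xi eta; have [x [y [xZ [yZ [xy -> e1]]]]] := phiP xi.
  have [x' [y' [x'Z [y'Z [xy' -> e2]]]]] := phiP eta.
  by rewrite /= (phiE _ _ _ yZ xy) (phiE _ _ _ y'Z xy') => /eqP;
     rewrite -(wd _ _ _ _ xZ x'Z yZ y'Z xy xy') => /eqP.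
have surj (eta : subquot Z' B') : exists xi, phi' xi == eta.
  have [y [yZ ->]] := subquot_surj eta; have [x xZ xy] := Rr _ yZ.
  by exists (subquot_class B xZ); rewrite /= (phiE _ _ _ yZ xy).
have bij : bijective phi'.
  exists (fun eta => xchoose (surj eta)) => [xi|eta]; last exact/eqP/(xchooseP (surj eta)).
  by apply: inj; exact/eqP/(xchooseP (surj (phi' xi))).
by exists (ZmodIso bij); exact: phiE.
Qed.

(** * The spectral sequence of a filtered complex *)

Section FilteredComplex.
Variables (M : complex) (F : int -> forall i, zmodClosed (M i)).
Hypothesis F_mono : forall p i x, x \in F p i -> x \in F (p + 1) i.
Hypothesis F_bound : forall p i x, p <= 0 -> x \in F p i -> x = 0.
Hypothesis F_exhaust : forall i x, exists p, x \in F p i.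

Lemma filtration_le p p' i x : p <= p' -> x \in F p i -> x \in F p' i.
Proof.
move=> pp' xF; rewrite -(subrK p p') addrC.
have : 0 <= p' - p by rewrite subr_ge0.
case: (p' - p) => // n _; elim: n => [|n IH]; first by rewrite addr0.
by rewrite -addn1 PoszD addrA; exact: F_mono.
Qed.

(** The group $Z^r_p=\{x\in F_p : dx\in F_{p-r}\}$. Quantifying over all target degrees avoids
    naming the only relevant one, $i-1$. *)
Definition zcyc_pred (r p i : int) (x : M i) : bool :=
  (x \in F p i) && `[< forall j, cxd M i j x \in F (p - r) j >].
Lemma zcyc_closed r p i : zmod_closed (@zcyc_pred r p i).
Proof.
split=> [|x y]; rewrite ![_ \in @zcyc_pred _ _ _]unfold_in /zcyc_pred.
  by apply/andP; split; rewrite ?rpred0 //; apply/asboolP => j; rewrite raddf0 rpred0.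
move=> /andP[xF /asboolP dx] /andP[yF /asboolP dy].
apply/andP; split; first exact: rpredB.
by apply/asboolP => j; rewrite raddfB; apply: rpredB; [exact: dx | exact: dy].
Qed.
HB.instance Definition _ r p i :=
  GRing.isZmodClosed.Build (M i) (@zcyc_pred r p i) (@zcyc_closed r p i).
Definition zcyc r p i : zmodClosed (M i) :=
  GRing.ZmodClosed.clone (M i) (@zcyc_pred r p i) _.

Lemma zcycP r p i x :
  reflect (x \in F p i /\ forall j, cxd M i j x \in F (p - r) j) (x \in zcyc r p i).
Proof.
rewrite [x \in _]unfold_in /= /zcyc_pred.
apply: (iffP andP) => -[xF dx]; split=> //; first exact/asboolP.
exact/asboolP.
Qed.

(** The denominator $Z^{r-1}_{p-1}+dZ^{r-1}_{p+r-1}$ of $E^r_p$. The degree [j] is bound by an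
    equation so that it can be replaced by an equal expression without transport. *)
Definition bcyc_pred (r p i : int) (x : M i) : bool :=
  `[< exists2 w, w \in zcyc (r - 1) (p - 1) i &
      exists2 j, i + 1 = j & exists2 v, v \in zcyc (r - 1) (p + r - 1) j &
      x = w + cxd M j i v >].
Lemma bcyc_closed r p i : zmod_closed (@bcyc_pred r p i).
Proof.
split=> [|x y]; rewrite ![_ \in @bcyc_pred _ _ _]unfold_in /bcyc_pred.
  apply/asboolP; exists 0; rewrite ?rpred0 //; exists (i + 1) => //.
  by exists 0; rewrite ?rpred0 // raddf0 addr0.
move=> /asboolP[w wZ [j <- [v vZ ->]]] /asboolP[w' w'Z [j' <- [v' v'Z ->]]].
apply/asboolP; exists (w - w'); first exact: rpredB.
exists (i + 1) => //; exists (v - v'); first exact: rpredB.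
by rewrite raddfB opprD addrACA.
Qed.
HB.instance Definition _ r p i :=
  GRing.isZmodClosed.Build (M i) (@bcyc_pred r p i) (@bcyc_closed r p i).
Definition bcyc r p i : zmodClosed (M i) :=
  GRing.ZmodClosed.clone (M i) (@bcyc_pred r p i) _.

Lemma bcycP r p i x :
  reflect (exists2 w, w \in zcyc (r - 1) (p - 1) i &
      exists2 j, i + 1 = j & exists2 v, v \in zcyc (r - 1) (p + r - 1) j &
      x = w + cxd M j i v) (x \in bcyc r p i).
Proof. rewrite [x \in _]unfold_in /= /bcyc_pred; exact: asboolP. Qed.

Definition fpage (r : nat) (p q : int) : zmodType :=
  subquot (zcyc r%:Z p (p + q)) (bcyc r%:Z p (p + q)).

Definition fdiff0 (r : nat) (p q p' q' : int) : {additive M (p + q)%R -> M (p' + q')%R} :=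
  if (p' == p - r%:Z) && (q' == q + r%:Z - 1) then cxd M (p + q) (p' + q') else \0.

Lemma fdiff0_zcyc r p q p' q' x :
  x \in zcyc r%:Z p (p + q) -> fdiff0 r p q p' q' x \in zcyc r%:Z p' (p' + q').
Proof.
rewrite /fdiff0; case: ifP => [/andP[/eqP-> _]|_] => [/zcycP[xF dx]|_]; last exact: rpred0.
by apply/zcycP; split=> [|j]; [exact: dx | rewrite cxdd rpred0].
Qed.

Lemma fdiff0_bcyc r p q p' q' x :
  x \in zcyc r%:Z p (p + q) -> x \in bcyc r%:Z p (p + q) ->
  fdiff0 r p q p' q' x \in bcyc r%:Z p' (p' + q').
Proof.
rewrite /fdiff0; case: ifP => [/andP[/eqP ep /eqP eq]|_] xZ; last by rewrite rpred0.
move=> /bcycP[w wZ [j _ [v vZ ->]]]; rewrite raddfD /= cxdd addr0.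
apply/bcycP; exists 0; first exact: rpred0.
exists (p + q); first by rewrite ep eq; lia.
by exists w; rewrite ?add0r // ep subrK.
Qed.

Definition fdiff (r : nat) (p q p' q' : int) : {additive fpage r p q -> fpage r p' q'} :=
  subquot_map (@fdiff0_zcyc r p q p' q') (@fdiff0_bcyc r p q p' q').

Lemma fdiffE r p q x (xZ : x \in zcyc r%:Z p (p + q)) p' q' :
  p' = p - r%:Z -> q' = q + r%:Z - 1 ->
  exists xZ' : cxd M (p + q) (p' + q') x \in zcyc r%:Z p' (p' + q'),
    fdiff r p q p' q' (subquot_class _ xZ) = subquot_class _ xZ'.
Proof.
move=> ep eq; have := fdiff0_zcyc p' q' xZ; rewrite /fdiff0 ep eq !eqxx => xZ'.
exists xZ'; rewrite subquot_mapE; apply: subquot_class_eq.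
by rewrite /fdiff0 !eqxx.
Qed.

Lemma fdiff_deg r p q p' q' :
  (p' != p - r%:Z) || (q' != q + r%:Z - 1) -> forall x, fdiff r p q p' q' x = 0.
Proof.
move=> ne x; have [y [yZ ->]] := subquot_surj x; apply/eqP.
rewrite subquot_mapE subquot_class0 /fdiff0 ifF ?rpred0 //.
by apply/negbTE; rewrite negb_and.
Qed.

Lemma fdiffK r p q p' q' p'' q'' x : fdiff r p' q' p'' q'' (fdiff r p q p' q' x) = 0.
Proof.
have [y [yZ ->]] := subquot_surj x; apply/eqP.
rewrite !subquot_mapE subquot_class0 /fdiff0; case: ifP => _; last by rewrite rpred0.
by case: ifP => _; rewrite ?cxdd ?rpred0 // raddf0 rpred0.
Qed.

Definition represents (r : nat) (p q : int) (xi : fpage r p q) (x : M (p + q)) : Prop :=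
  exists xZ : x \in zcyc r%:Z p (p + q), xi = subquot_class _ xZ.

Lemma represents0 r p q (xi : fpage r p q) x :
  represents xi x -> (xi == 0) = (x \in bcyc r%:Z p (p + q)).
Proof. by move=> [xZ ->]; rewrite subquot_class0. Qed.

Lemma representsB r p q (xi xi' : fpage r p q) x x' :
  represents xi x -> represents xi' x' -> represents (xi - xi') (x - x').
Proof. by move=> [xZ ->] [xZ' ->]; exists (rpredB xZ xZ'); rewrite subquot_classB. Qed.

Lemma zcyc_le r r' p p' i x : r' <= r -> p' - r' >= p - r -> p <= p' ->
  x \in zcyc r p i -> x \in zcyc r' p' i.
Proof.
move=> r'r pr pp' /zcycP[xF dxF]; apply/zcycP; split; first exact: filtration_le xF.
by move=> j; apply: filtration_le (dxF j).
Qed.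

Lemma zcyc_bcyc r p i w : w \in zcyc (r - 1) (p - 1) i -> w \in bcyc r p i.
Proof.
move=> wZ; apply/bcycP; exists w => //; exists (i + 1) => //.
by exists 0; rewrite ?rpred0 // raddf0 addr0.
Qed.

(** If $d^r[z]=0$, then $dz=w+dv$ with $v\in Z^{r-1}_{p-1}$ and $w\in F_{p-r-1}$. The corrected
    representative $z-v$ has boundary $w$, hence lies in $Z^{r+1}_p$. *)
Lemma fdiff_kernel r p q z (zZ : z \in zcyc r%:Z p (p + q)) :
  subquot_class (bcyc r%:Z p (p + q)) zZ
    \in kernel (fdiff r p q (p - r%:Z) (q + r%:Z - 1)) ->
  exists2 x, x \in zcyc r.+1%:Z p (p + q) & z - x \in zcyc (r%:Z - 1) (p - 1) (p + q).
Proof.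
rewrite kernelE.
have [dzZ ->] := fdiffE zZ erefl erefl; rewrite subquot_class0.
move=> /bcycP[w wZ [j ej [v vZ edz]]].
have {}ej : j = p + q by rewrite -ej; lia.
subst j; have {}vZ : v \in zcyc (r%:Z - 1) (p - 1) (p + q).
  by move: vZ; apply: zcyc_le; lia.
exists (z - v); last by have -> : z - (z - v) = v by rewrite opprB addrCA subrr addr0.
move/zcycP: (zZ) => [zF dzF]; move/zcycP: vZ => [vF dvF].
apply/zcycP; split; first by apply: rpredB => //; apply: filtration_le vF; lia.
move=> k; have [ek|ek] := eqVneq (k + 1) (p + q); last by rewrite cx_deg // rpred0.
have {}ek : k = p - r%:Z + (q + r%:Z - 1) by lia.
subst k; rewrite raddfB /= edz addrK; move/zcycP: wZ => [wF _].
by apply: filtration_le wF; lia.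
Qed.

Lemma zcyc_kernel r p q x (xZ : x \in zcyc r%:Z p (p + q)) : x \in zcyc r.+1%:Z p (p + q) ->
  subquot_class (bcyc r%:Z p (p + q)) xZ
    \in kernel (fdiff r p q (p - r%:Z) (q + r%:Z - 1)).
Proof.
move=> /zcycP[xF dxF]; have [dxZ edx] := fdiffE xZ erefl erefl.
rewrite kernelE edx subquot_class0; apply: zcyc_bcyc.
apply/zcycP; split; first by apply: filtration_le (dxF _); lia.
by move=> j; rewrite cxdd rpred0.
Qed.

(** The isomorphism is induced by the relation [represents]. That it preserves representatives is
    recorded in the sigma type, because [survivesP] has to follow one element through all pages. *)
Lemma fnext_page_ex r p q : (0 < r)%N ->
  {phi : zmod_iso
    (homology_at (fdiff r (p + r%:Z) (q - r%:Z + 1) p q)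
                 (fdiff r p q (p - r%:Z) (q + r%:Z - 1)))
    (fpage r.+1 p q) |
   forall xi x (xiK : xi \in kernel (fdiff r p q (p - r%:Z) (q + r%:Z - 1)))
     (xZ : x \in zcyc r.+1%:Z p (p + q)), represents xi x ->
     phi (subquot_class _ xiK) = subquot_class _ xZ}.
Proof.
move=> r0; apply: subquot_rel_iso.
- by move=> *; exact: representsB.
- move=> xi xiK; have [z [zZ exi]] := subquot_surj xi; subst xi.
  have [x xZ zxZ] := fdiff_kernel xiK; exists x => //.
  have xZ' : x \in zcyc r%:Z p (p + q) by move: xZ; apply: zcyc_le; lia.
  by exists xZ'; apply/eqP; rewrite subquot_class_eqE; exact: zcyc_bcyc.
- move=> x /zcycP[xF dxF].
  have xZ : x \in zcyc r%:Z p (p + q).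
    by apply/zcycP; split=> // j; apply: filtration_le (dxF j); lia.
  exists (subquot_class _ xZ); last by exists xZ.
  by apply: zcyc_kernel; apply/zcycP.
- move=> xi x _ /zcycP[xF dxF] [xZ ->]; split.
  + move=> /image_grpP[eta].
    have [v [vZ ->]] := subquot_surj eta.
    have [||dvZ -> /eqP] := fdiffE vZ (p' := p) (q' := q); try lia.
    (* Here $x-dv=w+dv'$, so $dw=dx$, which puts $w$ in $Z^r_{p-1}$; the boundary term becomes
       $d(v+v')$. *)
    rewrite subquot_class_eqE -opprB rpredN => /bcycP[w wZ [j <- [v' v'Z edx]]].
    move/zcycP: v'Z => [v'F dv'F]; move/zcycP: wZ => [wF dwF]; move/zcycP: vZ => [vF dvF].
    apply/bcycP; exists w.
      apply/zcycP; split; first by apply: filtration_le wF; lia.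
      move=> k; have -> : w = x - cxd M _ (p + q) v - cxd M _ _ v' by rewrite edx addrK.
      by rewrite !raddfB /= !cxdd !subr0; apply: filtration_le (dxF k); lia.
    have ej : p + r%:Z + (q - r%:Z + 1) = p + q + 1 by lia.
    exists (p + r%:Z + (q - r%:Z + 1)); first by rewrite ej.
    (* The degree of [v] is generalized, so that [v] and [v'] come to live in the same group and can
       be added. *)
    move: (p + r%:Z + (q - r%:Z + 1)) ej v vF dvF edx dvZ => j' ej; subst j' => v vF dvF edx dvZ.
    exists (v + v').
      apply/zcycP; split.
        by apply: rpredD; [apply: filtration_le vF | apply: filtration_le v'F]; lia.
      by move=> k; rewrite raddfD; apply: rpredD;
        [apply: filtration_le (dvF k) | apply: filtration_le (dv'F k)]; lia.
    by move/eqP: edx; rewrite subr_eq raddfD /= => /eqP ->; rewrite -addrA [X in w + X]addrC.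
  + move=> /bcycP[w wZ [j ej [v vZ ex]]].
    have {}ej : j = p + r%:Z + (q - r%:Z + 1) by rewrite -ej; lia.
    subst j; have vZ' : v \in zcyc r%:Z (p + r%:Z) (p + r%:Z + (q - r%:Z + 1)).
      by move: vZ; apply: zcyc_le; lia.
    apply/image_grpP; exists (subquot_class _ vZ').
    have [||dvZ ->] := fdiffE vZ' (p' := p) (q' := q); try lia.
    apply/eqP; rewrite subquot_class_eqE ex opprD addrCA subrr addr0 rpredN.
    by apply: zcyc_bcyc; move: wZ; apply: zcyc_le; lia.
Qed.

Definition filtered_ss : spectral_sequence :=
  @SpectralSequence fpage fdiff fdiff_deg fdiffK
    (fun r p q r0 => sval (fnext_page_ex p q r0)).

Lemma fpage_vanish r p q (x : filtered_ss r p q) : p <= 0 -> x = 0.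
Proof.
move=> p0; have [y [yZ ->]] := subquot_surj x; apply/eqP; rewrite subquot_class0.
by move/zcycP: yZ => [/(F_bound p0) -> _]; exact: rpred0.
Qed.

(** Each [next_page] isomorphism matches classes with a common representative, so the iterated
    condition collapses to a single common representative of both ends. *)
Lemma survivesP p q k (xi : filtered_ss 1%N p q) (eta : filtered_ss k.+1 p q) :
  survives xi eta <-> exists z, represents xi z /\ represents eta z.
Proof.
elim: k eta => [|k IH] eta /=.
  split=> [<-|[z [[zZ ->] [zZ' ->]]]]; last exact: subquot_class_eq.
  by have [z [zZ ->]] := subquot_surj xi; exists z; split; exists zZ.
split.
  move=> [zeta [/IH[z [[zZ exi] [zZ' ezeta]]] [zK <-]]]; subst zeta.
  have [x xZ zxZ] := fdiff_kernel zK.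
  have xZ1 : x \in zcyc 1%N%:Z p (p + q) by move: xZ; apply: zcyc_le; lia.
  have xZ2 : x \in zcyc k.+1%:Z p (p + q) by move: xZ; apply: zcyc_le; lia.
  exists x; split.
    exists xZ1; rewrite exi; apply/eqP; rewrite subquot_class_eqE; apply: zcyc_bcyc.
    by move: zxZ; apply: zcyc_le; lia.
  exists xZ; apply: (svalP (@fnext_page_ex k.+1 p q isT) _ _ zK xZ).
  by exists xZ2; apply/eqP; rewrite subquot_class_eqE; exact: zcyc_bcyc.
move=> [z [xiz [zZ ->]]].
have zZ' : z \in zcyc k.+1%:Z p (p + q) by move: zZ; apply: zcyc_le; lia.
exists (subquot_class _ zZ'); split; first by apply/IH; exists z; split=> //; exists zZ'.
exists (zcyc_kernel zZ' zZ);
  apply: (svalP (@fnext_page_ex k.+1 p q isT) _ _ (zcyc_kernel zZ' zZ) zZ).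
by exists zZ'.
Qed.

Lemma cycle_cxd0 n x j : x \in kernel (cxd M n (n - 1)) -> cxd M n j x = 0.
Proof.
rewrite kernelE => /eqP dx; have [ej|ej] := eqVneq (j + 1) n; last exact: cx_deg.
by have -> : j = n - 1 by rewrite -ej addrK.
Qed.

Definition hfilt_pred (n p : int) (h : homology M n) : bool :=
  `[< exists2 x, x \in F p n &
        exists xK : x \in kernel (cxd M n (n - 1)), h = subquot_class _ xK >].
Lemma hfilt_closed n p : zmod_closed (@hfilt_pred n p).
Proof.
split=> [|x y]; rewrite ![_ \in @hfilt_pred _ _]unfold_in /hfilt_pred.
  apply/asboolP; exists 0; first exact: rpred0.
  by exists (rpred0 _); apply/esym/eqP; rewrite subquot_class0 rpred0.
move=> /asboolP[a aF [aK ->]] /asboolP[b bF [bK ->]]; apply/asboolP.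
exists (a - b); first exact: rpredB.
by exists (rpredB aK bK); rewrite subquot_classB.
Qed.
HB.instance Definition _ n p :=
  GRing.isZmodClosed.Build (homology M n) (@hfilt_pred n p) (@hfilt_closed n p).
Definition hfilt n p : zmodClosed (homology M n) :=
  GRing.ZmodClosed.clone (homology M n) (@hfilt_pred n p) _.

Lemma hfiltP n p h :
  reflect (exists2 x, x \in F p n &
    exists xK : x \in kernel (cxd M n (n - 1)), h = subquot_class _ xK) (h \in hfilt n p).
Proof. rewrite [h \in _]unfold_in; exact: asboolP. Qed.

Lemma represents_diff p q xi x x' :
  @represents 1 p q xi x -> represents xi x' ->
  exists2 w, w \in F (p - 1) (p + q) & exists v, x - x' = w + cxd M (p + q + 1) (p + q) v.
Proof.
move=> [xZ ->] [xZ' /eqP]; rewrite subquot_class_eqE => /bcycP[w /zcycP[wF _] [j <- [v _ e]]].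
by exists w => //; exists v.
Qed.

Lemma filtered_ss_converges : converges filtered_ss (homology M).
Proof.
exists hfilt; split.
- move=> n p h /hfiltP[x xF [xK ->]]; apply/hfiltP; exists x; first exact: F_mono.
  by exists xK.
- move=> n; exists 0 => h /hfiltP[x /(F_bound (lexx 0)) ex [xK ->]].
  by apply/eqP; rewrite subquot_class0 ex rpred0.
- move=> n h; have [x [xK ->]] := subquot_surj h; have [p xF] := F_exhaust x.
  by exists p; apply/hfiltP; exists x => //; exists xK.
move=> p q.
(* The comparison relation: [xi] and [h] are classes of one and the same element of $F_p$ which is
   an actual cycle. *)
pose R (xi : filtered_ss 1%N p q) (h : homology M (p + q)) := exists2 x, x \in F p (p + q) &
  represents xi x /\ exists xK : x \in kernel (cxd M (p + q) (p + q - 1)), h = subquot_class _ xK.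
suff RP : [/\ forall xi xi' h h', R xi h -> R xi' h' -> R (xi - xi') (h - h'),
    forall xi, xi \in Zinf_pred (p := p) (q := q) -> exists2 h, h \in hfilt (p + q) p & R xi h,
    forall h, h \in hfilt (p + q) p ->
      exists2 xi, xi \in @Zinf_pred filtered_ss p q & R xi h
    & forall xi h, xi \in @Zinf_pred filtered_ss p q -> h \in hfilt (p + q) p -> R xi h ->
      (xi \in @Binf_pred filtered_ss p q <-> h \in hfilt (p + q) (p - 1))].
  by case: RP => R1 R2 R3 R4; have [phi _] := subquot_rel_iso R1 R2 R3 R4; constructor.
have cycle_zcyc r p' x : x \in F p' (p + q) -> x \in kernel (cxd M (p + q) (p + q - 1)) ->
    x \in zcyc r p' (p + q).
  by move=> xF xK; apply/zcycP; split=> // j; rewrite (cycle_cxd0 _ xK) rpred0.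
split.
- move=> xi xi' h h' [x xF [rx [xK ->]]] [x' x'F [rx' [x'K ->]]].
  exists (x - x'); first exact: rpredB.
  by split; [exact: representsB | exists (rpredB xK x'K); rewrite subquot_classB].
(* Surviving $|p|$ differentials gives a representative with boundary in $F_{p-|p|-1}=0$, that is, a
   cycle. *)
- move=> xi; rewrite [xi \in _]unfold_in => /asboolP /(_ `|p|%N)[eta].
  move=> /survivesP[z [xiz [/zcycP[zF dzF] _]]].
  have zK : z \in kernel (cxd M (p + q) (p + q - 1)).
    by rewrite kernelE (F_bound _ (dzF _)) //; lia.
  exists (subquot_class _ zK); first by apply/hfiltP; exists z => //; exists zK.
  by exists z => //; split=> //; exists zK.
- move=> h /hfiltP[x xF [xK ->]]; have xZ := cycle_zcyc 1%N%:Z _ _ xF xK.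
  exists (subquot_class _ xZ); last by exists x => //; split; [exists xZ | exists xK].
  rewrite [_ \in _]unfold_in; apply/asboolP => k.
  have xZk := cycle_zcyc k.+1%:Z _ _ xF xK.
  by exists (subquot_class _ xZk); apply/survivesP; exists x; split; [exists xZ | exists xZk].
- move=> xi h _ _ [x xF [xix [xK ->]]]; rewrite [xi \in _]unfold_in; split.
  (* Both [x] and [z] represent [xi] on the first page, and [z] lies in the denominator of a later
     page. Adding the two decompositions writes [x] as an element of $F_{p-1}$ plus a boundary. *)
  + move=> /asboolP[k /survivesP[z [xiz /represents0]]]; rewrite eqxx => /esym.
    move=> /bcycP[w /zcycP[wF _] [j <- [v _ ez]]].
    have [w' w'F [v' exz]] := represents_diff xix xiz.
    have ex : x = w' + w + cxd M (p + q + 1) (p + q) (v' + v).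
      by rewrite raddfD /= addrACA -exz -ez subrK.
    have wK : w' + w \in kernel (cxd M (p + q) (p + q - 1)).
      by move: xK; rewrite !kernelE ex (raddfD (cxd M (p + q) (p + q - 1))) /= cxdd addr0.
    apply/hfiltP; exists (w' + w); first exact: rpredD.
    exists wK; apply/eqP; rewrite subquot_class_eqE {1}ex addrKl.
    by apply/image_grpP; exists (v' + v).
  + move=> /hfiltP[y yF [yK /eqP]]; rewrite subquot_class_eqE => /image_grpP[v ev].
    (* With $k=|p'-p|$ one has $v\in F_{p+k}$, and $dv=x-y\in F_p$; so $v\in Z^k_{p+k}$, as the
       denominator of $E^{k+1}_p$ demands. *)
    have [p' vF] := F_exhaust v; apply/asboolP; exists `|p' - p|%N; apply/survivesP.
    exists x; split=> //; have xZ := cycle_zcyc (`|p' - p|%N.+1)%:Z _ _ xF xK.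
    exists xZ; apply/esym/eqP; rewrite subquot_class0; apply/bcycP.
    exists y; first exact: cycle_zcyc.
    exists (p + q + 1) => //; exists v; last by rewrite ev -[LHS](addrKl y) addrA.
    apply/zcycP; split; first by apply: filtration_le vF; lia.
    move=> j; have [ej|ej] := eqVneq (j + 1) (p + q + 1); last by rewrite cx_deg ?rpred0.
    move/addIr: ej => ->; rewrite ev; apply: rpredB.
      by apply: filtration_le xF; lia.
    by apply: filtration_le yF; lia.
Qed.

End FilteredComplex.

Lemma zmod_cancel3 (M : zmodType) (p q r : M) : p - q + (- p - r) + (q + r) = 0.
Proof. by rewrite [p - q + _]addrACA subrr add0r -opprD addNr. Qed.

Lemma zmod_cancel3' (M : zmodType) (p q r : M) : - p + q + (p + r) + (- q - r) = 0.
Proof. by rewrite addrAC [- p + q]addrC zmod_cancel3. Qed.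

(** * Deformations of a total complex *)

(* A double-complex zigzag: [A] and [D] at $B=0$ form a complex $K$, the groups
   [Y] form a complex $Y$, and all groups together the cone of a span
   $K\leftarrow W\to Y$, where $W$ is [A], [D] at $B>0$. When both legs of the span
   are quasi-isomorphisms the total complex deforms into $K$ as well as into $Y$. *)
Section Zigzag.
Variables XA XD XY : nat -> nat -> zmodType.
Variable a1 : forall m B, {additive XA m.+1 B -> XA m B}.
Variable a2 : forall m B, {additive XA m B.+1 -> XA m B}.
Variable d1 : forall m B, {additive XD m.+1 B -> XD m B}.
Variable d2 : forall m B, {additive XD m B.+1 -> XD m B}.
Variable y1 : forall m B, {additive XY m.+1 B -> XY m B}.
Variable y2 : forall m B, {additive XY m B.+1 -> XY m B}.
Variable u : forall m B, {additive XA m B -> XD m B}.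
Variable fA : forall m B, {additive XA m B.+1 -> XY m.+1 B}.
Variable fD : forall B, {additive XD 0 B.+1 -> XY 0 B}.

(** An element of the total complex is an unrestricted family over all $(m,B)$. Finiteness returns
    only through [fam_hom], since a single total degree meets finitely many positions. *)
Record tfamily := Family {
  famA : forall m B, XA m B;
  famD : forall m B, XD m B;
  famY : forall m B, XY m B }.

Definition fam0 := Family (fun _ _ => 0) (fun _ _ => 0) (fun _ _ => 0).
Definition fam_add (z w : tfamily) := Family (fun m B => famA z m B + famA w m B)
  (fun m B => famD z m B + famD w m B) (fun m B => famY z m B + famY w m B).
Definition fam_sub (z w : tfamily) := Family (fun m B => famA z m B - famA w m B)
  (fun m B => famD z m B - famD w m B) (fun m B => famY z m B - famY w m B).

(** Forgetting the $d$'s leaves $m+1$ vertices of the smaller category for a word of [XA] at $m$ and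
    none for a word of [XD]; this is why the last term of [famY] splits according to $a$. *)
Definition fam_d (z : tfamily) := Family
  (fun m B => a1 m B (famA z m.+1 B) + a2 m B (famA z m B.+1))
  (fun m B => d1 m B (famD z m.+1 B) + u m B (famA z m B) + d2 m B (famD z m B.+1))
  (fun a B => y1 a B (famY z a.+1 B) + y2 a B (famY z a B.+1) +
    match a return XY a B with 0%N => fD B (famD z 0 B.+1) | m.+1 => fA m B (famA z m B.+1) end).

Definition fam_eq (z w : tfamily) := [/\ forall m B, famA z m B = famA w m B,
  forall m B, famD z m B = famD w m B & forall a B, famY z a B = famY w a B].

Lemma fam_dD z w : fam_eq (fam_d (fam_add z w)) (fam_add (fam_d z) (fam_d w)).
Proof.
split=> [m B|m B|[|m] B] /=; rewrite !raddfD /=; first exact: addrACA.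
all: by rewrite [RHS]addrACA [X in _ = X + _]addrACA.
Qed.

Lemma fam_dB z w : fam_eq (fam_d (fam_sub z w)) (fam_sub (fam_d z) (fam_d w)).
Proof.
split=> [m B|m B|[|m] B] /=; rewrite !raddfB /= ?opprD; first exact: addrACA.
all: by rewrite [RHS]addrACA [X in _ = X + _]addrACA.
Qed.

Hypothesis a11 : forall m B x, a1 m B (a1 m.+1 B x) = 0.
Hypothesis a22 : forall m B x, a2 m B (a2 m B.+1 x) = 0.
Hypothesis a12 : forall m B x, a1 m B (a2 m.+1 B x) = - a2 m B (a1 m B.+1 x).
Hypothesis d11 : forall m B x, d1 m B (d1 m.+1 B x) = 0.
Hypothesis d22 : forall m B x, d2 m B (d2 m B.+1 x) = 0.
Hypothesis d12 : forall m B x, d1 m B (d2 m.+1 B x) = - d2 m B (d1 m B.+1 x).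
Hypothesis y11 : forall m B x, y1 m B (y1 m.+1 B x) = 0.
Hypothesis y22 : forall m B x, y2 m B (y2 m B.+1 x) = 0.
Hypothesis y12 : forall m B x, y1 m B (y2 m.+1 B x) = - y2 m B (y1 m B.+1 x).
Hypothesis ua1 : forall m B x, u m B (a1 m B x) = - d1 m B (u m.+1 B x).
Hypothesis ua2 : forall m B x, u m B (a2 m B x) = - d2 m B (u m B.+1 x).
Hypothesis fa1 : forall m B x, fA m B (a1 m B.+1 x) = - y1 m.+1 B (fA m.+1 B x).
Hypothesis fa2 : forall m B x, fA m B (a2 m B.+1 x) = - y2 m.+1 B (fA m B.+1 x).
Hypothesis fu : forall B x, fD B (u 0 B.+1 x) = - y1 0 B (fA 0 B x).
Hypothesis fd1 : forall B x, fD B (d1 0 B.+1 x) = 0.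
Hypothesis fd2 : forall B x, fD B (d2 0 B.+1 x) = - y2 0 B (fD B.+1 x).

Lemma fam_dd z : fam_eq (fam_d (fam_d z)) fam0.
Proof.
split=> [m B|m B|[|m] B] /=; rewrite !raddfD /=.
- by rewrite a11 a22 a12 add0r addr0 addNr.
- by rewrite d11 d22 d12 ua1 ua2 add0r addr0 zmod_cancel3.
- by rewrite y11 y22 y12 fd1 fu fd2 !add0r addr0 zmod_cancel3'.
- by rewrite y11 y22 y12 fa1 fa2 !add0r addr0 zmod_cancel3'.
Qed.

(** [XA] is raised by one degree, being the source in the cone of [u]. *)
Definition fam_hom (i : int) (z : tfamily) :=
  [/\ forall m B, (m.+1 + B)%N%:Z != i -> famA z m B = 0,
      forall m B, (m + B)%N%:Z != i -> famD z m B = 0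
    & forall a B, (a + B)%N%:Z != i -> famY z a B = 0].

Lemma fam_homD i z w : fam_hom i z -> fam_hom i w -> fam_hom i (fam_add z w).
Proof.
by move=> [zA zD zY] [wA wD wY]; split=> m B ne /=; rewrite ?zA ?wA ?zD ?wD ?zY ?wY ?addr0.
Qed.

Lemma fam_homB i z w : fam_hom i z -> fam_hom i w -> fam_hom i (fam_sub z w).
Proof.
by move=> [zA zD zY] [wA wD wY]; split=> m B ne /=; rewrite ?zA ?wA ?zD ?wD ?zY ?wY ?subr0.
Qed.

Lemma fam_hom_d i z : fam_hom (i + 1) z -> fam_hom i (fam_d z).
Proof.
move=> [zA zD zY]; split=> [m B|m B|[|m] B] ne /=.
- by rewrite !zA ?raddf0 ?addr0 //; lia.
- by rewrite !zD ?zA ?raddf0 ?addr0 //; lia.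
- by rewrite !zY ?zD ?raddf0 ?addr0 //; lia.
- by rewrite !zY ?zA ?raddf0 ?addr0 //; lia.
Qed.

(** Since $dd=0$, subtracting $dh$ leaves the boundary of [z] unchanged; so a property of that
    boundary persists through successive corrections. *)
Lemma fam_step (P : tfamily -> Prop) i z h :
  (forall z1 z2, fam_eq z1 z2 -> P z1 -> P z2) ->
  fam_hom i z -> fam_hom (i + 1) h -> P (fam_d z) ->
  let z1 := fam_sub z (fam_d h) in fam_hom i z1 /\ P (fam_d z1).
Proof.
move=> Peq zi hi Pz; split; first by apply: fam_homB => //; exact: fam_hom_d.
apply: Peq Pz; have [eA eD eY] := fam_dB z (fam_d h); have [hA hD hY] := fam_dd h.
split=> m B.
- by rewrite eA; apply: etrans (congr1 (fun x => famA (fam_d z) m B - x) (esym (hA m B)));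
  rewrite subr0.
- by rewrite eD; apply: etrans (congr1 (fun x => famD (fam_d z) m B - x) (esym (hD m B)));
  rewrite subr0.
- by rewrite eY; apply: etrans (congr1 (fun x => famY (fam_d z) m B - x) (esym (hY m B)));
  rewrite subr0.
Qed.

Definition in_Y (z : tfamily) :=
  (forall m B, famA z m B = 0) /\ (forall m B, famD z m B = 0).
Definition in_K (z : tfamily) := [/\ forall m B, famA z m B.+1 = 0,
  forall m B, famD z m B.+1 = 0 & forall a B, famY z a B = 0].

Lemma in_Y_eq z1 z2 : fam_eq z1 z2 -> in_Y z1 -> in_Y z2.
Proof. by move=> [eA eD _] [zA zD]; split=> m B; rewrite -?eA -?eD. Qed.
Lemma in_K_eq z1 z2 : fam_eq z1 z2 -> in_K z1 -> in_K z2.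
Proof. by move=> [eA eD eY] [zA zD zY]; split=> m B; rewrite -?eA -?eD -?eY. Qed.

Lemma deform_add (P : tfamily -> Prop) i z h :
  (forall z1 z2, fam_eq z1 z2 -> P z1 -> P z2) -> fam_hom (i + 1) h ->
  (exists2 z', fam_hom (i + 1) z' & P (fam_sub (fam_sub z (fam_d h)) (fam_d z'))) ->
  exists2 z', fam_hom (i + 1) z' & P (fam_sub z (fam_d z')).
Proof.
move=> Peq hi [z' z'i Pz]; exists (fam_add h z'); first exact: fam_homD.
apply: Peq Pz; have [eA eD eY] := fam_dD h z'.
have sub3 (M : zmodType) (x y w t : M) : t = y + w -> x - y - w = x - t.
  by move=> ->; rewrite opprD addrA.
by split=> m B; [exact: (sub3 _ _ _ _ _ (eA m B)) | exact: (sub3 _ _ _ _ _ (eD m B))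
  | exact: (sub3 _ _ _ _ _ (eY m B))].
Qed.

Section DeformY.
Variable sA : forall m B, {additive XA m B -> XA m B.+1}.
Variable sD : forall m B, {additive XD m B -> XD m B.+1}.
Hypothesis sA0 : forall m x, a2 m 0 (sA m 0 x) = x.
Hypothesis sD0 : forall m x, d2 m 0 (sD m 0 x) = x.
Hypothesis sAS : forall m B x, a2 m B.+1 (sA m B.+1 x) = x - sA m B (a2 m B x).
Hypothesis sDS : forall m B x, d2 m B.+1 (sD m B.+1 x) = x - sD m B (d2 m B x).
Hypothesis us : forall m B x, u m B.+1 (sA m B x) = - sD m B (u m B x).

(** Downward induction on $m$, starting above the total degree. In the highest remaining $m$, the
    hypothesis on [fam_d z] says that the components are cycles for [a2] and, up to [u], for [d2].
    The contractions [sA] and [sD] of the direction $B$ therefore bound them, and [us] makes the two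
    corrections compatible. *)
Lemma deform_Y i z : fam_hom i z -> in_Y (fam_d z) ->
  exists2 z', fam_hom (i + 1) z' & in_Y (fam_sub z (fam_d z')).
Proof.
pose below k z := forall m B, (k <= m)%N -> famA z m B = 0 /\ famD z m B = 0.
move=> zi dz; have : below (`|i|%N.+1) z.
  by move: zi => [zA zD _] m B km; rewrite zA ?zD //; lia.
elim: (_.+1) z zi dz => {}[|k IH] z zi dz bz.
  exists fam0; first by split.
  by split=> m B /=; have [zA zD] := bz m B isT; rewrite ?zA ?zD !raddf0 ?addr0 subr0.
pose h := Family
  (fun m B => match B return XA m B with 0%N => 0 | B.+1 => sA m B (famA z m B) end)
  (fun m B => match B return XD m B with 0%N => 0 | B.+1 => sD m B (famD z m B) end)
  (fun _ _ => 0).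
have hi : fam_hom (i + 1) h.
  case: zi => [iA iD _]; split=> // m [|B] //= ne; first by rewrite iA ?raddf0 //; lia.
  by rewrite iD ?raddf0 //; lia.
apply: (deform_add in_Y_eq hi).
have [z1i dz1] := fam_step in_Y_eq zi hi dz; apply: IH => // m B km.
case: dz => [dA dD]; have [zA zD] := (fun B => proj1 (bz m.+1 B km), fun B => proj2 (bz m.+1 B km)).
case: B => [|B] /=.
  by rewrite sA0 sD0 !raddf0 addr0 !add0r !subrr.
have := dA m B; have := dD m B; rewrite /= zA zD !raddf0 !add0r => uD aA.
rewrite sAS sDS us aA raddf0 subr0 subrr; split=> //.
move/eqP: uD; rewrite addr_eq0 => /eqP ->.
by rewrite raddfN opprK [X in _ - X]addrC subrK subrr.
Qed.
End DeformY.

Section DeformK.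
Variable tD : forall m B, {additive XD m B.+1 -> XD m.+1 B.+1}.
Variable gD : forall B, {additive XY 0 B -> XD 0 B.+1}.
Variable PA : forall m B, {additive XA m B.+1 -> XA m.+1 B.+1}.
Variable gA : forall m B, {additive XY m.+1 B -> XA m B.+1}.
Hypothesis tD0 : forall B x, d1 0 B.+1 (tD 0 B x) = x - gD B (fD B x).
Hypothesis tDS : forall m B x, d1 m.+1 B.+1 (tD m.+1 B x) = x - tD m B (d1 m B.+1 x).
Hypothesis fgD : forall B x, fD B (gD B x) = x.
Hypothesis PA0 : forall B x, a1 0 B.+1 (PA 0 B x) = x - gA 0 B (fA 0 B x).
Hypothesis PAS : forall m B x,
  a1 m.+1 B.+1 (PA m.+1 B x) = x - gA m.+1 B (fA m.+1 B x) - PA m B (a1 m B.+1 x).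
Hypothesis fPA : forall m B x, fA m.+1 B (PA m B x) = 0.
Hypothesis fgA : forall m B x, fA m B (gA m B x) = x.
Hypothesis ga1 : forall m B x, a1 m B.+1 (gA m.+1 B x) = - gA m B (y1 m.+1 B x).

(** Downward induction on $B$. For fixed $B$, [XA] at $B+1$ and [XY] at $B$ with first index at
    least 1 form the cone of [fA], contracted by [PA] and [gA]; [XD] at $B+1$ and [XY] at $(0,B)$
    form the cone of [fD], contracted by [tD] and [gD]. The condition on [fam_d z] makes the highest
    components cycles in these cones. *)
Lemma deform_K i z : fam_hom i z -> in_K (fam_d z) ->
  exists2 z', fam_hom (i + 1) z' & in_K (fam_sub z (fam_d z')).
Proof.
pose belowA k z := forall m B, (k <= B)%N -> famA z m B.+1 = 0 /\ famY z m.+1 B = 0.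
pose belowD k z := forall m B, (k <= B)%N -> famD z m B.+1 = 0 /\ famY z 0 B = 0.
move=> zi dz; have : belowA (`|i|%N.+1) z /\ belowD (`|i|%N.+1) z.
  move: zi => [zA zD zY].
  by split=> m B km; rewrite ?zA ?zD ?zY //; lia.
elim: (_.+1) z zi dz => {}[|k IH] z zi dz [bA bD].
  exists fam0; first by split.
  split=> [m B|m B|[|m] B] /=; rewrite ?(proj1 (bA _ _ _)) ?(proj1 (bD _ _ _)) //
     ?(proj2 (bA _ _ _)) ?(proj2 (bD 0%N _ _)) //; by rewrite !raddf0 ?addr0 subr0.
(* [XA] is cleared first: the boundary of [hA] disturbs [XD] through [u], whereas the boundary of
   the later [hD] meets neither [XA] nor [XY] at positive first index. *)
pose hA := Family
  (fun m B => match m, B return XA m B with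
    | 0%N, B.+1 => gA 0 B (famY z 1 B)
    | m.+1, B.+1 => PA m B (famA z m B.+1) + gA m.+1 B (famY z m.+2 B)
    | _, _ => 0 end) (fun _ _ => 0) (fun _ _ => 0).
have hAi : fam_hom (i + 1) hA.
  case: zi => [iA iD iY]; split=> // -[|m] [|B] //= ne; first by rewrite iY ?raddf0 //; lia.
  by rewrite iA ?iY ?raddf0 ?addr0 //; lia.
apply: (deform_add in_K_eq hAi); have [z1i dz1] := fam_step in_K_eq zi hAi dz.
case: dz => [zdA zdD zdY].
have hA2 n B : (k <= B)%N -> hA.(famA) n B.+2 = 0.
  by move=> kB; case: n => [|n] /=;
    rewrite ?(proj1 (bA _ B.+1 kB)) ?(proj2 (bA _ B.+1 kB)) !raddf0 ?addr0.
have b1A : belowA k (fam_sub z (fam_d hA)).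
  move=> m B kB.
  have hAf n : a1 n B.+1 (hA.(famA) n.+1 B.+1) = famA z n B.+1 .
    have := zdY n.+1 B; rewrite /= (proj2 (bA n B.+1 kB)) raddf0 addr0 => /eqP.
    rewrite addr_eq0 => /eqP yf; rewrite raddfD /= ga1 yf raddfN opprK.
    case: n yf => [|n] yf; first by rewrite PA0 subrK.
    have := zdA n B; rewrite /= (proj1 (bA n B.+1 kB)) raddf0 addr0 => az.
    by rewrite PAS az raddf0 subr0 subrK.
  have fh n : fA n B (hA.(famA) n B.+1) = famY z n.+1 B.
    by case: n => [|n] /=; rewrite ?raddfD /= ?fPA ?add0r fgA.
  split; rewrite [LHS]/=.
    by rewrite -[X in a1 _ _ X]/(hA.(famA) m.+1 B.+1) hAf -[X in a2 _ _ X]/(hA.(famA) m B.+2) hA2 //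
      raddf0 addr0 subrr.
  by rewrite -[X in fA _ _ X]/(hA.(famA) m B.+1) fh !raddf0 !add0r subrr.
have b1D : belowD k.+1 (fam_sub z (fam_d hA)).
  move=> m [//|B] kB; have [zD zY] := bD m B.+1 kB; rewrite /= zD zY !raddf0 !addr0 add0r.
  split; last by rewrite subrr.
  by rewrite -[X in u _ _ X]/(hA.(famA) m B.+2) hA2 // raddf0 addr0 oppr0.
move: (fam_sub z (fam_d hA)) z1i dz1 b1A b1D => {zdA zdD zdY hAi hA2 hA bA bD zi}z zi dz bA bD.
pose hD := Family (fun _ _ => 0)
  (fun m B => match m, B return XD m B with
    | 0%N, B.+1 => gD B (famY z 0 B)
    | m.+1, B.+1 => tD m B (famD z m B.+1)
    | _, _ => 0 end) (fun _ _ => 0).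
have hDi : fam_hom (i + 1) hD.
  case: zi => [iA iD iY]; split=> // -[|m] [|B] //= ne; first by rewrite iY ?raddf0 //; lia.
  by rewrite iD ?raddf0 //; lia.
apply: (deform_add in_K_eq hDi); have [z1i dz1] := fam_step in_K_eq zi hDi dz.
apply: IH => //; split=> m B kB; case: dz => [zdA zdD zdY].
  by rewrite /= (proj1 (bA m B kB)) (proj2 (bA m B kB)) !raddf0 !addr0 !subr0.
have hD2 n : hD.(famD) n B.+2 = 0.
  by case: n => [|n] /=; rewrite ?(proj1 (bD _ B.+1 _)) ?(proj2 (bD 0%N B.+1 _)) ?raddf0.
have hD1 : d1 m B.+1 (hD.(famD) m.+1 B.+1) = famD z m B.+1.
  case: m => [|m] /=.
    have := zdY 0%N B; rewrite /= (proj2 (bA 0%N B kB)) (proj2 (bD 0%N B.+1 kB)) !raddf0 !add0r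
      => fz.
    by rewrite tD0 fz raddf0 subr0.
  have := zdD m B; rewrite /= (proj1 (bA m B kB)) (proj1 (bD m B.+1 kB)) !raddf0 !addr0 => dz.
  by rewrite tDS dz raddf0 subr0.
split; rewrite [LHS]/=.
  by rewrite -[X in d1 _ _ X]/(hD.(famD) m.+1 B.+1) hD1 -[X in d2 _ _ X]/(hD.(famD) m B.+2) hD2
    !raddf0 !addr0 subrr.
by rewrite fgD !raddf0 !add0r subrr.
Qed.
End DeformK.

(* Replacing [P] by [P - g f P] makes [f P] vanish. *)
Lemma deform_K_homotopy
  (tD : forall m B, {additive XD m B.+1 -> XD m.+1 B.+1})
  (gD : forall B, {additive XY 0 B -> XD 0 B.+1})
  (P : forall m B, {additive XA m B.+1 -> XA m.+1 B.+1})
  (gA : forall m B, {additive XY m.+1 B -> XA m B.+1}) :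
  (forall B x, d1 0 B.+1 (tD 0 B x) = x - gD B (fD B x)) ->
  (forall m B x, d1 m.+1 B.+1 (tD m.+1 B x) = x - tD m B (d1 m B.+1 x)) ->
  (forall B x, fD B (gD B x) = x) ->
  (forall B x, a1 0 B.+1 (P 0 B x) = x - gA 0 B (fA 0 B x)) ->
  (forall m B x,
    a1 m.+1 B.+1 (P m.+1 B x) = x - gA m.+1 B (fA m.+1 B x) - P m B (a1 m B.+1 x)) ->
  (forall m B x, fA m B (gA m B x) = x) ->
  (forall m B x, a1 m B.+1 (gA m.+1 B x) = - gA m B (y1 m.+1 B x)) ->
  forall i z, fam_hom i z -> in_K (fam_d z) ->
  exists2 z', fam_hom (i + 1) z' & in_K (fam_sub z (fam_d z')).
Proof.
move=> tD0 tDS fgD P0 PS fgA ga1 i z.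
pose PA m B : {additive XA m B.+1 -> XA m.+1 B.+1} :=
  P m B \- (gA m.+1 B \o (fA m.+1 B \o P m B)).
have PAE m B x : PA m B x = P m B x - gA m.+1 B (fA m.+1 B (P m B x)) by [].
have a1PA m B x : a1 m B.+1 (PA m B x) =
    a1 m B.+1 (P m B x) - gA m B (fA m B (a1 m B.+1 (P m B x))).
  by rewrite PAE raddfB ga1 fa1 raddfN.
have gfB m B x x' : gA m B (fA m B (x - x')) = gA m B (fA m B x) - gA m B (fA m B x').
  by rewrite !raddfB.
apply: (@deform_K tD gD PA gA) => //.
- by move=> B x; rewrite a1PA P0 gfB fgA subrr subr0.
- move=> m B x; rewrite a1PA PS !gfB fgA subrr sub0r opprK PAE.
  by rewrite opprB addrA addrAC.
- by move=> m B x; rewrite PAE raddfB fgA subrr.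
Qed.
End Zigzag.

(** * Naive colimits *)

Section SetColimit.
Variables (X : nat -> Type) (t : forall n, X n -> X n.+1) (L : Type) (j : forall n, X n -> L).
Hypothesis colim : is_set_colimit t j.

(** On the sum of all stages the transition maps become one endofunction, which can be iterated
    without transport along sums of indices. *)
Definition step (x : {n & X n}) : {n & X n} := existT X (projT1 x).+1 (t (projT2 x)).

Lemma colim_step x : j (projT2 (step x)) = j (projT2 x).
Proof. by case: x => n x; exact: colim.1. Qed.

Lemma colim_iter d x : j (projT2 (iter d step x)) = j (projT2 x).
Proof. by elim: d => // d IH; rewrite iterS colim_step. Qed.

Lemma iter_level d x : projT1 (iter d step x) = (d + projT1 x)%N.
Proof. by elim: d => // d IH; rewrite iterS /= IH. Qed.

(** The predicate of being in the image and the constant [True] are both maps from the colimit to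
    [Prop] that are [True] on every stage; uniqueness identifies them. *)
Lemma colim_surj y : exists n (x : X n), j x = y.
Proof.
have [v [_ vuniq]] := colim.2 Prop (fun _ _ => True) (fun _ _ => erefl).
pose im y := exists n (x : X n), j x = y.
have e1 : v = im.
  by apply: vuniq => n x; apply/propext; split=> // _; exists n, x.
have e2 : v = fun _ => True by exact: vuniq.
by change (im y); rewrite -e1 e2.
Qed.

(* The set-valued universal property, tested on [Prop], detects eventual equality. *)
Lemma colim_eventually x y : j (projT2 x) = j (projT2 y) ->
  exists d d', iter d step x = iter d' step y.
Proof.
pose k n (z : X n) := exists d d', iter d step x = iter d' step (existT X n z).
have kt n z : k n.+1 (t z) = k n z.
  apply/propext; split=> -[d [d' e]].
    by exists d, d'.+1; rewrite e iterSr.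
  by exists d.+1, d'; rewrite iterS e -iterS iterSr.
have [v [vk _]] := colim.2 Prop k kt.
case: y => m y /= exy; change (k _ y) => {kt}.
have -> : k _ y = k _ (projT2 x) by rewrite -!vk exy.
by exists 0%N, 0%N; case: x {k vk v exy}.
Qed.
End SetColimit.

Section NaiveColimit.
Variables (Q : nat -> category) (T : forall n, functor (Q n) (Q n.+1)).
Variables (L : category) (J : forall n, functor (Q n) L).
Hypothesis T_cellular : forall n, cellular (T n).
Hypothesis colim : is_naive_colimit T J.

Lemma colim_ob n (x : Q n) : J n.+1 (T n x) = J n x.
Proof. exact: colim.1.1. Qed.

Lemma colim_ob_surj y : exists n (x : Q n), J n x = y.
Proof. exact: (colim_surj colim.1). Qed.

Notation ostep := (step (fun n => fob (T n))).
Notation astep := (step (fun n => amap (T n))).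

Definition osrc (a : {n & arrow (Q n)}) : {n & Q n} := existT _ (projT1 a) (src (projT2 a)).
Definition otgt (a : {n & arrow (Q n)}) : {n & Q n} := existT _ (projT1 a) (tgt (projT2 a)).

Lemma existT_inj (X : nat -> Type) n (x y : X n) : existT X n x = existT X n y -> x = y.
Proof.
move=> e; have [en <-] : {en : n = n | ecast k (X k) en x = y}.
  have gen (p q : {n & X n}) : p = q -> {en : projT1 p = projT1 q |
      ecast k (X k) en (projT2 p) = projT2 q} by move=> <-; exists erefl.
  exact: (gen _ _ e).
by rewrite (eq_axiomK en).
Qed.

Lemma osrc_iter d a : osrc (iter d astep a) = iter d ostep (osrc a).
Proof. by elim: d => // d IH; rewrite !iterS -IH. Qed.

Lemma otgt_iter d a : otgt (iter d astep a) = iter d ostep (otgt a).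
Proof. by elim: d => // d IH; rewrite !iterS -IH. Qed.

Lemma arrow_hom (C : category) (a : arrow C) x y : src a = x -> tgt a = y ->
  exists f : hom x y, a = Arrow f.
Proof. by case: a => x' y' f /= <- <-; exists f. Qed.

Lemma step_full n (x y : Q n) (b : {n & arrow (Q n)}) :
  osrc b = ostep (existT _ n x) -> otgt b = ostep (existT _ n y) ->
  exists f : hom x y, astep (existT _ n (Arrow f)) = b.
Proof.
case: b => m b; rewrite /osrc /otgt /ostep /= => es et.
have em : m = n.+1 by exact: (congr1 (@projT1 _ _) es).
subst m; have {}es := existT_inj es; have {}et := existT_inj et.
have [g eb] := arrow_hom es et; subst b.
have [h _ hK] := (T_cellular n).1 x y.
by exists (h g); rewrite /step /= /amap /= hK.
Qed.

Lemma iter_full d n (x y : Q n) (b : {n & arrow (Q n)}) :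
  osrc b = iter d ostep (existT _ n x) -> otgt b = iter d ostep (existT _ n y) ->
  exists f : hom x y, iter d astep (existT _ n (Arrow f)) = b.
Proof.
elim: d b => [|d IH] b es et.
  case: b es et => m b; rewrite /osrc /otgt /= => es et;
    have em : m = n by exact: (congr1 (@projT1 _ _) es).
  subst m; have {}es := existT_inj es; have {}et := existT_inj et.
  by have [f ->] := arrow_hom es et; exists f.
rewrite !iterS in es et.
case ex : (iter d ostep (existT _ n x)) es => [m x'] es.
case ey : (iter d ostep (existT _ n y)) et => [m' y'] et.
have em : m = m'.
  have := iter_level (fun n => fob (T n)) d (existT _ n x).
  have := iter_level (fun n => fob (T n)) d (existT _ n y).
  by rewrite ex ey /= => -> ->.
subst m'; have [g <-] := step_full es et.
by have [|| f <-] := IH (existT _ m (Arrow g)); [rewrite ex | rewrite ey | exists f].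
Qed.

(** The arrow [g] comes from some stage, where its end points become equal to those of [x] and [y]
    after finitely many transitions. Fullness of the transitions then brings it back to stage
    [n]. *)
Lemma J_full n (x y : Q n) (g : hom (J n x) (J n y)) : exists f : hom x y, fmap (J n) f = g.
Proof.
have [m [a ea]] := colim_surj colim.2 (Arrow g).
have Jx : J m (src a) = J n x by exact: (congr1 (@src L) ea).
have Jy : J m (tgt a) = J n y by exact: (congr1 (@tgt L) ea).
have [d [d1 ed]] := colim_eventually (x := existT _ n x) (y :=
  existT _ m (src a)) colim.1 (esym Jx).
have [d' [d1' ed']] := colim_eventually (x := existT _ n y) (y :=
  existT _ m (tgt a)) colim.1 (esym Jy).
have l1 : (d + n = d1 + m)%N by move/(congr1 (@projT1 _ _)): (ed); rewrite !iter_level.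
have l2 : (d' + n = d1' + m)%N by move/(congr1 (@projT1 _ _)): (ed'); rewrite !iter_level.
(* The shift must settle both end points at once: $d'+d_1$ steps extend the $d_1$ steps needed at
   the source and, being equal to $d+d_1'$, also the $d_1'$ steps needed at the target. *)
pose b := iter (d' + d1) astep (existT _ m a).
have [||f ef] := @iter_full (d' + d) n x y b.
- by rewrite osrc_iter [LHS]iterD [RHS]iterD ed.
- have e1 : (d' + d1 = d + d1')%N by lia.
  by rewrite /b e1 otgt_iter [(d' + d)%N]addnC [LHS]iterD [RHS]iterD ed'.
exists f; apply: Arrow_inj; rewrite -ea.
have := colim_iter colim.2 (d' + d) (existT _ n (Arrow f)).
by rewrite ef (colim_iter colim.2).
Qed.

(** Two arrows identified in the colimit agree after finitely many transitions. The numbers of steps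
    coincide since the levels do, and faithfulness of each transition undoes them. *)
Lemma J_faithful n (x y : Q n) (f f' : hom x y) : fmap (J n) f = fmap (J n) f' -> f = f'.
Proof.
move=> ef; have [|d [d' e]] := colim_eventually (x := existT _ n (Arrow f))
  (y := existT _ n (Arrow f')) colim.2; first by rewrite /= /amap /= ef.
have ed : d = d'.
  by move/(congr1 (@projT1 _ _)): (e); rewrite !iter_level => /addIn.
subst d'; elim: d n x y f f' e {ef} => [|d IH] n x y f f' e.
  exact: Arrow_inj (existT_inj e).
rewrite !iterSr in e; have := IH _ _ _ _ _ e.
by apply: bij_inj; exact: (T_cellular n).1.
Qed.

Definition level_le (n : nat) (x : L) : Prop := in_image (J n) x.

Lemma level_leS n x : level_le n x -> level_le n.+1 x.
Proof. by move=> [c <-]; exists (T n c); exact: colim_ob. Qed.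

Lemma level_le_leq m n x : (m <= n)%N -> level_le m x -> level_le n x.
Proof.
move=> /subnK <- xm; elim: (n - m)%N => // d; exact: level_leS.
Qed.

(** A source of too high a level is lowered one stage at a time: by fullness of [J] the arrow exists
    in that stage and points into the image of [T], so cellularity forces its source into the image
    as well. *)
Lemma level_sieve n x y (g : hom x y) : level_le n y -> level_le n x.
Proof.
move=> [c ec]; subst y; have [m [b eb]] := colim_ob_surj x; subst x.
have [mn|/ltnW nm] := leqP m n; first by apply: level_le_leq mn _; exists b.
rewrite -(subnK nm) in b g *; elim: (m - n)%N b g => [|d IH] b g; first by exists b.
have [c' ec'] : exists c', J (d + n)%N c' = J n c.
  by apply: (level_le_leq (leq_addl d n)); exists c.
have [[b' eb]|nb] := pselect (in_image (T (d + n)%N) b).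
  by subst b; move: g; rewrite [J _ _]colim_ob; exact: IH.
have g' : hom (J (d + n).+1 b) (J (d + n).+1 (T (d + n)%N c')).
  by rewrite colim_ob ec'.
by have [f _] := J_full g'; case: ((T_cellular (d + n)%N).2 b c' nb f).
Qed.

(** As [J] may identify objects, $J d=J c$ does not say that [d] is the image of [c]. But the
    identity then lifts to an arrow from [d] to $T c$, which cellularity excludes when [d] is
    outside the image. *)
Lemma complement_level n (d : Q n.+1) : ~ in_image (T n) d <-> ~ level_le n (J n.+1 d).
Proof.
split=> nd; last by move=> [c ec]; apply: nd; exists c; rewrite -colim_ob ec.
move=> [c ec]; have g : hom (J n.+1 d) (J n.+1 (T n c)).
  by rewrite colim_ob ec; exact: idm.
by have [f _] := J_full g; case: ((T_cellular n).2 d c nd f).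
Qed.
End NaiveColimit.

(** * Alternating sums: simplicial identities and homotopies *)

Section AlternatingSums.
Variable M : zmodType.

Definition altsum (k : nat) (F : nat -> M) : M := \sum_(i < k) F i *~ (-1) ^+ i.

Lemma signS (x : M) i : x *~ (-1) ^+ i.+1 = - (x *~ (-1) ^+ i).
Proof. by rewrite exprS mulN1r mulrNz. Qed.

Lemma signD (x : M) i j : x *~ (-1) ^+ i *~ (-1) ^+ j = x *~ (-1) ^+ (i + j).
Proof. by rewrite -mulrzA -exprD. Qed.

Lemma signK (x : M) i : x *~ (-1) ^+ i *~ (-1) ^+ i = x.
Proof. by rewrite signD -signr_odd oddD addbb expr0 mulr1z. Qed.

Lemma eq_altsum k F G : (forall i, (i < k)%N -> F i = G i) -> altsum k F = altsum k G.
Proof. by move=> FG; apply: eq_bigr => i _; rewrite FG. Qed.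

Lemma altsumB k F G : altsum k (fun i => F i - G i) = altsum k F - altsum k G.
Proof. by rewrite /altsum -sumrB; apply: eq_bigr => i _; rewrite mulrzBl. Qed.

Lemma altsum_sign k F j : altsum k F *~ (-1) ^+ j = altsum k (fun i => F i *~ (-1) ^+ j).
Proof.
rewrite /altsum mulrz_suml; apply: eq_bigr => i _.
by rewrite -!mulrzA mulrC.
Qed.

Lemma altsum_exchange k l (D : nat -> nat -> M) :
  altsum k (fun i => altsum l (D i)) = altsum l (fun j => altsum k (D^~ j)).
Proof.
rewrite /altsum; under eq_bigr do rewrite mulrz_suml.
rewrite exchange_big; apply: eq_bigr => j _; rewrite mulrz_suml; apply: eq_bigr => i _.
by rewrite -!mulrzA mulrC.
Qed.

Lemma altsum_recl k F : altsum k.+1 F = F 0%N - altsum k (fun i => F i.+1).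
Proof.
rewrite /altsum big_ord_recl; congr (_ + _).
by rewrite -sumrN; apply: eq_bigr => i _; rewrite -signS.
Qed.

Lemma altsum_recr k F : altsum k.+1 F = altsum k F + F k *~ (-1) ^+ k.
Proof. by rewrite /altsum big_ord_recr. Qed.

(** The involution [h] exchanges the pair $(i,j)$, $i<j$, with $(j-1,i)$; the corresponding terms
    are equal by hypothesis and have opposite signs. *)
Lemma altsumK k (D : nat -> nat -> M) :
  (forall i j, (i < j)%N -> (j < k.+2)%N -> D i j = D j.-1 i) ->
  altsum k.+1 (fun i => altsum k.+2 (D i)) = 0.
Proof.
move=> DE; rewrite /altsum.
under eq_bigr do rewrite mulrz_suml.
under eq_bigr do under eq_bigr do rewrite signD.
rewrite pair_bigA /= (bigID (fun p : 'I_k.+1 * 'I_k.+2 => (p.1 < p.2)%N)) /=.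
pose h (p : 'I_k.+1 * 'I_k.+2) : 'I_k.+1 * 'I_k.+2 :=
  if (p.1 < p.2)%N then (inord p.2.-1, inord p.1) else (inord p.2, inord p.1.+1).
have hK p : h (h p) = p.
  case: p => i j; rewrite /h /=; have ii := ltn_ord i; have jj := ltn_ord j.
  case: (ltnP i j) => ij /=; rewrite !inordK; try lia.
    rewrite ifF; last by lia.
    by congr pair; apply: val_inj; rewrite /= inordK; lia.
  rewrite ifT; last by lia.
  by congr pair; apply: val_inj; rewrite /= inordK; lia.
rewrite [X in _ + X](reindex_inj (can_inj hK)) /= addrC.
rewrite (eq_bigl (fun p : 'I_k.+1 * 'I_k.+2 => (p.1 < p.2)%N)); last first.
  case=> i j; rewrite /h /=; have ii := ltn_ord i; have jj := ltn_ord j.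
  by case: (ltnP i j) => ij /=; rewrite !inordK; lia.
rewrite -big_split big1 // => -[i j] /= ij.
have ii := ltn_ord i; have jj := ltn_ord j.
rewrite /h /= ij /= !inordK; try lia.
rewrite (DE i j) //; have -> : (j + i)%N = (i + j.-1).+1 by lia.
by rewrite signS addrN.
Qed.

(* The chain homotopy identity of a simplicial homotopy: [D j i] is $d_jh_i$ and
   [H i j] is $h_id_j$. *)
Lemma altsum_prism m (D H : nat -> nat -> M) :
  (forall i j, (j < i)%N -> (i <= m)%N -> D j i = H i.-1 j) ->
  (forall i, (0 < i)%N -> (i <= m)%N -> D i i = D i i.-1) ->
  (forall i j, (i.+1 < j)%N -> (j <= m.+1)%N -> D j i = H i j.-1) ->
  altsum m.+2 (fun j => altsum m.+1 (D j)) + altsum m (fun i => altsum m.+1 (H i)) =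
  D 0%N 0%N - D m.+1 m.
Proof.
move=> D1 D2 D3; rewrite altsum_exchange.
(* For each $h_i$, [lo] and [hi] collect the faces below and above the two middle ones $d_ih_i$ and
   $d_{i+1}h_i$. The middle ones are $e_i-e_{i+1}$ and telescope; [lo] and [hi] cancel against the
   second double sum. *)
pose lo i := \sum_(0 <= j < i) H i.-1 j *~ (-1) ^+ (j + i).
pose hi i := \sum_(i.+1 <= j < m.+1) H i j *~ (-1) ^+ (j + i).
pose e i := if (i <= m)%N then D i i else D m.+1 m.
have col i : (i <= m)%N ->
    altsum m.+2 (D^~ i) *~ (-1) ^+ i = lo i + (e i - e i.+1) - hi i.
  move=> im; rewrite /altsum mulrz_suml; under eq_bigr do rewrite signD.
  rewrite -(big_mkord predT (fun j => D j i *~ (-1) ^+ (j + i))) /=.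
  rewrite (big_cat_nat _ (n := i)) //=; last by lia.
  rewrite -addrA; congr (_ + _).
    by rewrite /lo; apply: eq_big_nat => j /andP[_ ji]; rewrite D1.
  rewrite big_ltn ?[X in _ + X]big_ltn; try lia.
  have -> : D i i *~ (-1) ^+ (i + i) = e i by rewrite -signD signK /e im.
  have -> : D i.+1 i *~ (-1) ^+ (i.+1 + i) = - e i.+1.
    rewrite addSn signS -signD signK /e; case: ltnP => [im'|mi]; first by rewrite D2.
    by have -> : i = m by lia.
  rewrite addrA; congr (_ + _); rewrite big_add1 /hi -sumrN.
  by apply: eq_big_nat => j /andP[ij jm]; rewrite addSn signS D3.
have -> : altsum m.+1 (fun i => altsum m.+2 (D^~ i)) =
    \sum_(0 <= i < m.+1) lo i + (e 0%N - e m.+1) - \sum_(0 <= i < m) hi i.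
  rewrite /altsum -(big_mkord predT (fun i => altsum m.+2 (D^~ i) *~ (-1) ^+ i)) /=.
  rewrite (eq_big_nat _ _ (F2 := fun i => lo i + (e i - e i.+1) - hi i)); last first.
    by move=> i /andP[_ im]; exact: col.
  have tel : \sum_(0 <= i < m.+1) (e i - e i.+1) = e 0%N - e m.+1.
    by rewrite -opprB -telescope_sumr // -sumrN; apply: eq_bigr => i _; rewrite opprB.
  rewrite sumrB big_split /= tel; congr (_ - _).
  by rewrite big_nat_recr //= /hi [X in _ + X]big_geq ?addr0.
rewrite {2}/e ltnn [e 0%N]/e leq0n.
have -> : altsum m (fun i => altsum m.+1 (H i)) =
    \sum_(0 <= i < m) hi i - \sum_(0 <= i < m.+1) lo i.
  have lo0 : lo 0%N = 0 by rewrite /lo big_geq.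
  rewrite big_nat_recl // lo0 add0r /altsum.
  rewrite -(big_mkord predT (fun i => altsum m.+1 (H i) *~ (-1) ^+ i)) /=.
  rewrite -sumrB; apply: eq_big_nat => i /andP[_ im].
  rewrite /altsum mulrz_suml; under eq_bigr do rewrite signD.
  rewrite -(big_mkord predT (fun j => H i j *~ (-1) ^+ (j + i))) /=.
  rewrite (big_cat_nat _ (n := i.+1)) //=; last by lia.
  rewrite addrC; congr (_ + _); rewrite /lo -sumrN.
  by apply: eq_bigr => j _; rewrite addnS signS opprK.
by rewrite addrA subrK addrC addKr.
Qed.
End AlternatingSums.

Lemma quot_eq0 (M : zmodType) (Z : zmodClosed M) x :
  (\pi_(Quotient.quot Z)%qT x == 0) = (x \in Z).
Proof. by rewrite -[0](raddf0 (\pi_(Quotient.quot Z))%qT) -Quotient.idealrBE subr0. Qed.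

(** * Free groups tensored with $A$ *)

Section FreePartialMap.
Variables (K L : choiceType) (f : K -> option L).

Definition free_pmap : {freeg K / int} -> {freeg L / int} :=
  fglift (fun x => if f x is Some y then << y >> : {freeg L / int} else 0).

HB.instance Definition _ := GRing.isZmodMorphism.Build
  {freeg K / int} {freeg L / int} free_pmap (lift_is_additive _).

Lemma free_pmapU x : free_pmap << x >> = if f x is Some y then << y >> else 0.
Proof. by rewrite /free_pmap liftU scale1r. Qed.
End FreePartialMap.

Section LinearSpan.
Variable A : zmodType.

Definition lin (W : Type) : zmodType := tensor A {freeg {classic W} / int}.

Definition gen (W : Type) (w : W) (a : A) : lin W :=
  tens (<< (w : {classic W}) >> : {freeg {classic W} / int}) a.

Lemma tensDl (M : zmodType) (m m' : M) (a : A) : tens (m + m') a = tens m a + tens m' a.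
Proof.
apply/eqP; rewrite -subr_eq0 opprD addrA /tens -!raddfB; apply: etrans (quot_eq0 _ _) _.
rewrite unfold_in /=; apply/asboolP => Z; apply.
by left; exists m, m', a.
Qed.

Definition tensr (M : zmodType) (a : A) (m : M) : tensor A M := tens m a.

Fact tensr_is_zmod_morphism (M : zmodType) (a : A) : zmod_morphism (@tensr M a).
Proof. by move=> m m' /=; apply/eqP; rewrite eq_sym subr_eq -tensDl subrK. Qed.
HB.instance Definition _ (M : zmodType) (a : A) :=
  GRing.isZmodMorphism.Build M (tensor A M) (@tensr M a) (@tensr_is_zmod_morphism M a).

Lemma lin_ext (W : Type) (N : zmodType) (g h : {additive lin W -> N}) :
  (forall w a, g (gen w a) = h (gen w a)) -> g =1 h.
Proof.
move=> gh; apply: tensor_ext => m a.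
exact: (@free_ext _ _ (g \o tensr a : {additive _ -> _})
  (h \o tensr a : {additive _ -> _}) (fun w => gh w a) m).
Qed.

(** [P] is made into a subgroup; the projection to the quotient agrees with zero on generators,
    hence everywhere. *)
Lemma lin_ind (W : Type) (P : lin W -> Prop) :
  P 0 -> (forall x y, P x -> P y -> P (x - y)) -> (forall w a, P (gen w a)) -> forall x, P x.
Proof.
move=> P0 PB Pgen; pose S (x : lin W) : bool := `[< P x >].
have S_closed : zmod_closed S.
  by split=> [|x y /asboolP Px /asboolP Py]; apply/asboolP; [exact: P0 | exact: PB].
pose Z : zmodClosed (lin W) := HB.pack S (GRing.isZmodClosed.Build _ S S_closed).
move=> x; apply/asboolP; change (x \in Z); rewrite -quot_eq0; apply/eqP.
apply: (@lin_ext _ _ (\pi_(Quotient.quot Z))%qT \0) => w a.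
by apply/eqP; rewrite quot_eq0; apply/asboolP.
Qed.

Definition lin_map (W W' : Type) (f : W -> W') : {additive lin W -> lin W'} :=
  tensor_map A (@free_map {classic W} {classic W'} f).

Arguments lin_map : simpl never.

Lemma lin_mapE W W' (f : W -> W') w a : lin_map f (gen w a) = gen (f w) a.
Proof. by rewrite /lin_map /gen tensor_mapE; congr (tens _ _); exact: free_mapU. Qed.

Lemma lin_map_comp W W' W'' (f : W -> W') (g : W' -> W'') x :
  lin_map g (lin_map f x) = lin_map (g \o f) x.
Proof.
move: x; apply: (lin_ext (g := lin_map g \o lin_map f)) => w a.
by rewrite [LHS](congr1 (lin_map g) (lin_mapE _ _ _)) !lin_mapE.
Qed.

Lemma eq_lin_map W W' (f g : W -> W') x : f =1 g -> lin_map f x = lin_map g x.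
Proof. by move=> fg; move: x; apply: lin_ext => w a; rewrite !lin_mapE fg. Qed.

Lemma lin_map_id W (f : W -> W) x : f =1 id -> lin_map f x = x.
Proof. by move=> fI; move: x; apply: (lin_ext (h := idfun)) => w a; rewrite lin_mapE fI. Qed.

Definition lin_pmap (W W' : Type) (f : W -> option W') : {additive lin W -> lin W'} :=
  tensor_map A (@free_pmap {classic W} {classic W'} f).
Arguments lin_pmap : simpl never.

Lemma lin_pmapE W W' (f : W -> option W') w a :
  lin_pmap f (gen w a) = if f w is Some w' then gen w' a else 0.
Proof.
transitivity (tens (if f w is Some w' then (<< (w' : {classic W'}) >> :
  {freeg {classic W'} / int}) else 0) a).
  by rewrite /lin_pmap /gen tensor_mapE; congr (tens _ _); exact: free_pmapU.
by case: (f w) => //; rewrite tens0.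
Qed.
End LinearSpan.

(** * Labelled chains *)

Section Words.
Variables (X : category) (C D : Type) (jc : C -> X) (jd : D -> X).

(* A vertex of a chain in [X] together with a lift of it to [C] or to [D], or with
   no lift at all. *)
Inductive label := LabC of C | LabD of D | LabX of X.

Definition pos (o : label) : X :=
  match o with LabC c => jc c | LabD d => jd d | LabX x => x end.

(** The chosen lift depends on the position alone, so choosing a lift absorbs any earlier change of
    label. Where no lift exists the value is a harmless unlifted label. *)
Definition toC (o : label) : label :=
  if pselect (exists c, jc c = pos o) is left e then LabC (sval (cid e)) else LabX (pos o).
Definition toD (o : label) : label :=
  if pselect (exists d, jd d = pos o) is left e then LabD (sval (cid e)) else LabX (pos o).
Definition toX (o : label) : label := LabX (pos o).

(* In the shapes [isL] and [isE] no lift is recorded, although one exists. *)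
Definition isC (o : label) := exists c, o = LabC c.
Definition isD (o : label) := exists d, o = LabD d.
Definition isL (o : label) := o = LabX (pos o) /\ exists c, jc c = pos o.
Definition isE (o : label) := o = LabX (pos o) /\ exists d, jd d = pos o.

Lemma pos_toC o : pos (toC o) = pos o.
Proof. by rewrite /toC; case: pselect => // e /=; case: cid. Qed.
Lemma pos_toD o : pos (toD o) = pos o.
Proof. by rewrite /toD; case: pselect => // e /=; case: cid. Qed.
Lemma toX_pos o o' : pos o = pos o' -> toX o = toX o'.
Proof. by move=> e; rewrite /toX e. Qed.

Lemma isC_toC o : isC o -> isC (toC o).
Proof.
by move=> [c ->]; rewrite /toC; case: pselect => [e|[]]; [eexists | exists c].
Qed.
Lemma isL_toC o : isL o -> isC (toC o).
Proof. by move=> [_ oc]; rewrite /toC; case: pselect => // e; eexists. Qed.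
Lemma isE_toD o : isE o -> isD (toD o).
Proof. by move=> [_ oc]; rewrite /toD; case: pselect => // e; eexists. Qed.
Lemma isD_toX o : isD o -> isE (toX o).
Proof. by move=> [d ->]; split=> //; exists d. Qed.
Lemma isC_toX o : isC o -> isL (toX o).
Proof. by move=> [c ->]; split=> //; exists c. Qed.
Lemma isE_toX o : isE o -> isE (toX o).
Proof. by move=> [_ [d ed]]; split=> //; exists d. Qed.

Record word (n : nat) (sh : nat -> label -> Prop) := Word {
  wchain : functor (ordcat n) X;
  wlab : 'I_n.+1 -> label;
  wpos : forall i, pos (wlab i) = wchain i;
  wshape : forall i : 'I_n.+1, sh i (wlab i) }.

Lemma word_eq n sh (w w' : word n sh) :
  wchain w = wchain w' -> (forall i, wlab w i = wlab w' i) -> w = w'.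
Proof.
case: w w' => [u l p s] [u' l' p' s'] /= eu el; subst u'.
have {}el : l = l' by apply: functional_extensionality_dep.
by subst l'; congr Word; exact: Prop_irrelevance.
Qed.

(** One format for all operators on words: vertex [q] of the result is vertex [rix q] of the
    argument, with its lift altered by [rlab q]. Indices are plain natural numbers, so that
    identities between composites become linear arithmetic. *)
Record reindexing n (sh : nat -> label -> Prop) n' (sh' : nat -> label -> Prop) := Reindexing {
  rix : nat -> nat;
  rlab : nat -> label -> label;
  rix_le : forall q, (q <= n')%N -> (rix q <= n)%N;
  rix_mono : forall q r, (q <= r)%N -> (r <= n')%N -> (rix q <= rix r)%N;
  rlab_pos : forall q o, pos (rlab q o) = pos o;
  rlab_shape : forall q o, (q <= n')%N -> sh (rix q) o -> sh' q (rlab q o) }.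

Section Action.
Variables (n : nat) (sh : nat -> label -> Prop) (n' : nat) (sh' : nat -> label -> Prop).
Variable f : reindexing n sh n' sh'.

Lemma rix_ord_subproof (q : 'I_n'.+1) : (rix f q < n.+1)%N.
Proof. by have := ltn_ord q; rewrite !ltnS; exact: rix_le. Qed.

Definition rix_delta : Delta n' n :=
  @Functor (ordcat n') (ordcat n) (fun q : 'I_n'.+1 => Ordinal (rix_ord_subproof q))
    (fun q r (qr : (q <= r)%N) => @rix_mono _ _ _ _ f q r qr (ltn_ord r))
    (fun _ => bool_irrelevance _ _) (fun _ _ _ _ _ => bool_irrelevance _ _).

Definition ract (w : word n sh) : word n' sh' :=
  @Word n' sh' (functor_cmp (wchain w) rix_delta)
    (fun q : 'I_n'.+1 => rlab f q (wlab w (Ordinal (rix_ord_subproof q))))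
    (fun q => etrans (rlab_pos f q _) (wpos w _))
    (fun q => @rlab_shape _ _ _ _ f q _ (ltn_ord q) (wshape w (Ordinal (rix_ord_subproof q)))).
End Action.

Lemma ract_eq n sh n' sh' (f g : reindexing n sh n' sh') (w : word n sh) :
  (forall q, (q <= n')%N -> rix f q = rix g q) ->
  (forall q o, (q <= n')%N -> sh (rix f q) o -> rlab f q o = rlab g q o) -> ract f w = ract g w.
Proof.
move=> eix elab; apply: word_eq => [|q] /=.
  congr functor_cmp; apply: Delta_ext => q; apply: val_inj => /=; apply: eix.
  exact: (ltn_ord q).
have qn : (q <= n')%N by exact: (ltn_ord q).
have -> : Ordinal (rix_ord_subproof g q) = Ordinal (rix_ord_subproof f q).
  by apply: val_inj; rewrite /= eix.
by apply: elab => //; exact: wshape (Ordinal _).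
Qed.

Section Composition.
Variables (n1 n2 n3 : nat) (sh1 sh2 sh3 : nat -> label -> Prop).
Variables (f : reindexing n1 sh1 n2 sh2) (g : reindexing n2 sh2 n3 sh3).

Definition rcomp : reindexing n1 sh1 n3 sh3.
Proof.
refine (@Reindexing n1 sh1 n3 sh3 (fun q => rix f (rix g q))
  (fun q o => rlab g q (rlab f (rix g q) o)) _ _ _ _).
- by move=> q qn; do 2!apply: rix_le.
- by move=> q r qr rn; apply: rix_mono; [exact: rix_mono | exact: rix_le].
- by move=> q o; rewrite !rlab_pos.
- by move=> q o qn; move/(rlab_shape (rix_le g qn)) => /(rlab_shape qn).
Defined.

Lemma ract_comp w : ract g (ract f w) = ract rcomp w.
Proof.
apply: word_eq => [|q] /=.
  by rewrite -functor_cmpA; congr functor_cmp; apply: Delta_ext => q; apply: val_inj.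
by congr (rlab g _ (rlab f _ (wlab w _))); apply: val_inj.
Qed.
End Composition.

Lemma ract_id n sh (f : reindexing n sh n sh) (w : word n sh) :
  (forall q, (q <= n)%N -> rix f q = q) ->
  (forall q o, (q <= n)%N -> sh q o -> rlab f q o = o) -> ract f w = w.
Proof.
move=> eix elab; apply: word_eq => [|q] /=.
  rewrite -[RHS]functor_cmp_idr; congr functor_cmp; apply: Delta_ext => q.
  by apply: val_inj => /=; apply: eix; exact: (ltn_ord q).
have qn : (q <= n)%N by exact: (ltn_ord q).
have -> : Ordinal (rix_ord_subproof f q) = q by apply: val_inj; rewrite /= eix.
by apply: elab => //; exact: wshape.
Qed.

Variable A : zmodType.
Definition rop n sh n' sh' (f : reindexing n sh n' sh') :
  {additive lin A (word n sh) -> lin A (word n' sh')} := lin_map A (ract f).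
Arguments rop : simpl never.

(** This is the reduction on which all operator identities rest: equal positions and equal
    relabellings, the latter only for labels of the prescribed shape. *)
Lemma rop_comp_eq n sh n1 sh1 n2 sh2 n' sh' (f : reindexing n sh n1 sh1)
    (g : reindexing n1 sh1 n' sh') (f' : reindexing n sh n2 sh2)
    (g' : reindexing n2 sh2 n' sh') x :
  (forall q, (q <= n')%N -> rix f (rix g q) = rix f' (rix g' q)) ->
  (forall q o, (q <= n')%N -> sh (rix f (rix g q)) o ->
    rlab g q (rlab f (rix g q) o) = rlab g' q (rlab f' (rix g' q) o)) ->
  rop g (rop f x) = rop g' (rop f' x).
Proof.
move=> eix elab; rewrite /rop !lin_map_comp; apply: eq_lin_map => w /=.
by rewrite !ract_comp; exact: ract_eq.
Qed.

Lemma rop_comp_id n sh n1 sh1 (f : reindexing n sh n1 sh1) (g : reindexing n1 sh1 n sh) x :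
  (forall q, (q <= n)%N -> rix f (rix g q) = q) ->
  (forall q o, (q <= n)%N -> sh q o -> rlab g q (rlab f (rix g q) o) = o) ->
  rop g (rop f x) = x.
Proof.
move=> eix elab; rewrite /rop lin_map_comp; apply: lin_map_id => w /=.
by rewrite ract_comp; exact: ract_id.
Qed.

Definition shA (m q : nat) (o : label) : Prop :=
  if (q < m.+1)%N then isC o else if (q < m.+1 + m.+1)%N then isD o else isE o.
Definition shD (m q : nat) (o : label) : Prop := if (q < m.+1)%N then isD o else isE o.
Definition shY (a q : nat) (o : label) : Prop := if (q < a)%N then isL o else isE o.

(* [wordA m B] is $c_0\to\dots\to c_m\to d_0\to\dots\to d_m\to e_1\to\dots\to e_B$,
   [wordD m B] is $d_0\to\dots\to d_m\to e_1\to\dots\to e_B$ and [wordY a B] is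
   $x_1\to\dots\to x_a\to e_0\to\dots\to e_B$. *)
Definition wordA m B := word (m + m.+1 + B) (shA m).
Definition wordD m B := word (m + B) (shD m).
Definition wordY a B := word (a + B) (shY a).
End Words.

Ltac split_ifs := repeat (
  match goal with
  | |- context [if (?a <= ?b)%N then _ else _] => case: (leqP a b) => ?
  | |- context [nat_of_bool (?a <= ?b)%N] => case: (leqP a b) => ?
  end; cbn iota beta delta [nat_of_bool]).
Ltac ixsolve := move=> *; cbv beta; split_ifs; lia.
Ltac shsolve := move=> q o qn; cbv beta; split_ifs; rewrite /shA /shD /shY; split_ifs;
  solve [done | exfalso; lia | auto using isC_toC, isL_toC, isE_toD, isD_toX, isC_toX, isE_toX].

(** * Deletion, forgetting and insertion of vertices *)

Section Operators.
Variables (X : category) (C D : Type) (jc : C -> X) (jd : D -> X) (A : zmodType).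
Notation shA := (@shA X C D jc jd).
Notation shD := (@shD X C D jc jd).
Notation shY := (@shY X C D jc jd).
Notation toC := (toC jc jd).
Notation toD := (toD jc jd).
Notation toX := (toX jc jd).
Notation idl := (fun (_ : nat) o => o).

Notation Reind s s' ix lab :=
  (@Reindexing X C D jc jd _ s _ s' ix lab _ _ _ _) (only parsing).

(* The deletion indices are truncated so that every family is indexed by [nat]. *)
Definition rdelA (m B i : nat) :
  reindexing jc jd (m.+1 + m.+2 + B) (shA m.+1) (m + m.+1 + B) (shA m).
Proof.
(* Both $c_i$ and $d_i$ are omitted, as a face of the diagonal acts on both directions of the
   bisimplicial set. *)
refine (Reind (shA m.+1) (shA m)
  (fun q => if (q < m.+1)%N then q + (minn i m.+1 <= q)
            else if (q < m.+1 + m.+1)%N then q + 1 + (minn i m.+1 <= q - m.+1) else q + 2)%N idl);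
  [ixsolve | ixsolve | by [] | shsolve].
Defined.

(** Omits $e_{j+1}$, which sits at position $2(m+1)+j$. *)
Definition reA (m B j : nat) :
  reindexing jc jd (m + m.+1 + B.+1) (shA m) (m + m.+1 + B) (shA m).
Proof.
refine (Reind (shA m) (shA m) (fun q => q + (j + (m.+1 + m.+1) <= q))%N idl);
  [ixsolve | ixsolve | by [] | shsolve].
Defined.

Definition rdelD (m B i : nat) : reindexing jc jd (m.+1 + B) (shD m.+1) (m + B) (shD m).
Proof.
refine (Reind (shD m.+1) (shD m) (fun q => q + (minn i m.+1 <= q))%N idl);
  [ixsolve | ixsolve | by [] | shsolve].
Defined.

Definition reD (m B j : nat) : reindexing jc jd (m + B.+1) (shD m) (m + B) (shD m).
Proof.
refine (Reind (shD m) (shD m) (fun q => q + (j + m.+1 <= q))%N idl);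
  [ixsolve | ixsolve | by [] | shsolve].
Defined.

Definition rdelY (a B i : nat) : reindexing jc jd (a.+1 + B) (shY a.+1) (a + B) (shY a).
Proof.
refine (Reind (shY a.+1) (shY a) (fun q => q + (minn i a <= q))%N idl);
  [ixsolve | ixsolve | by [] | shsolve].
Defined.

(** Omits $e_j$: in these words the numbering of the $e$'s starts at 0. *)
Definition reY (a B j : nat) : reindexing jc jd (a + B.+1) (shY a) (a + B) (shY a).
Proof.
refine (Reind (shY a) (shY a) (fun q => q + (j + a <= q))%N idl);
  [ixsolve | ixsolve | by [] | shsolve].
Defined.

Definition raug (m B : nat) : reindexing jc jd (m + m.+1 + B) (shA m) (m + B) (shD m).
Proof.
refine (Reind (shA m) (shD m) (fun q => q + m.+1)%N idl);
  [ixsolve | ixsolve | by [] | shsolve].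
Defined.

(** Forgets the $d$'s and the lifts of the $c$'s; the former $e_1$ becomes $e_0$. *)
Definition rfA (m B : nat) : reindexing jc jd (m + m.+1 + B.+1) (shA m) (m.+1 + B) (shY m.+1).
Proof.
refine (Reind (shA m) (shY m.+1) (fun q => if (q < m.+1)%N then q else q + m.+1)%N
  (fun q => if (q < m.+1)%N then toX else id)); [ixsolve | ixsolve | | shsolve].
by move=> q o /=; case: ifP.
Defined.

Definition rfD (B : nat) : reindexing jc jd (0 + B.+1) (shD 0) (0 + B) (shY 0).
Proof.
refine (Reind (shD 0) (shY 0) (fun q => q + 1)%N idl);
  [ixsolve | ixsolve | by [] | shsolve].
Defined.

(** Repeats $d_m$, stripped of its lift, as a new first $e$. *)
Definition rsA (m B : nat) : reindexing jc jd (m + m.+1 + B) (shA m) (m + m.+1 + B.+1) (shA m).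
Proof.
refine (Reind (shA m) (shA m) (fun q => if (q < m.+1 + m.+1)%N then q else q - 1)%N
  (fun q => if (q < m.+1 + m.+1)%N then id else if (q < m.+1 + m.+2)%N then toX else id));
  [ixsolve | ixsolve | | shsolve].
by move=> q o /=; do 2!case: ifP => _ //.
Defined.

Definition rsD (m B : nat) : reindexing jc jd (m + B) (shD m) (m + B.+1) (shD m).
Proof.
refine (Reind (shD m) (shD m) (fun q => if (q < m.+1)%N then q else q - 1)%N
  (fun q => if (q < m.+1)%N then id else if (q < m.+2)%N then toX else id));
  [ixsolve | ixsolve | | shsolve].
by move=> q o /=; do 2!case: ifP => _ //.
Defined.

(** Inserts $e_1$ with a chosen lift as $d_{m+1}$; deleting this last $d$ undoes it. *)
Definition rtD (m B : nat) : reindexing jc jd (m + B.+1) (shD m) (m.+1 + B.+1) (shD m.+1).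
Proof.
refine (Reind (shD m) (shD m.+1) (fun q => if (q < m.+2)%N then q else q - 1)%N
  (fun q => if (q < m.+1)%N then id else if (q < m.+2)%N then toD else id));
  [ixsolve | ixsolve | | shsolve].
by move=> q o /=; do 2!case: ifP => _ //; exact: pos_toD.
Defined.

Definition rgD (B : nat) : reindexing jc jd (0 + B) (shY 0) (0 + B.+1) (shD 0).
Proof.
refine (Reind (shY 0) (shD 0) (fun q => q - 1)%N (fun q => if (q < 1)%N then toD else id));
  [ixsolve | ixsolve | | shsolve].
by move=> q o /=; case: ifP => _ //; exact: pos_toD.
Defined.

(** A section of [rfA]: the $x$'s receive chosen lifts and all $m+1$ of the $d$'s are the chosen
    lift of $e_0$. *)
Definition rgA (m B : nat) : reindexing jc jd (m.+1 + B) (shY m.+1) (m + m.+1 + B.+1) (shA m).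
Proof.
refine (Reind (shY m.+1) (shA m)
  (fun q => if (q < m.+1)%N then q else if (q < m.+1 + m.+1)%N then m.+1 else q - m.+1)%N
  (fun q => if (q < m.+1)%N then toC else if (q < m.+1 + m.+1)%N then toD else id));
  [ixsolve | ixsolve | | shsolve].
by move=> q o /=; case: ifP => _; [exact: pos_toC | case: ifP => _ //; exact: pos_toD].
Defined.

(* $(c_0\to\dots\to c_i\to c'_i\to\dots\to c'_m\to d_0\to\dots\to d_i\to e'_1\to\dots\to e'_1)$,
   with primes for the chosen lifts: these are the terms of the homotopy replacing
   all $c_j$ by chosen lifts and all $d_j$ by a lift of $e_1$. *)
Definition rprism (m B i : nat) :
  reindexing jc jd (m + m.+1 + B.+1) (shA m) (m.+1 + m.+2 + B.+1) (shA m.+1).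
Proof.
refine (Reind (shA m) (shA m.+1)
  (fun q => if (q < m.+2)%N then (if (q <= minn i m)%N then q else q - 1)
     else if (q < m.+2 + m.+2)%N then
       (if (q - m.+2 <= minn i m)%N then q - 1 else m.+1 + m.+1) else q - 2)%N
  (fun q => if (q < m.+2)%N then (if (q <= minn i m)%N then id else toC)
     else if (q < m.+2 + m.+2)%N then (if (q - m.+2 <= minn i m)%N then id else toD) else id));
  [ixsolve | ixsolve | | shsolve].
move=> q o /=; case: ifP => _; case: ifP => _ //; first exact: pos_toC.
by case: ifP => _ //; exact: pos_toD.
Defined.
End Operators.

Lemma sign_even (M : zmodType) (x : M) n : odd n = false -> x *~ (-1) ^+ n = x.
Proof. by move=> e; rewrite -signr_odd e expr0 mulr1z. Qed.

Ltac no_if t := match t with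
  | context [if _ then _ else _] => fail 1 | context [nat_of_bool _] => fail 1 | _ => idtac end.
Ltac split_inner_ifs := repeat (
  match goal with
  | |- context [if (?a <= ?b)%N then _ else _] => no_if a; no_if b; case: (leqP a b) => ?
  | |- context [nat_of_bool (?a <= ?b)%N] => no_if a; no_if b; case: (leqP a b) => ?
  end; cbn iota beta delta [nat_of_bool]; try (exfalso; lia)).
Ltac unfold_rix := cbn beta iota delta
  [rix rlab rdelA reA rdelD reD rdelY reY raug rfA rfD rsA rsD rtD rgD rgA rprism].
Ltac rix_solve := move=> *; unfold_rix; split_inner_ifs; lia.
Ltac rlab_solve := move=> *; unfold_rix; split_inner_ifs; first [by [] | exfalso; lia].

(** * Differentials and homotopies of the total complex of words *)

Section OperatorIdentities.
Variables (X : category) (C D : Type) (jc : C -> X) (jd : D -> X) (A : zmodType).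

Notation XA := (fun m B : nat => lin A (wordA jc jd m B)).
Notation XD := (fun m B : nat => lin A (wordD jc jd m B)).
Notation XY := (fun a B : nat => lin A (wordY jc jd a B)).

Section AlternatingOperator.
Variables (n : nat) (sh : nat -> label X C D -> Prop).
Variables (n' : nat) (sh' : nat -> label X C D -> Prop).
Variables (s k : nat) (f : nat -> reindexing jc jd n sh n' sh').

(** A common form for differentials, augmentations and homotopies; with the global sign kept as the
    exponent [s], sign questions become questions of parity. *)
Definition altop (x : lin A (word jc jd n sh)) : lin A (word jc jd n' sh') :=
  altsum k (fun i => rop A (f i) x) *~ (-1) ^+ s.

Lemma altop_is_zmod_morphism : zmod_morphism altop.
Proof.
move=> x y; rewrite /altop -mulrzBl -altsumB; congr (_ *~ _).
by apply: eq_altsum => i _; rewrite raddfB.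
Qed.
HB.instance Definition _ := GRing.isZmodMorphism.Build _ _ altop altop_is_zmod_morphism.
End AlternatingOperator.

Arguments altop : simpl never.

Lemma altop_comp n sh n1 sh1 n2 sh2 s k s' k'
    (f : nat -> reindexing jc jd n1 sh1 n2 sh2) (g : nat -> reindexing jc jd n sh n1 sh1) x :
  altop s k f (altop s' k' g x) =
  altsum k (fun i => altsum k' (fun j => rop A (f i) (rop A (g j) x))) *~ (-1) ^+ (s' + s).
Proof.
rewrite /altop -signD; congr (_ *~ _); rewrite [RHS]altsum_sign; apply: eq_altsum => i _.
rewrite raddfMz /altsum raddf_sum; congr (_ *~ _); apply: eq_bigr => j _.
by rewrite raddfMz.
Qed.

Lemma altop1 n sh n1 sh1 s (f : nat -> reindexing jc jd n sh n1 sh1) x :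
  altop s 1 f x = rop A (f 0%N) x *~ (-1) ^+ s.
Proof. by rewrite /altop /altsum big_ord_recl big_ord0 addr0 expr0 mulr1z. Qed.

Lemma altopK n sh n1 sh1 n2 sh2 s s' k
    (f : nat -> reindexing jc jd n1 sh1 n2 sh2) (g : nat -> reindexing jc jd n sh n1 sh1) x :
  (forall i j, (i < j)%N -> (j < k.+2)%N ->
    rop A (f i) (rop A (g j) x) = rop A (f j.-1) (rop A (g i) x)) ->
  altop s k.+1 f (altop s' k.+2 g x) = 0.
Proof. by move=> fg; rewrite altop_comp altsumK ?mul0rz. Qed.

Lemma altop_anticomm n sh n1 sh1 n2 sh2 n3 sh3 s k s' k' t t'
    (f : nat -> reindexing jc jd n1 sh1 n3 sh3) (g : nat -> reindexing jc jd n sh n1 sh1)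
    (g' : nat -> reindexing jc jd n2 sh2 n3 sh3) (f' : nat -> reindexing jc jd n sh n2 sh2) x :
  odd (s' + s) != odd (t + t') ->
  (forall i j, (i < k)%N -> (j < k')%N ->
    rop A (f i) (rop A (g j) x) = rop A (g' j) (rop A (f' i) x)) ->
  altop s k f (altop s' k' g x) = - altop t' k' g' (altop t k f' x).
Proof.
move=> odds fg; rewrite !altop_comp altsum_exchange.
rewrite (eq_altsum (G := fun j => altsum k (fun i => rop A (g' j) (rop A (f' i) x)))); last first.
  by move=> j jk; apply: eq_altsum => i ik; rewrite fg.
rewrite -signr_odd -[in RHS]signr_odd; move: odds.
by case: (odd _) (odd _) => -[] //= _; rewrite ?expr0 ?expr1 ?mulrN1z ?mulr1z ?opprK.
Qed.

Lemma altop_pair n sh n1 sh1 n2 sh2 s s' (f : reindexing jc jd n1 sh1 n2 sh2)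
    (g : nat -> reindexing jc jd n sh n1 sh1) x :
  rop A f (rop A (g 0%N) x) = rop A f (rop A (g 1%N) x) ->
  altop s 1 (fun=> f) (altop s' 2 g x) = 0.
Proof.
move=> fg; rewrite altop_comp /altsum big_ord_recl big_ord0 addr0.
by rewrite !big_ord_recl big_ord0 addr0 fg expr0 mulr1z addrN !mul0rz.
Qed.

Lemma altop_retract n sh n1 sh1 s s' (f : nat -> reindexing jc jd n1 sh1 n sh)
    (g : nat -> reindexing jc jd n sh n1 sh1) x :
  odd (s' + s) = false -> rop A (f 0%N) (rop A (g 0%N) x) = x ->
  altop s 1 f (altop s' 1 g x) = x.
Proof.
by move=> e fg; rewrite altop_comp /altsum !big_ord_recl !big_ord0 !addr0 fg !mulr1z sign_even.
Qed.

(** An extra degeneracy at the front: [g] is undone by the first face and passes through the others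
    with the index lowered by one. *)
Lemma altop_contract_l n sh n1 sh1 n2 sh2 s k s' t t'
    (f : nat -> reindexing jc jd n1 sh1 n sh) (g : reindexing jc jd n sh n1 sh1)
    (f' : nat -> reindexing jc jd n sh n2 sh2) (g' : reindexing jc jd n2 sh2 n sh) x :
  odd (s' + s) = false -> odd (t + t') = false -> rop A (f 0%N) (rop A g x) = x ->
  (forall j, (j < k)%N -> rop A (f j.+1) (rop A g x) = rop A g' (rop A (f' j) x)) ->
  altop s k.+1 f (altop s' 1 (fun=> g) x) = x - altop t' 1 (fun=> g') (altop t k f' x).
Proof.
move=> e e' fg fg'; rewrite !altop_comp altsum_exchange [altsum 1 _]big_ord_recl big_ord0 addr0.
rewrite [altsum 1 _]big_ord_recl big_ord0 addr0 !mulr1z (sign_even _ e) (sign_even _ e').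
rewrite altsum_recl fg; congr (_ - _).
by apply: eq_altsum => j jk; rewrite fg'.
Qed.

(** An extra degeneracy at the end: [g] is undone by the last face, whose sign $(-1)^k$ accounts for
    the parity conditions. *)
Lemma altop_contract_r n sh n1 sh1 n2 sh2 s k s' t t'
    (f : nat -> reindexing jc jd n1 sh1 n sh) (g : reindexing jc jd n sh n1 sh1)
    (f' : nat -> reindexing jc jd n sh n2 sh2) (g' : reindexing jc jd n2 sh2 n sh) x :
  odd (s' + s) = odd k -> odd (t + t') = ~~ odd k -> rop A (f k) (rop A g x) = x ->
  (forall i, (i < k)%N -> rop A (f i) (rop A g x) = rop A g' (rop A (f' i) x)) ->
  altop s k.+1 f (altop s' 1 (fun=> g) x) = x - altop t' 1 (fun=> g') (altop t k f' x).
Proof.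
move=> e e' fg fg'; rewrite !altop_comp altsum_exchange [altsum 1 _]big_ord_recl big_ord0 addr0.
rewrite [altsum 1 _]big_ord_recl big_ord0 addr0 !mulr1z altsum_recr fg mulrzDl signD.
rewrite [x *~ _]sign_even; last by rewrite oddD e addbb.
rewrite addrC; congr (_ + _).
rewrite (eq_altsum (G := fun j => rop A g' (rop A (f' j) x))) //.
rewrite -signr_odd e -[in RHS]signr_odd e'; by case: (odd k);
  rewrite /= ?expr0 ?expr1 ?mulrN1z ?mulr1z ?opprK.
Qed.

(** The outer sign, present because the differential of the $c$-words is negated, interchanges the
    two end terms of [altsum_prism]. *)
Lemma altop_prism n sh n1 sh1 n2 sh2 m (f : nat -> reindexing jc jd n1 sh1 n sh)
    (h : nat -> reindexing jc jd n sh n1 sh1) (f' : nat -> reindexing jc jd n sh n2 sh2)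
    (h' : nat -> reindexing jc jd n2 sh2 n sh) x :
  (forall i j, (j < i)%N -> (i <= m)%N ->
    rop A (f j) (rop A (h i) x) = rop A (h' i.-1) (rop A (f' j) x)) ->
  (forall i, (0 < i)%N -> (i <= m)%N ->
    rop A (f i) (rop A (h i) x) = rop A (f i) (rop A (h i.-1) x)) ->
  (forall i j, (i.+1 < j)%N -> (j <= m.+1)%N ->
    rop A (f j) (rop A (h i) x) = rop A (h' i) (rop A (f' j.-1) x)) ->
  altop 1 m.+2 f (altop 0 m.+1 h x) = rop A (f m.+1) (rop A (h m) x)
    - rop A (f 0%N) (rop A (h 0%N) x) - altop 0 m h' (altop 1 m.+1 f' x).
Proof.
move=> H1 H2 H3; rewrite !altop_comp !addn0 add0n expr1 !mulrN1z opprK.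
have := altsum_prism (D := fun j i => rop A (f j) (rop A (h i) x))
  (H := fun i j => rop A (h' i) (rop A (f' j) x)) H1 H2 H3.
by move/(canRL (addrK _)) => ->; rewrite opprB opprB addrC.
Qed.

(** The signs make all squares anticommute. The directions $B$ of [d2] and [y2] carry $(-1)^m$ and
    $(-1)^a$ as usual; [a1] and [a2] have one sign more, since [XA] is shifted in the cone of [uA];
    the signs $(-1)^B$ and $(-1)^{B+1}$ of [fA] and [fD] adapt them to both differentials. *)
Definition a1 m B : {additive XA m.+1 B -> XA m B} := altop 1 m.+2 (@rdelA X C D jc jd m B).
Definition a2 m B : {additive XA m B.+1 -> XA m B} := altop m.+1 B.+1 (@reA X C D jc jd m B).
Definition d1 m B : {additive XD m.+1 B -> XD m B} := altop 0 m.+2 (@rdelD X C D jc jd m B).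
Definition d2 m B : {additive XD m B.+1 -> XD m B} := altop m B.+1 (@reD X C D jc jd m B).
Definition y1 a B : {additive XY a.+1 B -> XY a B} := altop 0 a.+1 (@rdelY X C D jc jd a B).
Definition y2 a B : {additive XY a B.+1 -> XY a B} := altop a B.+2 (@reY X C D jc jd a B).
Definition uA m B : {additive XA m B -> XD m B} := altop 0 1 (fun=> @raug X C D jc jd m B).
Definition fA m B : {additive XA m B.+1 -> XY m.+1 B} := altop B 1 (fun=> @rfA X C D jc jd m B).
Definition fD B : {additive XD 0 B.+1 -> XY 0 B} := altop B.+1 1 (fun=> @rfD X C D jc jd B).

Ltac rop_solve := apply: rop_comp_eq; [rix_solve | rlab_solve].

Lemma a11 m B x : a1 m B (a1 m.+1 B x) = 0.
Proof. by apply: altopK => i j ij jk; rop_solve. Qed.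
Lemma a22 m B x : a2 m B (a2 m B.+1 x) = 0.
Proof. by apply: altopK => i j ij jk; rop_solve. Qed.
Lemma a12 m B x : a1 m B (a2 m.+1 B x) = - a2 m B (a1 m B.+1 x).
Proof. apply: altop_anticomm => [|i j ij jk]; [lia | rop_solve]. Qed.
Lemma d11 m B x : d1 m B (d1 m.+1 B x) = 0.
Proof. by apply: altopK => i j ij jk; rop_solve. Qed.
Lemma d22 m B x : d2 m B (d2 m B.+1 x) = 0.
Proof. by apply: altopK => i j ij jk; rop_solve. Qed.
Lemma d12 m B x : d1 m B (d2 m.+1 B x) = - d2 m B (d1 m B.+1 x).
Proof. apply: altop_anticomm => [|i j ij jk]; [lia | rop_solve]. Qed.
Lemma y11 m B x : y1 m B (y1 m.+1 B x) = 0.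
Proof. by apply: altopK => i j ij jk; rop_solve. Qed.
Lemma y22 m B x : y2 m B (y2 m B.+1 x) = 0.
Proof. by apply: altopK => i j ij jk; rop_solve. Qed.
Lemma y12 m B x : y1 m B (y2 m.+1 B x) = - y2 m B (y1 m B.+1 x).
Proof. apply: altop_anticomm => [|i j ij jk]; [lia | rop_solve]. Qed.
Lemma ua1 m B x : uA m B (a1 m B x) = - d1 m B (uA m.+1 B x).
Proof. apply: altop_anticomm => [|i j ij jk]; [lia | rop_solve]. Qed.
Lemma ua2 m B x : uA m B (a2 m B x) = - d2 m B (uA m B.+1 x).
Proof. apply: altop_anticomm => [|i j ij jk]; [lia | rop_solve]. Qed.
Lemma fa1 m B x : fA m B (a1 m B.+1 x) = - y1 m.+1 B (fA m.+1 B x).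
Proof. apply: altop_anticomm => [|i j ij jk]; [lia | rop_solve]. Qed.
Lemma fa2 m B x : fA m B (a2 m B.+1 x) = - y2 m.+1 B (fA m B.+1 x).
Proof. apply: altop_anticomm => [|i j ij jk]; [lia | rop_solve]. Qed.
Lemma fu B x : fD B (uA 0 B.+1 x) = - y1 0 B (fA 0 B x).
Proof. apply: altop_anticomm => [|i j ij jk]; [lia | rop_solve]. Qed.
Lemma fd2 B x : fD B (d2 0 B.+1 x) = - y2 0 B (fD B.+1 x).
Proof. apply: altop_anticomm => [|i j ij jk]; [lia | rop_solve]. Qed.
(** Once the remaining $d$ is forgotten, the two faces of $d_0\to d_1$ give the same chain. *)
Lemma fd1 B x : fD B (d1 0 B.+1 x) = 0.
Proof. by apply: altop_pair; rop_solve. Qed.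

Definition sA m B : {additive XA m B -> XA m B.+1} := altop m.+1 1 (fun=> @rsA X C D jc jd m B).
Definition sD m B : {additive XD m B -> XD m B.+1} := altop m 1 (fun=> @rsD X C D jc jd m B).
Definition tD m B : {additive XD m B.+1 -> XD m.+1 B.+1} :=
  altop m.+1 1 (fun=> @rtD X C D jc jd m B).
Definition gD B : {additive XY 0 B -> XD 0 B.+1} := altop B.+1 1 (fun=> @rgD X C D jc jd B).
Definition gA m B : {additive XY m.+1 B -> XA m B.+1} := altop B 1 (fun=> @rgA X C D jc jd m B).
Definition prism m B : {additive XA m B.+1 -> XA m.+1 B.+1} :=
  altop 0 m.+1 (@rprism X C D jc jd m B).

Lemma sA0 m x : a2 m 0 (sA m 0 x) = x.
Proof. apply: altop_retract; [lia | apply: rop_comp_id; [rix_solve | rlab_solve]]. Qed.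
Lemma sD0 m x : d2 m 0 (sD m 0 x) = x.
Proof. apply: altop_retract; [lia | apply: rop_comp_id; [rix_solve | rlab_solve]]. Qed.
Lemma sAS m B x : a2 m B.+1 (sA m B.+1 x) = x - sA m B (a2 m B x).
Proof.
apply: altop_contract_l => [|||j jB]; [lia | lia | | rop_solve].
by apply: rop_comp_id; [rix_solve | rlab_solve].
Qed.
Lemma sDS m B x : d2 m B.+1 (sD m B.+1 x) = x - sD m B (d2 m B x).
Proof.
apply: altop_contract_l => [|||j jB]; [lia | lia | | rop_solve].
by apply: rop_comp_id; [rix_solve | rlab_solve].
Qed.
Lemma us m B x : uA m B.+1 (sA m B x) = - sD m B (uA m B x).
Proof. apply: altop_anticomm => [|i j ij jk]; [lia | rop_solve]. Qed.

Lemma toX_shY a q o : shY jc jd a q o -> toX jc jd o = o.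
Proof. by rewrite /shY; case: ifP => _ -[e _]. Qed.

Lemma tD0 B x : d1 0 B.+1 (tD 0 B x) = x - gD B (fD B x).
Proof.
apply: altop_contract_r => [|||j jB]; [lia | lia | | rop_solve].
by apply: rop_comp_id; [rix_solve | rlab_solve].
Qed.
Lemma tDS m B x : d1 m.+1 B.+1 (tD m.+1 B x) = x - tD m B (d1 m B.+1 x).
Proof.
apply: altop_contract_r => [|||j jB]; [lia | lia | | rop_solve].
by apply: rop_comp_id; [rix_solve | rlab_solve].
Qed.
Lemma fgD B x : fD B (gD B x) = x.
Proof. apply: altop_retract; [lia | apply: rop_comp_id; [rix_solve | rlab_solve]]. Qed.
Lemma fgA m B x : fA m B (gA m B x) = x.
Proof.
apply: altop_retract; [lia | apply: rop_comp_id; first by rix_solve].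
move=> q o _ /toX_shY eo; unfold_rix; split_inner_ifs; try by []; try (exfalso; lia).
(* Forgetting the chosen lift restores the label, which in the shape [isL] is determined by its
   position. *)
by rewrite -{2}eo; apply: toX_pos; exact: pos_toC.
Qed.
Lemma ga1 m B x : a1 m B.+1 (gA m.+1 B x) = - gA m B (y1 m.+1 B x).
Proof. apply: altop_anticomm => [|i j ij jk]; [lia | rop_solve]. Qed.

(** The two ends of the homotopy. Deleting the last pair from the last term undoes the insertion;
    deleting the first pair from the first term leaves chosen lifts only, which is [gA] after
    [fA]. *)
Lemma prism_last m B x : rop A (rdelA jc jd m B.+1 m.+1) (rop A (rprism jc jd m B m) x) = x.
Proof. by apply: rop_comp_id; [rix_solve | rlab_solve]. Qed.
Lemma prism_first m B x :
  rop A (rdelA jc jd m B.+1 0) (rop A (rprism jc jd m B 0) x) = gA m B (fA m B x).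
Proof.
rewrite [RHS]altop_comp /altsum !big_ord_recl !big_ord0 !addr0 !mulr1z sign_even ?oddD ?addbb //.
by rop_solve.
Qed.

Lemma prism0 B x : a1 0 B.+1 (prism 0 B x) = x - gA 0 B (fA 0 B x).
Proof.
apply: etrans (altop_prism (m := 0) (f' := rprism jc jd 0 B) (h' := rdelA jc jd 0 B.+1) _ _ _) _;
  try by move=> *; exfalso; lia.
by rewrite prism_last prism_first [altop 0 0 _ _]sign_even // /altsum big_ord0 subr0.
Qed.

Lemma prismS m B x :
  a1 m.+1 B.+1 (prism m.+1 B x) = x - gA m.+1 B (fA m.+1 B x) - prism m B (a1 m B.+1 x).
Proof.
apply: etrans (altop_prism (f' := rdelA jc jd m B.+1) (h' := rprism jc jd m B) _ _ _) _;
  last by rewrite prism_last prism_first.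
- by move=> i j ji im; rop_solve.
- by move=> i i0 im; rop_solve.
- by move=> i j ij jm; rop_solve.
Qed.

Definition wfamily := tfamily XA XD XY.
Definition wd : wfamily -> wfamily := fam_d a1 a2 d1 d2 y1 y2 uA fA fD.

Lemma wdd z : fam_eq (wd (wd z)) (fam0 _ _ _).
Proof.
exact: (fam_dd a11 a22 a12 d11 d22 d12 y11 y22 y12 ua1 ua2 fa1 fa2 fu fd1 fd2).
Qed.

Lemma word_deform_Y i (z : wfamily) : fam_hom i z -> in_Y (wd z) ->
  exists2 z', fam_hom (i + 1) z' & in_Y (fam_sub z (wd z')).
Proof.
exact: (deform_Y a11 a22 a12 d11 d22 d12 y11 y22 y12 ua1 ua2 fa1 fa2 fu fd1 fd2 sA0 sD0 sAS sDS us).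
Qed.

Lemma word_deform_K i (z : wfamily) : fam_hom i z -> in_K (wd z) ->
  exists2 z', fam_hom (i + 1) z' & in_K (fam_sub z (wd z')).
Proof.
exact: (deform_K_homotopy a11 a22 a12 d11 d22 d12 y11 y22 y12 ua1 ua2 fa1 fa2 fu fd1 fd2
  tD0 tDS fgD prism0 prismS fgA ga1).
Qed.
End OperatorIdentities.

Definition sdiff (S : sset) (A : zmodType) n : {additive lin A (S n.+1) -> lin A (S n)} :=
  cxd (tensor_complex (sset_complex S) A) (Posz n.+1) (Posz n).
Arguments sdiff : simpl never.

Lemma sdiffE (S : sset) (A : zmodType) n (x : lin A (S n.+1)) :
  sdiff S A n x = altsum n.+2 (fun i => lin_map A (sact S (coface (inord i))) x).
Proof.
pose F (x : lin A (S n.+1)) : lin A (S n) :=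
  altsum n.+2 (fun i => lin_map A (sact S (coface (inord i))) x).
have F_additive : zmod_morphism F.
  by move=> y z; rewrite /F -altsumB; apply: eq_altsum => i _; rewrite raddfB.
pose F' : {additive lin A (S n.+1) -> lin A (S n)} :=
  HB.pack F (GRing.isZmodMorphism.Build _ _ F F_additive).
apply: (@lin_ext A (S n.+1) _ (sdiff S A n) F').
move=> w a; transitivity (tensr a (bdry (<< (w : {classic S n.+1}) >> : chains S n.+1))).
  apply: etrans (tensor_mapE _ _ _) _; congr (tens _ a).
  exact: (@transport_id _ (nat_cx (chains S)) (Posz n)).
rewrite /bdry raddf_sum.
apply: eq_bigr => i _; rewrite -[(-1) ^+ i in LHS]intz scaler_int raddfMz inord_val; congr (_ *~ _).
by rewrite faceU lin_mapE.
Qed.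

(** * The filtration by the last vertex *)

Section Filtration.
Variables (X : category) (A : zmodType).
Notation M := (tensor_complex (sset_complex (nerve X)) A).

Definition lastv (n : nat) (u : nerve X n) : X := u ord_max.

(** Annihilates the chains ending in [G] and fixes the others, so its kernel is the span of the
    chains ending in [G]. The filtration thus comes with an explicit projection onto a
    complement. *)
Definition kill (G : X -> Prop) (n : nat) : {additive lin A (nerve X n) -> lin A (nerve X n)} :=
  lin_pmap A (fun u : nerve X n => if `[< G (lastv u) >] then None else Some u).

Arguments kill : simpl never.

Lemma killE G n u a :
  kill G n (gen u a) = if `[< G (lastv u) >] then 0 else gen u a.
Proof. by rewrite /kill lin_pmapE; case: ifP. Qed.

Definition killi (G : X -> Prop) (i : int) : {additive M i -> M i} :=
  match i with Posz n => kill G n | Negz _ => \0 end.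

Definition filt (G : X -> Prop) (i : int) : zmodClosed (M i) := kernel (killi G i).

Lemma filt_posP G n (x : lin A (nerve X n)) : (x :
  M (Posz n)) \in filt G (Posz n) <-> kill G n x = 0.
Proof.
by split=> [xG|xG]; [apply/eqP; rewrite -(kernelE (killi G (Posz n)) x)
  | rewrite (kernelE (killi G (Posz n)) x); apply/eqP].
Qed.

Lemma filt_neg G n (x : M (Negz n)) : x \in filt G (Negz n).
Proof. by rewrite (kernelE (killi G (Negz n)) x). Qed.

Lemma neg_trivial n (x : M (Negz n)) : x = 0.
Proof.
apply: (@tensor_ext _ _ _ idfun \0) => m a.
by rewrite /= -[m]/(m : 'I_1) [m]ord1 tens0.
Qed.

Lemma kill_comp (G G' : X -> Prop) n x :
  (forall v, G v -> G' v) -> kill G' n (kill G n x) = kill G' n x.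
Proof.
move=> GG'; move: x; apply: (lin_ext (g := kill G' n \o kill G n)) => u a.
rewrite [LHS](congr1 (kill G' n) (killE _ _ _)) killE; case: asboolP => Gu.
  by rewrite raddf0 asboolT //; exact: GG'.
by rewrite killE.
Qed.

Lemma filt_sub (G G' : X -> Prop) i x :
  (forall v, G v -> G' v) -> x \in filt G i -> x \in filt G' i.
Proof.
move=> GG'; case: i x => n x; last by move=> _; exact: filt_neg.
by move/filt_posP => Gx; apply/filt_posP; rewrite -(kill_comp x GG') Gx raddf0.
Qed.

Lemma filt_empty (G : X -> Prop) i x : (forall v, ~ G v) -> x \in filt G i -> x = 0.
Proof.
move=> G0; case: i x => n x; last by rewrite (neg_trivial x).
move/filt_posP => <-; apply/esym; move: x; apply: (lin_ext (h := idfun)) => u a.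
by rewrite killE asboolF.
Qed.

Lemma filt_exhaust (G : nat -> X -> Prop) i x :
  (forall n v, G n v -> G n.+1 v) -> (forall v, exists n, G n v) ->
  exists n, x \in filt (G n) i.
Proof.
move=> GS Gall; case: i x => k x; last by exists 0%N; exact: filt_neg.
have Gle m n v : (m <= n)%N -> G m v -> G n v.
  by move=> /subnK <-; elim: (n - m)%N => // d IH /IH; exact: GS.
move: x; apply: lin_ind => [|x y [m xm] [n yn]|u a].
- by exists 0%N; exact: rpred0.
- have mx : x \in filt (G (maxn m n)) (Posz k).
    by apply: filt_sub xm => v; apply: Gle; exact: leq_maxl.
  have my : y \in filt (G (maxn m n)) (Posz k).
    by apply: filt_sub yn => v; apply: Gle; exact: leq_maxr.
  by exists (maxn m n); exact: rpredB mx my.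
have [n Gn] := Gall (lastv u); exists n; apply/filt_posP; rewrite killE asboolT //.
Qed.

Lemma coface_last n (u : nerve X n.+1) i :
  inhabited (hom (lastv (sact (nerve X) (coface i) u)) (lastv u)).
Proof.
constructor; apply: (fmap u (x := fintype.lift i ord_max) (y := ord_max)).
exact: leq_ord.
Qed.

(** The last vertex of a face has an arrow to the last vertex of the chain, so faces of chains
    ending in the sieve end there too. Hence [kill] of the boundary only depends on [kill] of the
    chain. *)
Lemma filt_cxd (G : X -> Prop) i j x :
  (forall v w, hom v w -> G w -> G v) -> x \in filt G i -> cxd M i j x \in filt G j.
Proof.
move=> Gs; have [ij|ij] := eqVneq (j + 1) i; last by rewrite cx_deg ?rpred0.
case: j ij => n; last by move=> *; exact: filt_neg.
rewrite -PoszD addn1 => ij; subst i; move/filt_posP => Gx; apply/filt_posP.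
rewrite -[cxd _ _ _ _]/(sdiff (nerve X) A n x).
have e y : kill G n (sdiff (nerve X) A n y) = kill G n (sdiff (nerve X) A n (kill G n.+1 y)).
  move: y; apply: (lin_ext (g := kill G n \o sdiff (nerve X) A n)
    (h := kill G n \o (sdiff (nerve X) A n \o kill G n.+1))) => u a.
  rewrite [RHS](congr1 (fun z => kill G n (sdiff (nerve X) A n z)) (killE _ _ _)).
  rewrite -[LHS]/(kill G n (sdiff (nerve X) A n (gen u a))).
  case: asboolP => // Gu; rewrite [in RHS]raddf0 [RHS]raddf0 sdiffE raddf_sum big1 // => k _.
  rewrite lin_mapE raddfMz killE asboolT ?mul0rz //.
  by have [h] := coface_last u (inord k); exact: Gs h Gu.
by rewrite e Gx !raddf0.
Qed.
End Filtration.

Lemma altsum_cat (M : zmodType) k l (F : nat -> M) :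
  altsum (k + l) F = altsum k F + altsum l (fun j => F (k + j)%N) *~ (-1) ^+ k.
Proof.
elim: k F => [|k IH] F; first by rewrite /altsum big_ord0 add0r mulr1z.
by rewrite addSn !altsum_recl IH opprD addrA signS.
Qed.

Lemma altsum0 (M : zmodType) k (F : nat -> M) :
  (forall i, (i < k)%N -> F i = 0) -> altsum k F = 0.
Proof. by move=> F0; rewrite /altsum big1 // => i _; rewrite F0 ?mul0rz. Qed.

Lemma transport_gen (A : zmodType) (W : nat -> Type) n n' (w : W n) a : n = n' ->
  exists2 w' : W n', existT W n w = existT W n' w' &
    transport (fun n => lin A (W n)) n n' (gen w a) = gen w' a.
Proof. by move=> e; subst n'; exists w; rewrite ?transport_id. Qed.

Lemma chain_cmp_eq (X : category) n n' (u : nerve X n) (u' : nerve X n') m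
    (f : Delta m n) (f' : Delta m n') :
  existT (nerve X) n u = existT (nerve X) n' u' -> (forall q, f q = f' q :> nat) ->
  functor_cmp u f = functor_cmp u' f'.
Proof.
move=> e; have en : n = n' := congr1 (@projT1 _ _) e; subst n'.
rewrite -(existT_inj e) => ff; congr functor_cmp; apply: Delta_ext => q.
by apply: val_inj; exact: ff.
Qed.

Lemma chain_vertex_eq (X : category) n n' (u : nerve X n) (u' : nerve X n')
    (q : 'I_n.+1) (q' : 'I_n'.+1) :
  existT (nerve X) n u = existT (nerve X) n' u' -> q = q' :> nat -> u q = u' q'.
Proof.
move=> e; have en : n = n' := congr1 (@projT1 _ _) e; subst n'.
by rewrite -(existT_inj e) => qq; congr fob; apply: val_inj; exact: qq.
Qed.

(** * Coordinates on the graded piece *)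

Section GradedPiece.
Variables (X : category) (C D : Type) (jc : C -> X) (jd : D -> X) (A : zmodType).

Definition inC (x : X) := exists c, jc c = x.
Definition inD (x : X) := exists d, jd d = x.
Definition inCD (x : X) := inC x \/ inD x.
Hypothesis disj : forall x, inC x -> inD x -> False.
Hypothesis sieveC : forall v w, hom v w -> inC w -> inC v.
Hypothesis sieveCD : forall v w, hom v w -> inCD w -> inCD v.

Definition shapeY n (a : nat) (u : nerve X n) :=
  forall q : 'I_n.+1, ((q < a)%N -> inC (u q)) /\ ((a <= q)%N -> inD (u q)).

Lemma wordY_shape a B (w : wordY jc jd a B) : shapeY (n := a + B) a (wchain w).
Proof.
move=> q; rewrite -(wpos w q); have := wshape w q; rewrite /shY.
by case: ltnP => _ [_ wq]; split.
Qed.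

Lemma wordY_inj a B (w w' : wordY jc jd a B) : wchain w = wchain w' -> w = w'.
Proof.
move=> e; apply: word_eq => // q.
have := wshape w q; have := wshape w' q => /toX_shY <- /toX_shY <-.
by apply: toX_pos; rewrite !wpos e.
Qed.

Lemma wordY_ex a B (u : nerve X (a + B)%N) : shapeY a u -> exists w : wordY jc jd a B, wchain w = u.
Proof.
move=> ush; have sh (q : 'I_(a + B).+1) : shY jc jd a q (LabX C D (u q)).
  by rewrite /shY; case: ltnP => qa; split=> //; apply ush.
by exists (@Word _ _ _ jc jd (a + B) (shY jc jd a) u (fun q => LabX C D (u q)) (fun _ => erefl) sh).
Qed.

(** The split [a] is the least index of a vertex in [inD]. Earlier vertices are in [inC] by
    minimality; a later vertex in [inC] would pull vertex [a] into [inC] by the sieve property. *)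
Lemma shapeY_split n (u : nerve X n) : inD (lastv u) -> exists2 a, (a <= n)%N & shapeY a u.
Proof.
move=> uD; pose P k := `[< exists2 q : 'I_n.+1, q = k :> nat & inD (u q) >].
have exP : exists k, P k by exists n; apply/asboolP; exists ord_max.
have [a /asboolP[qa qae ua] amin] := ex_minnP exP.
have uCD (q : 'I_n.+1) : inCD (u q).
  by apply: (sieveCD (fmap u (x := q) (y := ord_max) (leq_ord q))); right.
exists a; first by rewrite -qae leq_ord.
move=> q; split=> qa'.
  have [//|uq] := uCD q; have := amin q; rewrite leqNgt qa' => /(_ _) H; exfalso.
  by suff: false by []; apply: H; apply/asboolP; exists q.
have [uq|//] := uCD q; case: (disj _ ua).
by apply: (sieveC (fmap u (x := qa) (y := q) _) uq); rewrite /= qae.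
Qed.

Definition chainY (a B : nat) (u : nerve X (a + B)%N) : option (wordY jc jd a B) :=
  if pselect (exists w : wordY jc jd a B,
    wchain w = u) is left e then Some (sval (cid e)) else None.

Lemma chainY_wchain a B (w : wordY jc jd a B) : chainY (wchain w) = Some w.
Proof.
rewrite /chainY; case: pselect => [e|[]]; last by exists w.
by congr Some; apply: wordY_inj; case: cid.
Qed.

Lemma chainY_none a B (u : nerve X (a + B)%N) : ~ shapeY a u -> chainY u = None.
Proof.
move=> nu; rewrite /chainY; case: pselect => // -[w eu]; case: nu; rewrite -eu.
exact: wordY_shape.
Qed.

Definition chY (a B : nat) : {additive lin A (nerve X (a + B)%N) -> lin A (wordY jc jd a B)} :=
  lin_pmap A (@chainY a B).
Arguments chY : simpl never.

Lemma chY_wchain a B (w : wordY jc jd a B) (c : A) : chY a B (gen (wchain w :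
  nerve X _) c) = gen w c.
Proof. by rewrite /chY lin_pmapE chainY_wchain. Qed.

Lemma chY_none a B (u : nerve X (a + B)%N) (c : A) : ~ shapeY a u -> chY a B (gen u c) = 0.
Proof. by move=> nu; rewrite /chY lin_pmapE chainY_none. Qed.

Notation N := (fun n => lin A (nerve X n)).

Lemma shapeY_last n a (u : nerve X n) : (a <= n)%N -> shapeY a u -> ~ inC (lastv u).
Proof. by move=> an /(_ ord_max) [_ /(_ an) uD] uC; exact: disj uC uD. Qed.

Lemma shapeY_uniq n a a' (u : nerve X n) : (a < a')%N -> (a <= n)%N -> shapeY a u -> ~ shapeY a' u.
Proof.
move=> aa' an ua ua'; have [_ /(_ (leqnn a)) uD] := ua (Ordinal (an : (a < n.+1)%N)).
by have [/(_ aa') uC _] := ua' (Ordinal (an : (a < n.+1)%N)); exact: disj uC uD.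
Qed.

Lemma rop_gen n sh n' sh' (f : reindexing jc jd n sh n' sh') w (c : A) :
  rop A f (gen w c) = gen (ract f w) c.
Proof. exact: lin_mapE. Qed.

Lemma altop_gen n sh n' sh' s k (f : nat -> reindexing jc jd n sh n' sh') w (c : A) :
  altop s k f (gen w c) = altsum k (fun i => gen (ract (f i) w) c) *~ (-1) ^+ s.
Proof. by rewrite /altop; congr (_ *~ _); apply: eq_altsum => i _; exact: rop_gen. Qed.

Lemma y1_gen a B (w : wordY jc jd a.+1 B) (c : A) :
  y1 jc jd A a B (gen w c) = altsum a.+1 (fun i => gen (ract (rdelY jc jd a B i) w) c).
Proof. by apply: etrans (altop_gen _ _ _ _ _) _; rewrite mulr1z. Qed.

Lemma y2_gen a B (w : wordY jc jd a B.+1) (c : A) : y2 jc jd A a B (gen w c) =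
  altsum B.+2 (fun j => gen (ract (reY jc jd a B j) w) c) *~ (-1) ^+ a.
Proof. exact: altop_gen. Qed.

(** A face has $a$ vertices in [inC] and the others in [inD] only if it comes from a chain with
    $a+1$ or $a$ such vertices. The two possibilities give [y1] and [y2]. *)
Lemma chY_sdiff_gen a B (u : nerve X (a + B).+1%N) (c : A) : inCD (lastv u) ->
  chY a B (sdiff (nerve X) A (a + B)%N (gen u c)) =
  y1 jc jd A a B (chY a.+1 B (gen u c)) +
  y2 jc jd A a B (chY a B.+1 (transport N (a + B).+1%N (a + B.+1)%N (gen u c))).
Proof.
move=> uCD; have [u' eu ->] := @transport_gen A (nerve X) _ (a + B.+1) u c (esym (addnS a B)).
rewrite sdiffE raddf_sum.
transitivity (altsum (a +
  B).+2 (fun i => chY a B (gen (sact (nerve X) (coface (inord i)) u : nerve X (a + B)%N) c))).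
  by apply: eq_bigr => i _; rewrite raddfMz lin_mapE.
have sh' : shapeY a u' <-> shapeY a u.
  split=> ush q.
    have qn : (q < (a + B.+1).+1)%N by have := ltn_ord q; lia.
    by rewrite (chain_vertex_eq (q' := Ordinal qn) eu) //; exact: ush (Ordinal qn).
  have qn : (q < (a + B).+2)%N by have := ltn_ord q; lia.
  by rewrite -(chain_vertex_eq (q := Ordinal qn) eu) //; exact: ush (Ordinal qn).
have face_q i (q : 'I_(a + B).+1) (q' : 'I_(a + B).+2) : q' = bump i q :> nat -> (i < (a +
  B).+2)%N ->
    (sact (nerve X) (coface (inord i)) u : nerve X (a + B)%N) q = u q'.
  by move=> eq ii; rewrite /=; congr fob; apply: val_inj; rewrite /= inordK.
(* A chain ending in [inC] has only faces ending in [inC], so every term vanishes. *)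
have [uC|uD] := pselect (inC (lastv u)).
  rewrite altsum0 => [|i ii]; last first.
    apply: chY_none => /(_ ord_max) [_ /(_ (leq_addr _ _))] uD.
    have [h] := coface_last u (inord i); apply: disj uD; exact: sieveC h uC.
  have n1 : ~ shapeY a.+1 u by move=> /shapeY_last H; apply: H uC; lia.
  have n2 : ~ shapeY a u' by move=> ush; have /shapeY_last H := sh'.1 ush; apply: H uC; lia.
  by rewrite [chY a.+1 B _]chY_none // [chY a B.+1 _]chY_none // !raddf0 addr0.
have {uD uCD} uD : inD (lastv u) by case: uCD.
have [a' a'n ush] := shapeY_split uD.
(* Starting from $a+1$ vertices in [inC], exactly the first $a+1$ faces have shape $a$. *)
have [ea|na1] := eqVneq a' a.+1.
  subst a'; have [w ew] := wordY_ex (a := a.+1) (B := B) ush; subst u.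
  rewrite [chY a.+1 B _]chY_wchain [chY a B.+1 _]chY_none ?raddf0 ?addr0; last first.
    by move=> usha; apply: shapeY_uniq (ltnSn a) _ (sh'.1 usha) ush; lia.
  rewrite y1_gen (_ : (a + B).+2 = a.+1 + B.+1)%N; last by lia.
  rewrite altsum_cat [X in _ + X *~ _]altsum0 ?mul0rz ?addr0; last first.
    move=> j jB; apply: chY_none => fsh.
    have an : (a < (a + B).+1)%N by lia.
    have an' : (a < (a + B).+2)%N by lia.
    have [_ /(_ (leqnn _))] := fsh (Ordinal an).
    rewrite (face_q _ _ (Ordinal an')) /=; [|rewrite /bump; lia|lia].
    by move=> uaD; have [/(_ (ltnSn a)) uaC _] := ush (Ordinal an'); exact: disj uaC uaD.
  apply: eq_altsum => i ia; rewrite -[RHS]chY_wchain; congr (chY _ _ (gen _ _)).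
  apply: chain_cmp_eq => // q; rewrite /= inordK /bump; lia.
(* Starting from $a$ vertices in [inC], exactly the last $B+2$ faces have shape $a$; skipping the
   first $a$ faces produces the sign $(-1)^a$ of [y2]. *)
have [ea|na] := eqVneq a' a.
  subst a'; have [w ew] := wordY_ex (a := a) (B := B.+1) (sh'.2 ush); subst u'.
  rewrite [chY a B.+1 _]chY_wchain [chY a.+1 B _]chY_none ?raddf0 ?add0r; last first.
    by move=> usha; apply: shapeY_uniq (ltnSn a) _ ush usha; lia.
  rewrite y2_gen (_ : (a + B).+2 = a + B.+2)%N; last by lia.
  rewrite altsum_cat altsum0 ?add0r; last first.
    move=> i ia; apply: chY_none => fsh.
    have an : (a.-1 < (a + B).+1)%N by lia.
    have an' : (a < (a + B).+2)%N by lia.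
    have a0 : (a.-1 < a)%N by lia.
    have [/(_ a0)] := fsh (Ordinal an).
    rewrite (face_q _ _ (Ordinal an')) /=; [|rewrite /bump; lia|lia].
    by move=> uaC _; have [_ /(_ (leqnn a)) uaD] := ush (Ordinal an'); exact: disj uaC uaD.
  congr (_ *~ _); apply: eq_altsum => j jB; rewrite -[RHS]chY_wchain; congr (chY _ _ (gen _ _)).
  apply: chain_cmp_eq => // q; rewrite /= inordK /bump; lia.
(* For any other split no face has shape $a$, because a face lowers the number of vertices in [inC]
   by at most one. *)
have n1 : ~ shapeY a.+1 u.
  move=> usha; have [aa'|aa'|aa'] := ltngtP a' a.+1; last by rewrite aa' eqxx in na1.
    by apply: shapeY_uniq aa' _ ush usha; lia.
  by apply: shapeY_uniq aa' _ usha ush; lia.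
have n2 : ~ shapeY a u'.
  move=> usha'; have usha := sh'.1 usha'; have [aa'|aa'|aa'] := ltngtP a' a;
    last by rewrite aa' eqxx in na.
    by apply: shapeY_uniq aa' _ ush usha; lia.
  by apply: shapeY_uniq aa' _ usha ush; lia.
rewrite [chY a.+1 B _]chY_none // [chY a B.+1 _]chY_none // !raddf0 addr0.
apply: altsum0 => i ii; apply: chY_none => fsh.
have [aa'|aa'] := leqP a' a.
  have an : (a.-1 < (a + B).+1)%N by lia.
  have an' : (bump i a.-1 < (a + B).+2)%N by rewrite /bump; lia.
  have a0 : (a.-1 < a)%N by lia.
  have [/(_ a0)] := fsh (Ordinal an); rewrite (face_q _ _ (Ordinal an')) // => uaC _.
  have [_ uaD] := ush (Ordinal an'); apply: disj uaC (uaD _); rewrite /= /bump; lia.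
have an : (a < (a + B).+1)%N by lia.
have an' : (bump i a < (a + B).+2)%N by rewrite /bump; lia.
have [_ /(_ (leqnn a))] := fsh (Ordinal an); rewrite (face_q _ _ (Ordinal an')) // => uaD.
have [uaC _] := ush (Ordinal an'); apply: disj (uaC _) uaD; rewrite /= /bump; lia.
Qed.
Lemma shapeY_existT n n' a (u : nerve X n) (u' : nerve X n') :
  existT (nerve X) n u = existT (nerve X) n' u' -> shapeY a u -> shapeY a u'.
Proof.
by move=> e; have en : n = n' := congr1 (@projT1 _ _) e; subst n'; rewrite (existT_inj e).
Qed.

Definition PYn (a B n : nat) : {additive N n -> lin A (wordY jc jd a B)} :=
  chY a B \o transport N n (a + B)%N.
Arguments PYn : simpl never.

Lemma PYnE a B n x : PYn a B n x = chY a B (transport N n (a + B)%N x).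
Proof. by []. Qed.

Lemma PYn_neq a B n x : n != (a + B)%N -> PYn a B n x = 0.
Proof. by move=> ne; rewrite PYnE transport_neq ?raddf0. Qed.

Lemma PYn_sdiff a B n x : kill A inCD n.+1 x = 0 ->
  PYn a B n (sdiff (nerve X) A n x) =
  y1 jc jd A a B (PYn a.+1 B n.+1 x) + y2 jc jd A a B (PYn a B.+1 n.+1 x).
Proof.
have [en|ne] := eqVneq n (a + B)%N; last first.
  by rewrite !PYn_neq ?raddf0 ?addr0 //; lia.
subst n; rewrite !PYnE transport_id [transport _ (a + B).+1 (a.+1 + B)%N x]transport_id => xCD.
pose L : {additive N (a + B).+1%N -> lin A (wordY jc jd a B)} :=
  chY a B \o (sdiff (nerve X) A (a + B)%N : {additive _ -> _}).
pose R : {additive N (a + B).+1%N -> lin A (wordY jc jd a B)} :=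
  (y1 jc jd A a B \o chY a.+1 B) \+ (y2 jc jd A a B \o
    (chY a B.+1 \o transport N (a + B).+1%N (a + B.+1)%N)).
(* The operation $y\mapsto y-\mathrm{kill}\,y$ removes the generators ending outside [inCD], so the
   identity can be checked on generators and fixes the given [x]. *)
have LR y : L (y - kill A inCD _ y) = R (y - kill A inCD _ y).
  move: y; apply: (lin_ext (g := L \o (idfun \- kill A inCD _))
    (h := R \o (idfun \- kill A inCD _))) => u c.
  rewrite -[LHS]/(L (gen u c - kill A inCD _ (gen u c))) -[RHS]/(R (gen u c - kill A inCD _ (gen
    u c))).
  rewrite killE; case: asboolP => uCD; last by rewrite subrr !raddf0.
  by rewrite subr0; exact: chY_sdiff_gen.
by have := LR x; rewrite xCD subr0.
Qed.

Definition inY (a B n : nat) : {additive lin A (wordY jc jd a B) -> N n} :=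
  transport N (a + B)%N n \o lin_map A (fun w : wordY jc jd a B => wchain w : nerve X (a + B)%N).
Arguments inY : simpl never.

Lemma inY_gen a B (w : wordY jc jd a B) c : inY a B (a +
  B)%N (gen w c) = gen (wchain w : nerve X _) c.
Proof.
apply: etrans (transport_id (X := N) _) _; exact: lin_mapE.
Qed.

Lemma PYn_inY a B n y : (a + B)%N = n -> PYn a B n (inY a B n y) = y.
Proof.
move=> en; subst n; rewrite PYnE transport_id; move: y.
apply: (lin_ext (g := chY a B \o inY a B (a + B)%N) (h := idfun)) => w c.
exact: etrans (congr1 (chY a B) (inY_gen w c)) (chY_wchain w c).
Qed.

Lemma PYn_inY_neq a B a' B' n y : (a + B)%N = n -> (a' + B')%N = n -> a != a' ->
  PYn a' B' n (inY a B n y) = 0.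
Proof.
move=> en en' aa'; subst n; move: y.
apply: (lin_ext (g := PYn a' B' (a + B)%N \o inY a B (a + B)%N) (h := \0)) => w c.
apply: etrans (congr1 (PYn a' B' _) (inY_gen w c)) _; rewrite PYnE.
have [u' eu ->] := @transport_gen A (nerve X) _ (a' + B')%N (wchain w) c (esym en').
apply: chY_none => /(shapeY_existT (esym eu)) ush; have wsh := wordY_shape w.
have [aa''|aa''|aa''] := ltngtP a a'; last by rewrite aa'' eqxx in aa'.
  by apply: (shapeY_uniq aa'' _ wsh ush); lia.
by apply: (shapeY_uniq aa'' _ ush wsh); lia.
Qed.

Lemma kill_inY a B n y : kill A inCD n (inY a B n y) = 0.
Proof.
have [en|ne] := eqVneq (a + B)%N n; last by rewrite [inY a B n y]transport_neq // raddf0.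
subst n; move: y.
apply: (lin_ext (g := kill A inCD (a + B)%N \o inY a B (a + B)%N) (h := \0)) => w c.
apply: etrans (congr1 (kill A inCD _) (inY_gen w c)) _; rewrite killE asboolT //; right.
by have [_] := wordY_shape w ord_max; apply; exact: leq_addr.
Qed.

Definition sumY (n : nat) (y : forall a B, lin A (wordY jc jd a B)) : N n :=
  \sum_(a < n.+1) inY a (n - a) n (y a (n - a)%N).

Lemma PYn_sumY a B n y : (a + B)%N = n -> PYn a B n (sumY n y) = y a B.
Proof.
move=> en; have an : (a < n.+1)%N by lia.
rewrite /sumY raddf_sum (bigD1 (Ordinal an)) // big1 => [|a' aa']; last first.
  by apply: PYn_inY_neq => //; have := ltn_ord a'; lia.
apply: etrans (addr0 _) _; rewrite -[LHS]/(PYn a B n (inY a (n - a) n (y a (n - a)%N))).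
have -> : (n - a = B)%N by lia.
exact: PYn_inY.
Qed.

Lemma kill_sumY n y : kill A inCD n (sumY n y) = 0.
Proof. by rewrite raddf_sum big1 // => a _; exact: kill_inY. Qed.

Lemma PYn_gen_none a B n (u : nerve X n) c : ~ shapeY a u -> PYn a B n (gen u c) = 0.
Proof.
move=> nu; have [en|ne] := eqVneq n (a + B)%N; last exact: PYn_neq.
rewrite PYnE; have [u' eu ->] := @transport_gen A (nerve X) _ (a + B)%N u c en.
by apply: chY_none => /(shapeY_existT (esym eu)).
Qed.

Lemma inY_PYn_gen a B n (u : nerve X n) c : (a + B)%N = n -> shapeY a u ->
  inY a B n (PYn a B n (gen u c)) = gen u c.
Proof.
move=> en; subst n => ush; have [w <-] := wordY_ex (a := a) (B := B) ush.
by rewrite PYnE transport_id chY_wchain inY_gen.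
Qed.

(** Reassembling all coordinates recovers the part of [x] spanned by chains ending in [inD], and so
    does the right side: what [kill A inC] retains but [kill A inCD] does not. *)
Lemma kill_sumY_PYn n x :
  kill A inC n (sumY n (fun a B => PYn a B n x)) = kill A inC n x - kill A inCD n x.
Proof.
move: x; apply: lin_ind => [|x x' ex ex'|u c].
- by rewrite !raddf0 addr0 /sumY big1 ?raddf0 // => a _; rewrite !raddf0.
- have -> : sumY n (fun a B => PYn a B n (x - x')) =
      sumY n (fun a B => PYn a B n x) - sumY n (fun a B => PYn a B n x').
    by rewrite /sumY -sumrB; apply: eq_bigr => a _; rewrite !raddfB.
  by rewrite (raddfB (kill A inC n)) ex ex' (raddfB (kill A inC n)) (raddfB (kill A inCD n))
    !opprD !opprK addrACA.
rewrite !killE; have [uC|uC] := pselect (inC (lastv u)).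
  rewrite asboolT // asboolT ?subr0; last by left.
  rewrite /sumY big1 ?raddf0 // => a _; rewrite PYn_gen_none ?raddf0 //.
  by move=> /shapeY_last; apply=> //; rewrite -ltnS.
rewrite asboolF //; have [uD|uD] := pselect (inD (lastv u)); last first.
  rewrite asboolF ?subrr; last by case.
  rewrite /sumY big1 ?raddf0 // => a _; rewrite PYn_gen_none ?raddf0 //.
  by move=> /(_ ord_max) [_] H; apply: uD; apply: H; rewrite /= -ltnS.
rewrite asboolT ?subr0; last by right.
have [a an ush] := shapeY_split uD.
have an' : (a < n.+1)%N by [].
rewrite /sumY (bigD1 (Ordinal an')) // big1 => [|a' aa'].
  apply: etrans (congr1 (kill A inC n) (addr0 _)) _.
  rewrite -[X in kill A inC n X]/(inY a (n - a) n (PYn a (n - a) n (gen u c))).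
  by rewrite inY_PYn_gen ?killE ?asboolF //; lia.
rewrite PYn_gen_none ?raddf0 // => ush'.
have [aa''|aa''|aa''] := ltngtP a a'; last by case/eqP: aa'; exact: val_inj.
  by apply: shapeY_uniq aa'' _ ush ush'; lia.
by apply: shapeY_uniq aa'' _ ush' ush; have := ltn_ord a'; lia.
Qed.

Lemma PYn_kernel n x : kill A inCD n x = 0 ->
  (forall a B, (a + B)%N = n -> PYn a B n x = 0) -> kill A inC n x = 0.
Proof.
move=> xCD Px; have := kill_sumY_PYn x; rewrite xCD subr0 => <-.
rewrite /sumY big1 ?raddf0 // => a _; rewrite Px ?raddf0 //.
by have := ltn_ord a; lia.
Qed.

Lemma PYn_kill a B n x : kill A inC n x = 0 -> PYn a B n x = 0.
Proof.
move=> xC; suff e y : PYn a B n (y - kill A inC n y) = 0 by have := e x; rewrite xC subr0.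
move: y; apply: (lin_ext (g := PYn a B n \o (idfun \- kill A inC n)) (h := \0)) => u c.
rewrite -[LHS]/(PYn a B n (gen u c - kill A inC n (gen u c))) killE.
case: asboolP => uC; last by rewrite subrr raddf0.
have [en|ne] := eqVneq n (a + B)%N; last exact: PYn_neq.
rewrite subr0 PYn_gen_none // => /shapeY_last; apply=> //; lia.
Qed.
End GradedPiece.

(** * Equality of arrows and lifting along fully faithful functors *)

Section ArrowEquality.
Variable C : category.

Lemma Arrow_cmp (x y z x' y' z' : C) (g : hom y z) (f : hom x y) (g' : hom y' z') (f' : hom x' y') :
  Arrow g = Arrow g' -> Arrow f = Arrow f' -> Arrow (cmp g f) = Arrow (cmp g' f').
Proof.
move=> eg ef.
have ex : x = x' := congr1 (@src C) ef; have ey : y = y' := congr1 (@tgt C) ef.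
have ez : z = z' := congr1 (@tgt C) eg.
by subst x' y' z'; rewrite (Arrow_inj eg) (Arrow_inj ef).
Qed.

Lemma Arrow_idm (x x' : C) : x = x' -> Arrow (idm x) = Arrow (idm x').
Proof. by move->. Qed.

End ArrowEquality.

Lemma faithful_arrow (C D : category) (G : functor C D) (a b : arrow C) :
  (forall x y (f g : hom x y), fmap G f = fmap G g -> f = g) ->
  src a = src b -> tgt a = tgt b -> amap G a = amap G b -> a = b.
Proof.
move=> Gi; case: a b => [x y f] [x' y' g] /= ex ey; subst x' y' => e.
by congr Arrow; apply: Gi; exact: Arrow_inj e.
Qed.

Lemma full_subcat_arrow (D : category) (P : D -> Prop) (a b : arrow (full_subcat P)) :
  src a = src b -> tgt a = tgt b -> amap (subcat_incl P) a = amap (subcat_incl P) b -> a = b.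
Proof. exact: faithful_arrow. Qed.

(** Fullness lifts each arrow and faithfulness gives the functor laws. The object map is prescribed
    and kept visible in the conclusion, because the lifts stored in the labels must be recovered
    exactly. *)
Lemma functor_lift (K E X : category) (G : functor E X) (o : K -> E) (u : functor K X) :
  (forall x y (g : hom (G x) (G y)), exists f, fmap G f = g) ->
  (forall x y (f g : hom x y), fmap G f = fmap G g -> f = g) ->
  (forall k, G (o k) = u k) ->
  exists (m : forall k l, hom k l -> hom (o k) (o l)) mid mcmp,
    functor_cmp G (@Functor K E o m mid mcmp) = u.
Proof.
move=> Gfull Gfaith Go.
have ex k l (h : hom k l) : exists f : hom (o k) (o l), Arrow (fmap G f) = Arrow (fmap u h).
  have [g ->] := @arrow_hom X (Arrow (fmap u h)) (G (o k)) (G (o l)) (esym (Go k)) (esym (Go l)).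
  by have [f <-] := Gfull _ _ g; exists f.
pose m k l (h : hom k l) := sval (cid (ex k l h)).
have mE k l (h : hom k l) : Arrow (fmap G (m k l h)) = Arrow (fmap u h).
  by rewrite /m; case: cid.
exists m.
have mid k : m k k (idm k) = idm (o k).
  by apply/Gfaith/Arrow_inj; rewrite mE !fmap_id; apply/esym/Arrow_idm.
have mcmp k l n (g : hom l n) (f : hom k l) : m k n (cmp g f) = cmp (m l n g) (m k l f).
  apply/Gfaith/Arrow_inj; rewrite mE !fmap_cmp; apply: Arrow_cmp; exact/esym/mE.
by exists mid, mcmp; apply: functor_ext => k l h; exact: mE.
Qed.

Section CommaEquality.
Variables (C D : category) (T : functor C D) (d : D).

Lemma comma_ob_eq (x y : comma T d) :
  projT1 x = projT1 y -> Arrow (projT2 x) = Arrow (projT2 y) -> x = y.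
Proof. by case: x y => [c g] [c' g'] /= e; subst c' => /Arrow_inj ->. Qed.

Lemma comma_arrow_ext (a b : arrow (comma T d)) : src a = src b -> tgt a = tgt b ->
  Arrow (sval (arr a)) = Arrow (sval (arr b)) -> a = b.
Proof.
case: a b => [x y f] [x' y' g] /= ex ey; subst x' y' => /Arrow_inj e.
by congr Arrow; exact: comma_hom_eq.
Qed.
End CommaEquality.

(** * Diagonal simplices as labelled chains *)

Section Join.
Variable m : nat.

Definition join_le (x y : 'I_m.+1 + 'I_m.+1) : bool :=
  match x, y with
  | inl i, inl j => (i <= j)%N | inr i, inr j => (i <= j)%N
  | inl _, inr _ => true | inr _, inl _ => false
  end.

Lemma join_le_refl x : join_le x x.
Proof. by case: x => i /=. Qed.

Lemma join_le_trans x y z : join_le y z -> join_le x y -> join_le x z.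
Proof.
by case: x y z => i [] j [] k //=; move=> jk ij; exact: leq_trans ij jk.
Qed.

(** The join $[m]*[m]$, isomorphic to $[2m+1]$ by [kappa]. Keeping its two halves apart separates
    the $c$'s from the $d$'s by pattern matching instead of by comparing indices. *)
Definition joincat : category :=
  @Category ('I_m.+1 + 'I_m.+1)%type (fun x y => join_le x y) join_le_refl
    (fun x y z => @join_le_trans x y z)
    (fun _ _ _ => bool_irrelevance _ _) (fun _ _ _ => bool_irrelevance _ _)
    (fun _ _ _ _ _ _ _ => bool_irrelevance _ _).

Lemma joincat_functor_ext (K : category) (f g : functor K joincat) :
  (forall k, f k = g k) -> f = g.
Proof.
move=> fg; apply: functor_ext => k l h; rewrite /amap /=.
move: (fmap f h) (fmap g h); rewrite !fg => p q; congr Arrow; exact: bool_irrelevance.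
Qed.
End Join.

Section JoinPositions.
Variable m : nat.

Definition join_of (q : 'I_(m + m.+1 + 0).+1) : joincat m :=
  if (q < m.+1)%N then inl (inord q) else inr (inord (q - m.+1)).

Lemma join_of_le (q r : 'I_(m + m.+1 + 0).+1) : (q <= r)%N -> join_le (join_of q) (join_of r).
Proof.
move=> qr; have := ltn_ord q; have := ltn_ord r.
by rewrite /join_of; case: (ltnP r m.+1); case: (ltnP q m.+1) => /= ? ? ? ?;
  rewrite ?inordK; lia.
Qed.

Definition kappa : functor (ordcat (m + m.+1 + 0)) (joincat m) :=
  @Functor (ordcat (m + m.+1 + 0)) (joincat m) join_of (fun q r qr => join_of_le qr)
    (fun _ => bool_irrelevance _ _) (fun _ _ _ _ _ => bool_irrelevance _ _).

Definition join_pos (x : 'I_m.+1 + 'I_m.+1) : nat :=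
  match x with inl i => i | inr j => m.+1 + j end.

Lemma join_pos_lt x : (join_pos x < (m + m.+1 + 0).+1)%N.
Proof. by case: x => i /=; have := ltn_ord i; lia. Qed.

Lemma join_pos_le x y : join_le x y -> (join_pos x <= join_pos y)%N.
Proof. by case: x y => i [] j //=; have := ltn_ord i; lia. Qed.

Definition kappa' : functor (joincat m) (ordcat (m + m.+1 + 0)) :=
  @Functor (joincat m) (ordcat (m + m.+1 + 0)) (fun x => Ordinal (join_pos_lt x))
    (fun x y => @join_pos_le x y)
    (fun _ => bool_irrelevance _ _) (fun _ _ _ _ _ => bool_irrelevance _ _).

Lemma kappaK : functor_cmp kappa' kappa = functor_id _.
Proof.
apply: Delta_ext => q; apply: val_inj; rewrite /= /join_of; have := ltn_ord q.
by case: (ltnP q m.+1) => /= ? ?; rewrite inordK; lia.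
Qed.

Lemma kappa'K : functor_cmp kappa kappa' = functor_id _.
Proof.
apply: joincat_functor_ext => -[] i /=; rewrite /join_of /= -?[(m + 0).+1]/(m.+1);
  have := ltn_ord i.
  by move=> ->; rewrite inord_val.
by move=> im; rewrite ifF; [rewrite addKn inord_val | lia].
Qed.
End JoinPositions.

Lemma fmap_irr (n : nat) (C : category) (s : functor (ordcat n) C) i j (f g : @hom (ordcat n) i j) :
  fmap s f = fmap s g.
Proof. by rewrite (ordcat_hom_irr f g). Qed.

Section Theta.
Variables (P R X : category) (T : functor P R) (JP : functor P X) (JR : functor R X).
Hypothesis T_full : forall x y (g : hom (T x) (T y)), exists f, fmap T f = g.
Hypothesis T_faithful : forall x y (f g : hom x y), fmap T f = fmap T g -> f = g.
Hypothesis JR_full : forall x y (g : hom (JR x) (JR y)), exists f, fmap JR f = g.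
Hypothesis JR_faithful : forall x y (f g : hom x y), fmap JR f = fmap JR g -> f = g.
Hypothesis JRT : forall c, JR (T c) = JP c.

Notation E := (complement T).
Definition fibres : catfunctor E := cf_precomp (comma_cf T) (complement_incl T).
Notation F := fibres.
Definition outer_ob (d : E) : X := JR (sval d).
Notation jd := outer_ob.
Notation jc := (fob JP).

Section JoinFunctor.
Variables (m : nat) (s : functor (ordcat m) E).
Variable t : functor (ordcat m) (comma T (sval (s ord0))).

Definition jf_ob (x : joincat m) : R :=
  match x with inl i => T (projT1 (t i)) | inr j => sval (s j) end.

(** The arrow $c_i\to d_j$ is the composite through $d_0$, since the comma objects lie over the
    first vertex of [s]. *)
Definition jf_map (x y : joincat m) : hom x y -> hom (jf_ob x) (jf_ob y) :=
  match x, y return join_le x y -> hom (jf_ob x) (jf_ob y) with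
  | inl i, inl j => fun h => fmap T (sval (@fmap (ordcat m) _ t i j h))
  | inl i, inr j => fun _ =>
      cmp (@fmap (ordcat m) E s ord0 j (leq0n j) : hom (sval (s ord0)) (sval (s j))) (projT2 (t i))
  | inr i, inr j => fun h => @fmap (ordcat m) E s i j h
  | inr _, inl _ => fun h => match notF h with end
  end.

Lemma jf_map_id x : jf_map (idm x) = idm (jf_ob x).
Proof.
case: x => i /=.
  by rewrite (fmap_irr t _ (@idm (ordcat m) i)) fmap_id -[RHS]fmap_id.
by rewrite (fmap_irr s _ (@idm (ordcat m) i)) fmap_id.
Qed.

Lemma jf_map_cmp x y z (g : hom y z) (f : hom x y) : jf_map (cmp g f) = cmp (jf_map g) (jf_map f).
Proof.
case: x y z g f => [] i [] j [] k g f //.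
- by rewrite /jf_map -fmap_cmp; congr (fmap T _);
    rewrite (fmap_irr t _ (@cmp (ordcat m) i j k g f)) fmap_cmp.
- by rewrite /jf_map -cmpA (svalP (@fmap (ordcat m) _ t i j f)).
- rewrite /jf_map cmpA; congr cmp.
  by rewrite (fmap_irr s _ (@cmp (ordcat m) ord0 j k g (leq0n j))) fmap_cmp.
- by rewrite /jf_map (fmap_irr s _ (@cmp (ordcat m) i j k g f)) fmap_cmp.
Qed.

Definition join_functor : functor (joincat m) R := Functor jf_map_id jf_map_cmp.

Definition join_lab (x : joincat m) : label X P E :=
  match x with inl i => LabC X E (projT1 (t i)) | inr j => LabD X P (s j) end.

Lemma join_pos_lab x : pos jc jd (join_lab x) = JR (join_functor x).
Proof. by case: x => i //=; rewrite JRT. Qed.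
End JoinFunctor.

Lemma join_lab_shape m (s : nerve E m) t (q : 'I_(m + m.+1 + 0).+1) :
  shA jc jd m q (@join_lab m s t (kappa m q)).
Proof.
rewrite /shA /= /join_of; have := ltn_ord q.
case: (ltnP q m.+1) => /= ? ?; first by eexists.
by rewrite ifT; [eexists | lia].
Qed.

Definition thetaA m (x : diagonal (bnerve F) m) : wordA jc jd m 0 :=
  let: existT s t := x in
  @Word X P E jc jd (m + m.+1 + 0) (shA jc jd m)
    (functor_cmp JR (functor_cmp (join_functor t) (kappa m)))
    (fun q => join_lab t (kappa m q))
    (fun q => join_pos_lab t (kappa m q)) (@join_lab_shape m s t).

Lemma inord_addn0 m (q : 'I_(m + 0).+1) : (inord q : 'I_m.+1) = q :> nat.
Proof. by rewrite inordK //; have := ltn_ord q; lia. Qed.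

Lemma iota_le m (q r : 'I_(m +
  0).+1) : (q <= r)%N -> ((inord q : 'I_m.+1) <= (inord r : 'I_m.+1))%N.
Proof. by rewrite !inord_addn0. Qed.

(** The identity of $[m]$ up to the fact that [m + 0] is not convertible to [m]. *)
Definition deg_addn0 m : Delta (m + 0) m :=
  @Functor (ordcat (m + 0)) (ordcat m) (fun q : 'I_(m + 0).+1 => inord q : 'I_m.+1)
   (@iota_le m) (fun _ => bool_irrelevance _ _) (fun _ _ _ _ _ => bool_irrelevance _ _).

Definition deg_addn0' m : Delta m (m + 0) :=
  @Functor (ordcat m) (ordcat (m + 0)) (fun q : 'I_m.+1 => widen_ord (n := m.+1) (m := (m + 0).+1)
      (eq_leq (congr1 S (esym (addn0 m)))) q) (fun _ _ qr => qr)
   (fun _ => bool_irrelevance _ _) (fun _ _ _ _ _ => bool_irrelevance _ _).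

Lemma deg_addn0K m : functor_cmp (deg_addn0' m) (deg_addn0 m) = functor_id _.
Proof. by apply: Delta_ext => q; apply: val_inj; exact: inord_addn0. Qed.

Lemma deg_addn0'K m : functor_cmp (deg_addn0 m) (deg_addn0' m) = functor_id _.
Proof. by apply: Delta_ext => q; apply: val_inj; rewrite /= inord_val. Qed.

Lemma thetaD_shape m (s : nerve E m) (q : 'I_(m +
  0).+1) : shD jc jd m q (LabD X P (s (deg_addn0 m q))).
Proof.
by rewrite /shD ifT; [eexists | have := ltn_ord q; lia].
Qed.

Definition thetaD m (s : nerve E m) : wordD jc jd m 0 :=
  @Word X P E jc jd (m + 0) (shD jc jd m)
    (functor_cmp (functor_cmp JR (complement_incl T)) (functor_cmp s (deg_addn0 m)))
    (fun q => LabD X P (s (deg_addn0 m q))) (fun=> erefl) (thetaD_shape s).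
Definition join_coface m (i : 'I_m.+2) (x : joincat m) : joincat m.+1 :=
  match x with inl j => inl (fintype.lift i j) | inr j => inr (fintype.lift i j) end.

Lemma join_coface_le m (i : 'I_m.+2) x y :
  join_le x y -> join_le (join_coface i x) (join_coface i y).
Proof. by case: x y => a [] b //=; rewrite leq_bump2. Qed.

Definition join_delta m (i : 'I_m.+2) : functor (joincat m) (joincat m.+1) :=
  @Functor (joincat m) (joincat m.+1) (join_coface i) (@join_coface_le m i)
    (fun _ => bool_irrelevance _ _) (fun _ _ _ _ _ => bool_irrelevance _ _).

(** When vertex 0 is deleted, the base point moves from $d_0$ to $d_1$. The transition functor in
    the bisimplicial set composes with $d_0\to d_1$, so the arrows $c_i\to d_j$ of the join are
    unchanged. *)
Lemma join_functor_face m (s : nerve E m.+1) (t : nerve (F (vertex0 s)) m.+1) (i : 'I_m.+2) :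
  @join_functor m (sact (nerve E) (coface i) s)
    (functor_cmp (cfmap F (vertex0_arrow (coface i) s)) (sact (nerve _) (coface i) t)) =
  functor_cmp (@join_functor m.+1 s t) (join_delta i).
Proof.
apply: functor_ext => -[] a [] b h //.
- congr Arrow; congr (fmap T _).
  exact: (congr1 (fun z => sval z) (@fmap_irr m.+1 _ t (fintype.lift i a) (fintype.lift i b) _ _)).
- congr Arrow; rewrite /= cmpA; congr cmp.
  apply: etrans (esym (@fmap_cmp (ordcat m.+1) E s ord0 (fintype.lift i ord0) (fintype.lift i b)
    _ _)) _.
  exact: fmap_irr.
- congr Arrow; exact: (@fmap_irr m.+1 E s (fintype.lift i a) (fintype.lift i b)).
Qed.

Lemma kappa_face m (i : 'I_m.+2) :
  functor_cmp (join_delta i) (kappa m) =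
  functor_cmp (kappa m.+1) (rix_delta (rdelA jc jd m 0 i)).
Proof.
apply: joincat_functor_ext => q; have := ltn_ord q; have im := ltn_ord i.
rewrite /= /join_of /=; case: (ltnP q m.+1) => /= qm qn.
  rewrite ifT; last by lia.
  by congr inl; apply: val_inj; rewrite /= /bump !inordK; lia.
have -> : (q < m.+1 + m.+1)%N by lia.
rewrite ifF; last by lia.
by congr inr; apply: val_inj; rewrite /= /bump !inordK; lia.
Qed.

Lemma thetaA_face m (x : diagonal (bnerve F) m.+1) (i : 'I_m.+2) :
  thetaA (sact (diagonal (bnerve F)) (coface i) x) = ract (rdelA jc jd m 0 i) (thetaA x).
Proof.
case: x => s t; apply: word_eq => [|q].
  rewrite /= -functor_cmpA; congr functor_cmp.
  rewrite (join_functor_face t i).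
  by rewrite -functor_cmpA kappa_face functor_cmpA.
rewrite -[LHS]/(join_lab _ (kappa m q)).
have ek := congr1 (fun f : functor (ordcat (m + m.+1 + 0)) (joincat m.+1) => f q) (kappa_face i).
rewrite -[RHS]/(join_lab t (kappa m.+1 (rix_delta (rdelA jc jd m 0 i) q))) -[kappa m.+1 _]ek /=.
by case: (join_of q).
Qed.

Lemma thetaD_face m (s : nerve E m.+1) (i : 'I_m.+2) :
  thetaD (sact (nerve E) (coface i) s) = ract (rdelD jc jd m 0 i) (thetaD s).
Proof.
have e : functor_cmp (coface i) (deg_addn0 m) = functor_cmp (deg_addn0 m.+1) (rix_delta (rdelD jc
  jd m 0 i)).
  apply: Delta_ext => q; apply: val_inj; have qn := ltn_ord q; have im := ltn_ord i.
  by rewrite /= /bump !inordK; lia.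
apply: word_eq => [|q].
  rewrite /= -!functor_cmpA; congr functor_cmp; rewrite -?functor_cmpA.
  by rewrite (functor_cmpA s (coface i) (deg_addn0 m)) -functor_cmpA e !functor_cmpA.
exact: (congr1 (fun f : functor (ordcat (m + 0)) (ordcat m.+1) => LabD X P (s (f q))) e).
Qed.

Lemma thetaA_aug m (x : diagonal (bnerve F) m) :
  ract (raug jc jd m 0) (thetaA x) = thetaD (bnerve_proj F m x).
Proof.
case: x => s t; pose inr_f : functor (ordcat m) (joincat m) :=
  @Functor (ordcat m) (joincat m) inr (fun _ _ h => h)
    (fun _ => bool_irrelevance _ _) (fun _ _ _ _ _ => bool_irrelevance _ _).
have e : functor_cmp (kappa m) (rix_delta (raug jc jd m 0)) = functor_cmp inr_f (deg_addn0 m).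
  apply: joincat_functor_ext => q; have qn := ltn_ord q; rewrite /= /join_of /= ifF; last by lia.
  by rewrite addnK.
have ej : functor_cmp (join_functor t) inr_f = functor_cmp (complement_incl T) s.
  exact: functor_ext.
apply: word_eq => [|q].
  rewrite /= -!functor_cmpA e; congr functor_cmp.
  by rewrite functor_cmpA ej functor_cmpA.
have eq := congr1 (fun f : functor (ordcat (m + 0)) (joincat m) => f q) e.
by apply: etrans (congr1 (join_lab t) eq) _.
Qed.
End Theta.

Lemma functor_faithful_ext (K E X : category) (G : functor E X) (s s' : functor K E) :
  (forall x y (f g : hom x y), fmap G f = fmap G g -> f = g) ->
  (forall k, s k = s' k) -> functor_cmp G s = functor_cmp G s' -> s = s'.
Proof.
move=> Gi ob e; apply: functor_ext => x y f; apply: (faithful_arrow Gi) => //; try exact: ob.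
exact: (congr1 (fun H : functor K X => amap H (Arrow f)) e).
Qed.

Section ThetaBijective.
Variables (P R X : category) (T : functor P R) (JP : functor P X) (JR : functor R X).
Hypothesis T_full : forall x y (g : hom (T x) (T y)), exists f, fmap T f = g.
Hypothesis T_faithful : forall x y (f g : hom x y), fmap T f = fmap T g -> f = g.
Hypothesis JR_full : forall x y (g : hom (JR x) (JR y)), exists f, fmap JR f = g.
Hypothesis JR_faithful : forall x y (f g : hom x y), fmap JR f = fmap JR g -> f = g.
Hypothesis JRT : forall c, JR (T c) = JP c.
Notation E := (complement T).
Notation F := (fibres T).
Notation jc := (fob JP).
Notation jd := (outer_ob JR).
Notation thA := (@thetaA P R X T JP JR JRT _).
Notation thD := (@thetaD P R X T JP JR _).
Notation G := (functor_cmp JR (complement_incl T)).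

Lemma thetaD_inj m : injective (@thetaD P R X T JP JR m).
Proof.
move=> s s' e; apply: (@functor_faithful_ext _ _ _ G) => [x y f g|k|].
- exact: JR_faithful.
- have /= := congr1 (fun w => wlab w (deg_addn0' m k)) e.
  have ek : (inord (deg_addn0' m k) : 'I_m.+1) = k by rewrite /= inord_val.
  by rewrite ek => -[].
have /= := congr1 (fun w => functor_cmp (wchain w) (deg_addn0' m)) e.
by rewrite -!functor_cmpA !deg_addn0'K !functor_cmp_idr !functor_cmpA.
Qed.

Lemma thetaD_surj m (w : wordD jc jd m 0) : exists s, thD s = w.
Proof.
have exd (k : 'I_m.+1) : exists d, wlab w (deg_addn0' m k) = LabD X P d.
  by have := wshape w (deg_addn0' m k); rewrite /shD ifT //; exact: (ltn_ord k).
pose o k := sval (cid (exd k)).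
have oE k : wlab w (deg_addn0' m k) = LabD X P (o k) by rewrite /o; case: cid.
have [||k|mm [mid [mcmp e]]] :=
  @functor_lift (ordcat m) E X G o (functor_cmp (wchain w) (deg_addn0' m)).
- by move=> x y g; exact: (JR_full g).
- by move=> x y f g; exact: JR_faithful.
- by rewrite /= -(wpos w (deg_addn0' m k)) oE.
exists (Functor mid mcmp); apply: word_eq => [|q] /=.
  by rewrite functor_cmpA e -functor_cmpA deg_addn0K functor_cmp_idr.
rewrite -oE; congr (wlab w _).
exact: (congr1 (fun f : functor (ordcat (m + 0)) (ordcat (m + 0)) => f q) (deg_addn0K m)).
Qed.

Lemma thetaA_inj m : injective (@thetaA P R X T JP JR JRT m).
Proof.
move=> [s t] [s' t'] e.
have lab y : join_lab X t y = join_lab X t' y.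
  have /= := congr1 (fun w => wlab w (kappa' m y)) e.
  by rewrite -[join_of _]/(functor_cmp (kappa m) (kappa' m) y) kappa'K.
have jf : join_functor t = join_functor t'.
  apply: (@functor_faithful_ext _ _ _ JR) => [|y|].
  - exact: JR_faithful.
  - by case: y (lab y) => i /= [->].
  have /= := congr1 (fun w => functor_cmp (wchain w) (kappa' m)) e.
  by rewrite -!functor_cmpA !kappa'K !functor_cmp_idr.
have jfa x y (h : @hom (joincat m) x y) :=
  congr1 (fun H : functor (joincat m) R => amap H (Arrow h)) jf.
have es : s = s'.
  apply: functor_ext => x y h; apply: full_subcat_arrow.
  - by have [] := lab (inr x).
  - by have [] := lab (inr y).
  exact: (jfa (inr x) (inr y) h).
subst s'; congr existT.
have et i : t i = t' i.
  apply: comma_ob_eq; first by have [] := lab (inl i).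
  have := jfa (inl i) (inr ord0) isT; rewrite /amap /=.
  by rewrite (fmap_irr s _ (@idm (ordcat m) ord0)) fmap_id !cmp_idl.
apply: functor_ext => x y h; apply: comma_arrow_ext; try exact: et.
apply: (faithful_arrow T_faithful) => /=; try by rewrite et.
exact: (jfa (inl x) (inl y) h).
Qed.

(** The labels prescribe objects of $R$ for all vertices, and the underlying chain lifts along [JR]
    to a functor on the join. Its right half is [s]; its left half lifts further along [T], and the
    arrows to $d_0$ turn it into a chain in the comma category. *)
Lemma thetaA_surj m (w : wordA jc jd m 0) : exists x, thA x = w.
Proof.
have exc (i : 'I_m.+1) : exists c, wlab w (kappa' m (inl i)) = LabC X E c.
  by have := wshape w (kappa' m (inl i)); rewrite /shA ifT //; exact: (ltn_ord i).
have exd (i : 'I_m.+1) : exists d, wlab w (kappa' m (inr i)) = LabD X P d.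
  have := wshape w (kappa' m (inr i)); have := ltn_ord i; rewrite /shA /= => im.
  by rewrite ifF ?ifT //; lia.
pose c i := sval (cid (exc i)); pose d i := sval (cid (exd i)).
have cE i : wlab w (kappa' m (inl i)) = LabC X E (c i) by rewrite /c; case: cid.
have dE i : wlab w (kappa' m (inr i)) = LabD X P (d i) by rewrite /d; case: cid.
pose o (x : joincat m) : R := match x with inl i => T (c i) | inr j => sval (d j) end.
have [|||mm [mid [mcmp ev]]] :=
  @functor_lift (joincat m) R X JR o (functor_cmp (wchain w) (kappa' m)).
- exact: JR_full.
- exact: JR_faithful.
- by case=> i; rewrite /= -(wpos w (Ordinal _)) ?JRT; [rewrite cE | rewrite dE].
set v := Functor mid mcmp in ev.
(* Order proofs on the join are equal only propositionally, so the functor laws for the halves need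
   this rewriting. *)
have irr x y (h h' : @hom (joincat m) x y) : mm x y h = mm x y h'.
  by congr mm; exact: bool_irrelevance.
have sid (j : ordcat m) : @mm (inr j) (inr j) (idm j) = @idm E (d j).
  by apply: etrans (mid (inr j)); exact: irr.
have scmp (j k l : ordcat m) (g : hom k l) (f : hom j k) :
    @mm (inr j) (inr l) (cmp g f) = @cmp E (d j) (d k) (d l) (@mm (inr k) (inr l) g) (@mm (inr j)
      (inr k) f).
  by apply: etrans (mcmp (inr j) (inr k) (inr l) g f); exact: irr.
pose s : functor (ordcat m) E := @Functor (ordcat m) E d
  (fun j k h => @mm (inr j) (inr k) h) sid scmp.
have exT i j (h : @hom (ordcat m) i j) : exists f : hom (c i) (c j),
  fmap T f = @mm (inl i) (inl j) h.
  exact: T_full.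
pose tm i j h := sval (cid (exT i j h)).
have tmE i j h : fmap T (tm i j h) = @mm (inl i) (inl j) h by rewrite /tm; case: cid.
pose to (i : ordcat m) : comma T (sval (s ord0)) :=
  existT (fun c => hom (T c) (sval (d ord0))) (c i) (@mm (inl i) (inr ord0) isT).
have tmp i j h : cmp (projT2 (to j)) (fmap T (tm i j h)) = projT2 (to i).
  by rewrite tmE -(mcmp (inl i) (inl j) (inr ord0) isT h); exact: (irr (inl i) (inr ord0)).
pose tf (i j : ordcat m) (h : hom i j) : hom (to i) (to j) := exist _ (tm i j h) (tmp i j h).
have tid i : tf i i (idm i) = idm (to i).
  apply: (@comma_hom_eq _ _ T); apply: T_faithful; rewrite /= tmE fmap_id.
  by apply: etrans (mid (inl i)); exact: irr.
have tcmp i j k (g : hom j k) (f : hom i j) : tf i k (cmp g f) = cmp (tf j k g) (tf i j f).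
  apply: (@comma_hom_eq _ _ T); apply: T_faithful; rewrite /= fmap_cmp !tmE.
  by apply: etrans (mcmp (inl i) (inl j) (inl k) g f); exact: irr.
pose t : functor (ordcat m) (comma T (sval (s ord0))) := Functor tid tcmp.
have jv : join_functor t = v.
  apply: functor_ext => -[] i [] j h //; congr Arrow.
  - exact: tmE.
  - by apply: etrans (esym (mcmp (inl i) (inr ord0) (inr j) (leq0n j) isT)) _; exact: irr.
exists (existT _ s t); apply: word_eq => [|q] /=.
  by rewrite jv functor_cmpA ev -functor_cmpA kappaK functor_cmp_idr.
have <- : kappa' m (kappa m q) = q.
  exact: (congr1 (fun f : functor (ordcat (m + m.+1 + 0)) (ordcat (m + m.+1 +
    0)) => f q) (kappaK m)).
rewrite -[join_of (kappa' m _)]/(functor_cmp (kappa m) (kappa' m) (kappa m q)) kappa'K.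
by rewrite -[functor_id _ _]/(kappa m q); case: (kappa m q) => i; rewrite ?cE ?dE.
Qed.
End ThetaBijective.

(** * Degrees and products after tensoring *)

Section TensorMaps.
Variable A : zmodType.

Lemma tensor_map_comp (L M N : zmodType) (f : {additive L -> M}) (g : {additive M -> N}) x :
  tensor_map A g (tensor_map A f x) = tensor_map A (g \o f) x.
Proof.
move: x; apply: (tensor_ext (g := tensor_map A g \o tensor_map A f)) => m a.
by rewrite tensor_mapE; apply: etrans (congr1 (tensor_map A g) (tensor_mapE _ _ _)) _;
  rewrite tensor_mapE.
Qed.

Lemma eq_tensor_map (M N : zmodType) (f g : {additive M -> N}) x :
  f =1 g -> tensor_map A f x = tensor_map A g x.
Proof. by move=> fg; move: x; apply: tensor_ext => m a; rewrite !tensor_mapE fg. Qed.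

Lemma tensor_map_id (M : zmodType) (f : {additive M -> M}) x : f =1 id -> tensor_map A f x = x.
Proof. by move=> fI; move: x; apply: (tensor_ext (h := idfun)) => m a; rewrite tensor_mapE fI. Qed.

Lemma tensor_map0 (M N : zmodType) (f : {additive M -> N}) x :
  (forall y, f y = 0) -> tensor_map A f x = 0.
Proof. by move=> f0; move: x; apply: (tensor_ext (h := \0)) => m a;
  rewrite tensor_mapE f0 tens0. Qed.

Lemma tensor_mapD (M N : zmodType) (f g h : {additive M -> N}) x :
  (forall y, h y = f y + g y) -> tensor_map A h x = tensor_map A f x + tensor_map A g x.
Proof.
move=> hfg; move: x; apply: (tensor_ext (h := tensor_map A f \+ tensor_map A g)) => m a.
by rewrite tensor_mapE hfg tensDl -!tensor_mapE.
Qed.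

Lemma tensor_mapN (M N : zmodType) (f h : {additive M -> N}) x :
  (forall y, h y = - f y) -> tensor_map A h x = - tensor_map A f x.
Proof.
move=> hf; apply/eqP; rewrite -addr_eq0 -(@tensor_mapD _ _ h f \0) ?tensor_map0 // => y.
by rewrite hf addNr.
Qed.

Lemma deg_trivial (S : sset) n (x : tensor A (sset_complex S (Negz n))) : x = 0.
Proof.
apply: (@tensor_ext _ _ _ idfun \0) => m a.
by rewrite /= -[m]/(m : 'I_1) [m]ord1 tens0.
Qed.

(* Zero unless [i = m]: [transport] along a false equation is the zero map. *)
Definition deg_comp (S : sset) (m : nat) (i : int) :
    {additive tensor A (sset_complex S i) -> lin A (S m)} :=
  tensor_map A (transport (nat_cx (chains S)) i (Posz m)).

Definition deg_incl (S : sset) (m : nat) (i : int) :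
    {additive lin A (S m) -> tensor A (sset_complex S i)} :=
  tensor_map A (transport (nat_cx (chains S)) (Posz m) i).

Lemma deg_compK (S : sset) m i x : i = Posz m -> deg_incl S m i (deg_comp S m i x) = x.
Proof.
move=> ei; subst i; apply: etrans (tensor_map_comp _ _ _) _; apply: tensor_map_id => y.
by rewrite /= !transport_id.
Qed.

Lemma deg_inclK (S : sset) m i x : i = Posz m -> deg_comp S m i (deg_incl S m i x) = x.
Proof.
move=> ei; subst i; apply: etrans (tensor_map_comp _ _ _) _; apply: tensor_map_id => y.
by rewrite /= !transport_id.
Qed.

Lemma deg_comp_neq (S : sset) m i x : i != Posz m -> deg_comp S m i x = 0.
Proof. by move=> ei; apply: tensor_map0 => y; exact: transport_neq. Qed.

Lemma deg_comp_d (S : sset) m i j x : j + 1 = i ->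
  deg_comp S m j (tensor_map A (cxd (sset_complex S) i j) x) = sdiff S A m (deg_comp S m.+1 i x).
Proof.
move=> ij; have [ei|ei] := eqVneq i (Posz m.+1); last first.
  by rewrite !deg_comp_neq ?raddf0 //; lia.
have ej : j = Posz m by lia.
clear ij; subst i j; rewrite [deg_comp S m m _]tensor_map_id => [|y]; last exact: transport_id.
by rewrite [deg_comp S m.+1 _ _]tensor_map_id => [|y] //; exact: transport_id.
Qed.
Lemma deg_comp_chm (S S' : sset) (f : smap S S') m i x :
  deg_comp S' m i (tensor_map A (sset_chain_map f i) x) = lin_map A (f m) (deg_comp S m i x).
Proof.
have [ei|ei] := eqVneq i (Posz m); last by rewrite !deg_comp_neq ?raddf0.
subst i; rewrite /deg_comp [LHS]tensor_map_id => [|y]; last exact: transport_id.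
by rewrite [tensor_map A _ x in RHS]tensor_map_id => [|y]; last exact: transport_id.
Qed.
Lemma deg_comp_inj (S : sset) i x : (forall m, deg_comp S m i x = 0) -> x = 0.
Proof.
case: i x => n x x0; last exact: deg_trivial.
by rewrite -(deg_compK x erefl) x0 raddf0.
Qed.

Lemma deg_comp_surj (S : sset) i (z : forall m, lin A (S m)) :
  (forall m, i != Posz m -> z m = 0) -> exists x, forall m, deg_comp S m i x = z m.
Proof.
case: i => n zn.
  exists (deg_incl S n n (z n)) => m; have [->|mn] := eqVneq m n; first exact: deg_inclK.
  have mn' : Posz n != Posz m by apply: contra_neq mn => -[->].
  by rewrite deg_comp_neq // zn.
by exists 0 => m; rewrite raddf0 zn.
Qed.

Section ProductInjections.
Variables M N : zmodType.

Definition pair_l (y : M) : (M * N)%type := (y, 0).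
Definition pair_r (y : N) : (M * N)%type := (0, y).
Fact pair_l_is_zmod_morphism : zmod_morphism pair_l.
Proof. by move=> x y; congr pair; rewrite /= subrr. Qed.
Fact pair_r_is_zmod_morphism : zmod_morphism pair_r.
Proof. by move=> x y; congr pair; rewrite /= subrr. Qed.
HB.instance Definition _ := GRing.isZmodMorphism.Build _ _ pair_l pair_l_is_zmod_morphism.
HB.instance Definition _ := GRing.isZmodMorphism.Build _ _ pair_r pair_r_is_zmod_morphism.

(** Tensoring commutes with binary products; this separates the two summands of the cone, which is
    formed before tensoring. *)
Lemma tensor_prod x : x = tensor_map A pair_l (tensor_map A (fst : (M * N)%type -> _) x) +
  tensor_map A pair_r (tensor_map A (snd : (M * N)%type -> _) x).
Proof.
rewrite !tensor_map_comp -(@tensor_mapD _ _ _ _ (idfun : (M * N)%type -> _)); last first.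
  by case=> a b; rewrite /= /pair_l /pair_r; congr pair; rewrite /= ?addr0 ?add0r.
by rewrite tensor_map_id.
Qed.

Lemma tensor_prod_fst y z : tensor_map A (fst : (M * N)%type -> _)
  (tensor_map A pair_l y + tensor_map A pair_r z) = y.
Proof.
rewrite raddfD !tensor_map_comp [X in _ + X]tensor_map0 // addr0.
exact: tensor_map_id.
Qed.

Lemma tensor_prod_snd y z : tensor_map A (snd : (M * N)%type -> _)
  (tensor_map A pair_l y + tensor_map A pair_r z) = z.
Proof.
rewrite raddfD !tensor_map_comp [X in X + _]tensor_map0 // add0r.
exact: tensor_map_id.
Qed.
End ProductInjections.
End TensorMaps.

(** * The reduced complex expressed by words *)

Section CompareCone.
Variables (P R X : category) (T : functor P R) (JP : functor P X) (JR : functor R X).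
Hypothesis T_full : forall x y (g : hom (T x) (T y)), exists f, fmap T f = g.
Hypothesis T_faithful : forall x y (f g : hom x y), fmap T f = fmap T g -> f = g.
Hypothesis JR_full : forall x y (g : hom (JR x) (JR y)), exists f, fmap JR f = g.
Hypothesis JR_faithful : forall x y (f g : hom x y), fmap JR f = fmap JR g -> f = g.
Hypothesis JRT : forall c, JR (T c) = JP c.
Variable A : zmodType.
Notation E := (complement T).
Notation F := (fibres T).
Notation jc := (fob JP).
Notation jd := (outer_ob JR).
Notation CE := (sset_complex (nerve E)).
Notation CF := (sset_complex (diagonal (bnerve F))).
Notation K := (reduced_complex F A).
Notation fam := (wfamily jc jd A).
Notation wd := (@wd X P E jc jd A).

Definition liftA m : {additive lin A (diagonal (bnerve F) m) -> lin A (wordA jc jd m 0)} :=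
  lin_map A (@thetaA P R X T JP JR JRT m).
Definition liftD m : {additive lin A (nerve E m) -> lin A (wordD jc jd m 0)} :=
  lin_map A (@thetaD P R X T JP JR m).

Lemma lin_map_bij (W W' : Type) (f : W -> W') : injective f -> (forall w', exists w, f w = w') ->
  exists g, (forall x, lin_map A g (lin_map A f x) = x) /\ (forall y,
    lin_map A f (lin_map A g y) = y).
Proof.
move=> fi fs; have [g gE] := choice fs; exists g.
split=> x; rewrite lin_map_comp; apply: lin_map_id => w /=; last exact: gE.
by apply: fi; rewrite gE.
Qed.

Lemma liftA_inj m x : liftA m x = 0 -> x = 0.
Proof.
have [g [gK _]] := lin_map_bij (@thetaA_inj P R X T JP JR T_faithful JR_faithful JRT m)
  (@thetaA_surj P R X T JP JR T_full T_faithful JR_full JR_faithful JRT m).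
by move=> x0; rewrite -[x]gK -[lin_map A _ x]/(liftA m x) x0 raddf0.
Qed.
Lemma liftA_surj m y : exists x, liftA m x = y.
Proof.
have [g [_ gK]] := lin_map_bij (@thetaA_inj P R X T JP JR T_faithful JR_faithful JRT m)
  (@thetaA_surj P R X T JP JR T_full T_faithful JR_full JR_faithful JRT m).
by exists (lin_map A g y); exact: gK.
Qed.
Lemma liftD_inj m x : liftD m x = 0 -> x = 0.
Proof.
have [g [gK _]] := lin_map_bij (@thetaD_inj P R X T JP JR JR_faithful m)
  (@thetaD_surj P R X T JP JR JR_full JR_faithful m).
by move=> x0; rewrite -[x]gK -[lin_map A _ x]/(liftD m x) x0 raddf0.
Qed.
Lemma liftD_surj m y : exists x, liftD m x = y.
Proof.
have [g [_ gK]] := lin_map_bij (@thetaD_inj P R X T JP JR JR_faithful m)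
  (@thetaD_surj P R X T JP JR JR_full JR_faithful m).
by exists (lin_map A g y); exact: gK.
Qed.

(** The sign is the one built into [a1]. *)
Lemma liftA_d m x : liftA m (sdiff _ A m x) = - a1 jc jd A m 0 (liftA m.+1 x).
Proof.
rewrite sdiffE raddf_sum [a1 _ _ _ _ _ _]/(altop _ _ _ _) /altop expr1 mulrN1z opprK.
apply: eq_bigr => i _; rewrite raddfMz; congr (_ *~ _).
rewrite /liftA /rop !lin_map_comp; apply: eq_lin_map => w.
by apply: etrans (thetaA_face JRT w (inord i)) _; rewrite inord_val.
Qed.

Lemma liftD_d m x : liftD m (sdiff _ A m x) = d1 jc jd A m 0 (liftD m.+1 x).
Proof.
rewrite sdiffE raddf_sum [d1 _ _ _ _ _ _]/(altop _ _ _ _) /altop expr0 mulr1z.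
apply: eq_bigr => i _; rewrite raddfMz; congr (_ *~ _).
rewrite /liftD /rop !lin_map_comp; apply: eq_lin_map => w.
by apply: etrans (thetaD_face JP JR w (inord i)) _; rewrite inord_val.
Qed.

Lemma liftA_aug m x : uA jc jd A m 0 (liftA m x) = liftD m (lin_map A (bnerve_proj F m) x).
Proof.
apply: etrans (altop1 _ _ _) _; rewrite expr0 mulr1z.
rewrite /liftA /liftD /rop !lin_map_comp; apply: eq_lin_map => w /=.
exact: thetaA_aug.
Qed.

(** In degree $k$ the shifted cone is $C_k(\mathcal E,\mathbf F)\oplus C_{k+1}(\mathcal E)$; hence
    this coordinate lives at $m=k$ and [kapD] at $m=k+1$. The expression [k + 1 - 1] is what
    unfolding shift and cone produces. *)
Definition kapA m k : {additive K k -> lin A (wordA jc jd m 0)} :=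
  liftA m \o (deg_comp A (diagonal (bnerve F)) m (k + 1 - 1) \o
    tensor_map A (fst : (CF (k + 1 - 1)%R * CE (k + 1)%R)%type -> _)).
Definition kapD m k : {additive K k -> lin A (wordD jc jd m 0)} :=
  liftD m \o (deg_comp A (nerve E) m (k + 1) \o
    tensor_map A (snd : (CF (k + 1 - 1)%R * CE (k + 1)%R)%type -> _)).

Lemma kapA_neq m k x : k != Posz m -> kapA m k x = 0.
Proof.
move=> km; rewrite /kapA -[LHS]/(liftA m (deg_comp A _ m _ (tensor_map A _ x))).
by rewrite deg_comp_neq ?raddf0 // addrK.
Qed.

Lemma kapD_neq m k x : k + 1 != Posz m -> kapD m k x = 0.
Proof.
move=> km; rewrite /kapD -[LHS]/(liftD m (deg_comp A _ m _ (tensor_map A _ x))).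
by rewrite deg_comp_neq ?raddf0.
Qed.

(** The coordinates anticommute with the differentials, here and in [kapD_d], because the shift
    negates the differential of the cone. *)
Lemma kapA_d m k j x : j + 1 = k -> kapA m j (cxd K k j x) = - a1 jc jd A m 0 (kapA m.+1 k x).
Proof.
move=> jk; rewrite -[kapA m.+1 k x]/(liftA m.+1 (deg_comp A _ m.+1 _ (tensor_map A _ x))) -liftA_d.
rewrite -(@deg_comp_d A _ m _ (j + 1 - 1)); last by lia.
rewrite -[LHS]/(liftA m (deg_comp A _ m _ (tensor_map A _ (tensor_map A _ x)))).
congr (liftA m _); congr (deg_comp _ _ _ _ _); rewrite !tensor_map_comp;
  apply: eq_tensor_map => -[y1 y2] /=.
by rewrite opprK.
Qed.

Lemma kapD_d m k j x : j + 1 = k ->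
  kapD m j (cxd K k j x) = - (d1 jc jd A m 0 (kapD m.+1 k x) + uA jc jd A m 0 (kapA m k x)).
Proof.
move=> jk; rewrite -[kapD m.+1 k x]/(liftD m.+1 (deg_comp A _ m.+1 _ (tensor_map A _ x))) -liftD_d.
rewrite -(@deg_comp_d A _ m _ (j + 1)); last by rewrite jk.
rewrite -[kapA m k x]/(liftA m (deg_comp A _ m _ (tensor_map A _ x))) liftA_aug -raddfD -raddfN.
rewrite -[LHS]/(liftD m (deg_comp A _ m _ (tensor_map A _ (tensor_map A _ x)))).
congr (liftD m _).
have ij : k + 1 - 1 = j + 1 by rewrite addrK jk.
rewrite -(deg_comp_chm (bnerve_proj F)).
(* In the cone the augmentation lands in degree $j+1$ by a [transport] from $k+1-1$; as the two
   degrees are equal, it is the identity. *)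
have -> : deg_comp A (nerve E) m (k + 1 - 1)
      (tensor_map A (sset_chain_map (bnerve_proj F) (k + 1 - 1)) (tensor_map A fst x)) =
    deg_comp A (nerve E) m (j + 1) (tensor_map A (transport CE (k + 1 - 1) (j + 1))
      (tensor_map A (aug F (k + 1 - 1)) (tensor_map A fst x))).
  move: (tensor_map A fst x) => y; move: (k + 1 - 1) ij y => i ij; subst i => y.
  by rewrite [tensor_map A (transport _ _ _) _]tensor_map_id => [|z]; last exact: transport_id.
rewrite -raddfD -raddfN; congr (deg_comp _ _ _ _ _); rewrite !tensor_map_comp.
pose h : {additive (CF (k + 1 - 1)%R * CE (k + 1)%R)%type -> CE (j + 1)%R} :=
  snd \o (@cone_d CF CE (aug F) (k + 1) (j + 1) : {additive _ -> _}).
apply: etrans (tensor_mapN (f := h) x _) _; first by case.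
by congr (- _); apply: tensor_mapD => -[y1 y2]; rewrite /h /= /cone_d /=; exact: addrC.
Qed.

Lemma kap_inj k x : (forall m, kapA m k x = 0) -> (forall m, kapD m k x = 0) -> x = 0.
Proof.
move=> xA xD; rewrite [LHS](@tensor_prod A (CF (k + 1 - 1)) (CE (k + 1))).
have -> : tensor_map A (fst : (CF (k + 1 - 1)%R * CE (k + 1)%R)%type -> _) x = 0.
  by apply: deg_comp_inj => m; apply: liftA_inj; exact: xA.
have -> : tensor_map A (snd : (CF (k + 1 - 1)%R * CE (k + 1)%R)%type -> _) x = 0.
  by apply: deg_comp_inj => m; apply: liftD_inj; exact: xD.
by rewrite !raddf0 addr0.
Qed.

Lemma kap_surj k (zA : forall m, lin A (wordA jc jd m 0)) (zD : forall m, lin A (wordD jc jd m 0)) :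
  (forall m, k != Posz m -> zA m = 0) -> (forall m, k + 1 != Posz m -> zD m = 0) ->
  exists x, (forall m, kapA m k x = zA m) /\ (forall m, kapD m k x = zD m).
Proof.
move=> zA0 zD0.
pose yA m := sval (cid (liftA_surj (zA m))); pose yD m := sval (cid (liftD_surj (zD m))).
have yAE m : liftA m (yA m) = zA m by rewrite /yA; case: cid.
have yDE m : liftD m (yD m) = zD m by rewrite /yD; case: cid.
have [|xA xAE] := @deg_comp_surj A _ (k + 1 - 1) yA.
  by move=> m; rewrite addrK => km; apply: liftA_inj; rewrite yAE zA0.
have [|xD xDE] := @deg_comp_surj A _ (k + 1) yD.
  by move=> m km; apply: liftD_inj; rewrite yDE zD0.
exists (tensor_map A (@pair_l _ _) xA + tensor_map A (@pair_r _ _) xD); split=> m.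
  by rewrite -[LHS]/(liftA m (deg_comp A _ m _ (tensor_map A _ _))) tensor_prod_fst xAE.
by rewrite -[LHS]/(liftD m (deg_comp A _ m _ (tensor_map A _ _))) tensor_prod_snd xDE.
Qed.
End CompareCone.

(** * The graded pieces *)

Section GradedIso.
Variables (P R X : category) (T : functor P R) (JP : functor P X) (JR : functor R X).
Hypothesis T_full : forall x y (g : hom (T x) (T y)), exists f, fmap T f = g.
Hypothesis T_faithful : forall x y (f g : hom x y), fmap T f = fmap T g -> f = g.
Hypothesis JR_full : forall x y (g : hom (JR x) (JR y)), exists f, fmap JR f = g.
Hypothesis JR_faithful : forall x y (f g : hom x y), fmap JR f = fmap JR g -> f = g.
Hypothesis JRT : forall c, JR (T c) = JP c.
Variable A : zmodType.
Notation E := (complement T).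
Notation F := (fibres T).
Notation jc := (fob JP).
Notation jdE := (@outer_ob P R X T JR).
Notation inC := (@inC X P jc).
Notation inD := (@inD X E jdE).
Notation inCD := (@inCD X P E jc jdE).
Hypothesis disj : forall x, inC x -> inD x -> False.
Hypothesis sieveC : forall v w, hom v w -> inC w -> inC v.
Hypothesis sieveCD : forall v w, hom v w -> inCD w -> inCD v.
Notation M := (tensor_complex (sset_complex (nerve X)) A).
Notation K := (reduced_complex F A).
Notation fam := (wfamily jc jdE A).
Notation wd := (@wd X P E jc jdE A).
Notation LA := (fun m B => lin A (wordA jc jdE m B)).
Notation LD := (fun m B => lin A (wordD jc jdE m B)).
Notation LY := (fun a B => lin A (wordY jc jdE a B)).
Notation kA := (kapA JRT A).
Notation kD := (kapD T JP JR A).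

Lemma wdD (z w : fam) : fam_eq (wd (fam_add z w)) (fam_add (wd z) (wd w)).
Proof. exact: fam_dD. Qed.

Lemma wdB (z w : fam) : fam_eq (wd (fam_sub z w)) (fam_sub (wd z) (wd w)).
Proof. exact: fam_dB. Qed.

Lemma wd_hom i (z : fam) : fam_hom (i + 1) z -> fam_hom i (wd z).
Proof. exact: fam_hom_d. Qed.

Lemma wd_sub_wd (z z' : fam) : fam_eq (wd (fam_sub z (wd z'))) (wd z).
Proof.
have [eA eD eY] := wdB z (wd z'); have [hA hD hY] := wdd z'.
split=> m B.
- by apply: etrans (eA m B) _;
  apply: etrans (congr1 (fun x => famA (wd z) m B - x) (hA m B)) (subr0 _).
- by apply: etrans (eD m B) _;
  apply: etrans (congr1 (fun x => famD (wd z) m B - x) (hD m B)) (subr0 _).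
- by apply: etrans (eY m B) _;
  apply: etrans (congr1 (fun x => famY (wd z) m B - x) (hY m B)) (subr0 _).
Qed.

Definition PY (a B : nat) (i : int) : {additive M i -> LY a B} :=
  match i with Posz n => PYn jc jdE A a B n | Negz _ => \0 end.

Definition famP i (x : M i) : fam := Family (fun _ _ => 0) (fun _ _ => 0) (fun a B => PY a B i x).

Definition famK k (x : K k) : fam := Family
  (fun m B => match B return LA m B with 0%N => kA m k x | _.+1 => 0 end)
  (fun m B => match B return LD m B with 0%N => kD m k x | _.+1 => 0 end) (fun _ _ => 0).

Lemma PY_neq a B (i : int) (x : M i) : i != (a + B)%N%:Z -> PY a B i x = 0.
Proof.
case: i x => n x ne; last by [].
by apply: PYn_neq; apply: contra_neq ne => ->.
Qed.

Lemma famP_hom i x : fam_hom i (@famP i x).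
Proof. by split=> // a B ne /=; rewrite PY_neq // eq_sym. Qed.

Lemma famK_hom k x : fam_hom (k + 1) (@famK k x).
Proof.
split=> // m [|B] ne //; first by apply: kapA_neq; lia.
by apply: kapD_neq; lia.
Qed.

Lemma PY_d a B i j x : j + 1 = i -> x \in filt A inCD i -> PY a B j (cxd M i j x) =
  y1 jc jdE A a B (PY a.+1 B i x) + y2 jc jdE A a B (PY a B.+1 i x).
Proof.
move=> ji; case: i x ji => [[|n]|n] x ji xF.
- have -> : j = Negz 0 by lia.
  by rewrite (PY_neq (i := Posz 0)) ?(PY_neq (i := Posz 0)) ?raddf0 ?addr0 //; lia.
- have -> : j = Posz n by lia.
  by apply: (PYn_sdiff disj sieveC sieveCD); apply/filt_posP.
by case: j ji => j ji; [lia | rewrite /= !raddf0 addr0].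
Qed.

Lemma PY_kernel i x : x \in filt A inCD i -> (forall a B, PY a B i x = 0) -> x \in filt A inC i.
Proof.
case: i x => n x; last by move=> _ _; exact: filt_neg.
move=> /filt_posP xCD x0; apply/filt_posP.
by apply: (PYn_kernel disj sieveC sieveCD xCD) => a B _; exact: x0.
Qed.

Lemma PY_filt a B i x : x \in filt A inC i -> PY a B i x = 0.
Proof. by case: i x => n x //= /filt_posP; exact: (PYn_kill disj). Qed.

Lemma PY_surj i (y : forall a B, LY a B) : (forall a B, (a + B)%N%:Z != i -> y a B = 0) ->
  exists2 x, x \in filt A inCD i & forall a B, PY a B i x = y a B.
Proof.
case: i => n y0; last by exists 0; [exact: rpred0 | move=> a B; rewrite y0].
exists (sumY n y); first by apply/filt_posP; exact: kill_sumY.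
move=> a B; have [en|ne] := eqVneq (a + B)%N n; first exact: (PYn_sumY disj).
rewrite y0; first by apply: PYn_neq; rewrite eq_sym.
by apply: contra_neq ne => -[].
Qed.

Lemma kap_eq0 k (x : K k) : (forall m, kA m k x = 0) -> (forall m, kD m k x = 0) -> x = 0.
Proof. exact: kap_inj. Qed.

Lemma wd_famK k (kap : K k) j : j + 1 = k ->
  [/\ forall m, famA (wd (famK kap)) m 0 = - kA m j (cxd K k j kap),
      forall m, famD (wd (famK kap)) m 0 = - kD m j (cxd K k j kap),
      forall m B, famA (wd (famK kap)) m B.+1 = 0,
      forall m B, famD (wd (famK kap)) m B.+1 = 0
    & forall a B, famY (wd (famK kap)) a B = 0].
Proof.
move=> jk; split=> [m|m|m B|m B|a B].
- rewrite (kapA_d JRT m kap jk) opprK.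
  by rewrite -[LHS]/(a1 jc jdE A m 0 (kA m.+1 k kap) + a2 jc jdE A m 0 0) raddf0 addr0.
- rewrite (kapD_d JRT m kap jk) opprK.
  by rewrite -[LHS]/(d1 jc jdE A m 0 (kD m.+1 k kap) + uA jc jdE A m 0 (kA m k kap) +
    d2 jc jdE A m 0 0) raddf0 addr0.
- by rewrite -[LHS]/(a1 jc jdE A m B.+1 0 + a2 jc jdE A m B.+1 0) !raddf0 addr0.
- by rewrite -[LHS]/(d1 jc jdE A m B.+1 0 + uA jc jdE A m B.+1 0 +
  d2 jc jdE A m B.+1 0) !raddf0 !addr0.
case: a => [|a].
  by rewrite -[LHS]/(y1 jc jdE A 0 B 0 + y2 jc jdE A 0 B 0 + fD jc jdE A B 0) !raddf0 !addr0.
by rewrite -[LHS]/(y1 jc jdE A a.+1 B 0 + y2 jc jdE A a.+1 B 0 + fA jc jdE A a B 0) !raddf0 !addr0.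
Qed.

Lemma wd_famP i (x : M i) j : j + 1 = i -> x \in filt A inCD i ->
  [/\ forall m B, famA (wd (famP x)) m B = 0, forall m B, famD (wd (famP x)) m B = 0
    & forall a B, famY (wd (famP x)) a B = PY a B j (cxd M i j x)].
Proof.
move=> ji xF; split=> [m B|m B|a B].
- by rewrite -[LHS]/(a1 jc jdE A m B 0 + a2 jc jdE A m B 0) !raddf0 addr0.
- by rewrite -[LHS]/(d1 jc jdE A m B 0 + uA jc jdE A m B 0 + d2 jc jdE A m B 0) !raddf0 !addr0.
rewrite (PY_d a B ji xF); case: a => [|a].
  by rewrite -[LHS]/(y1 jc jdE A 0 B (PY 1 B i x) + y2 jc jdE A 0 B (PY 0 B.+1 i x) +
    fD jc jdE A B 0) [fD _ _ _ _ _]raddf0 addr0.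
by rewrite -[LHS]/(y1 jc jdE A a.+1 B (PY a.+2 B i x) + y2 jc jdE A a.+1 B (PY a.+1 B.+1 i x) +
  fA jc jdE A a B 0) [fA _ _ _ _ _ _]raddf0 addr0.
Qed.

(* The classes of the relative cycle [x] and of the cycle [kap] become homologous
   in the total complex of the word families. *)
Definition related i k (x : M i) (kap : K k) : Prop := exists2 z : fam, fam_hom (i + 1) z &
  fam_eq (wd z) (fam_add (famP x) (famK kap)).

Lemma relatedB i k (x x' : M i) (kap kap' : K k) :
  related x kap -> related x' kap' -> related (x - x') (kap - kap').
Proof.
move=> [z zi [eA eD eY]] [z' zi' [eA' eD' eY']]; exists (fam_sub z z'); first exact: fam_homB.
have [bA bD bY] := wdB z z'.
have add0B (V : zmodType) (a b c : V) : c = a - b -> (0 + a) - (0 + b) = 0 + c.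
  by move=> ->; rewrite !add0r.
have addB0 (V : zmodType) (a b c : V) : c = a - b -> (a + 0) - (b + 0) = c + 0.
  by move=> ->; rewrite !addr0.
split=> m B.
- apply: etrans (bA m B) _; apply: etrans (congr2 (fun u v => u - v) (eA m B) (eA' m B)) _.
  by case: B => [|B]; apply: add0B; [exact: (raddfB (kA m k)) | rewrite subrr].
- apply: etrans (bD m B) _; apply: etrans (congr2 (fun u v => u - v) (eD m B) (eD' m B)) _.
  by case: B => [|B]; apply: add0B; [exact: (raddfB (kD m k)) | rewrite subrr].
- apply: etrans (bY m B) _; apply: etrans (congr2 (fun u v => u - v) (eY m B) (eY' m B)) _.
  by apply: addB0; exact: (raddfB (PY m B i)).
Qed.

Section Iso.
Variables (i k : int).
Hypothesis ki : k + 1 = i.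

(** As $dx$ lies in the lower filtration step, [famP x] is a cycle of the total complex. Deforming
    it into the cone leaves a remainder whose negative is [famK kap]; [kap] is a cycle because
    $ddz=0$. *)
Lemma related_l (x : M i) : x \in filt A inCD i -> cxd M i k x \in filt A inC k ->
  exists2 kap : K k, kap \in kernel (cxd K k (k - 1)) & related x kap.
Proof.
move=> xF dxF; have [pA pD pY] := wd_famP ki xF; have dP : in_K (wd (famP x)).
  by split=> // a B; rewrite pY (PY_filt _ _ dxF).
have [z zi [zA zD zY]] := word_deform_K (famP_hom x) dP.
have [wA wD _] : fam_hom i (wd z) by apply: wd_hom.
have [||kap [kapAE kapDE]] := kap_surj T_full T_faithful JR_full JR_faithful JRT
  (k := k) (zA := fun m => famA (wd z) m 0) (zD := fun m => famD (wd z) m 0).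
- by move=> m km; apply: wA; lia.
- by move=> m km; apply: wD; lia.
have zA' m B : famA (wd z) m B.+1 = 0 by apply/eqP; rewrite -oppr_eq0 -[X in X == _]add0r;
  apply/eqP; exact: zA.
have zD' m B : famD (wd z) m B.+1 = 0 by apply/eqP; rewrite -oppr_eq0 -[X in X == _]add0r;
  apply/eqP; exact: zD.
exists kap.
  have kk : k - 1 + 1 = k by rewrite subrK.
  have [hA hD _] := wdd z.
  rewrite kernelE; apply/eqP; apply: kap_eq0 => m.
    rewrite (kapA_d JRT m kap kk) kapAE.
    have e : a1 jc jdE A m 0 (famA (wd z) m.+1 0%N) +
      a2 jc jdE A m 0 (famA (wd z) m 1%N) = 0 := hA m 0%N.
    by move: e; rewrite zA' raddf0 addr0 => ->; rewrite oppr0.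
  rewrite (kapD_d JRT m kap kk) kapDE kapAE.
  have e : d1 jc jdE A m 0 (famD (wd z) m.+1 0%N) + uA jc jdE A m 0 (famA (wd z) m 0%N) +
    d2 jc jdE A m 0 (famD (wd z) m 1%N) = 0 := hD m 0%N.
  by move: e; rewrite zD' raddf0 addr0 => ->; rewrite oppr0.
exists z; first exact: zi.
split=> [m [|B]|m [|B]|a B].
- exact: etrans (esym (kapAE m)) (esym (add0r _)).
- exact: etrans (zA' m B) (esym (addr0 _)).
- exact: etrans (esym (kapDE m)) (esym (add0r _)).
- exact: etrans (zD' m B) (esym (addr0 _)).
- apply: etrans (esym (addr0 _)); apply/esym/eqP; rewrite -subr_eq0; apply/eqP; exact: zY.
Qed.

(** The opposite deformation: [famK kap] is moved into the words of [Y], and the resulting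
    coordinates are those of some chain [x]. The coordinates of $dx$ vanish, which places $dx$ in
    the lower filtration step. *)
Lemma related_r (kap : K k) : kap \in kernel (cxd K k (k - 1)) ->
  exists2 x : M i, x \in filt A inCD i /\ cxd M i k x \in filt A inC k & related x kap.
Proof.
rewrite kernelE => /eqP dkap.
have kk : k - 1 + 1 = k by rewrite subrK.
have [kA0 kD0 kA1 kD1 kY] := wd_famK kap kk.
have kY' : in_Y (wd (famK kap)).
  split=> m [|B]; [|exact: kA1| |exact: kD1].
    by rewrite kA0 dkap raddf0 oppr0.
  by rewrite kD0 dkap raddf0 oppr0.
have khom : fam_hom i (famK kap) by rewrite -ki; exact: famK_hom.
have [z zi [zA zD]] := word_deform_Y khom kY'.
have {}zA m B : famA (wd z) m B = famA (famK kap) m B.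
  by apply/esym/eqP; rewrite -subr_eq0; apply/eqP; exact: zA.
have {}zD m B : famD (wd z) m B = famD (famK kap) m B.
  by apply/esym/eqP; rewrite -subr_eq0; apply/eqP; exact: zD.
have [_ _ wY] : fam_hom i (wd z) by apply: wd_hom.
have [x xF xY] := PY_surj wY.
have [_ _ ddY] := wdd z.
have dxF : cxd M i k x \in filt A inC k.
  apply: PY_kernel => [|a B]; first exact: filt_cxd xF.
  rewrite (PY_d a B ki xF) !xY.
  case: a => [|a].
    have e : y1 jc jdE A 0 B (famY (wd z) 1 B) + y2 jc jdE A 0 B (famY (wd z) 0%N B.+1) +
      fD jc jdE A B (famD (wd z) 0%N B.+1) = 0 := ddY 0%N B.
    by move: e; rewrite zD [fD _ _ _ _ _]raddf0 addr0.
  have e : y1 jc jdE A a.+1 B (famY (wd z) a.+2 B) + y2 jc jdE A a.+1 B (famY (wd z) a.+1 B.+1) +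
    fA jc jdE A a B (famA (wd z) a B.+1) = 0 := ddY a.+1 B.
  by move: e; rewrite zA [fA _ _ _ _ _ _]raddf0 addr0.
exists x; first by [].
exists z; first exact: zi.
split=> m B.
- exact: etrans (zA m B) (esym (add0r _)).
- exact: etrans (zD m B) (esym (add0r _)).
- exact: etrans (esym (xY m B)) (esym (addr0 _)).
Qed.

Lemma related_boundary_l (x w : M i) (v : M (i + 1)) (kap : K k) : related x kap ->
  w \in filt A inC i -> v \in filt A inCD (i + 1) -> x = w + cxd M (i + 1) i v ->
  kap \in image_grp (cxd K (k + 1) k).
Proof.
move=> [z zi [zA zD zY]] wF vF ex.
have [vA vD vY] := wd_famP erefl vF.
(* Since [w] has no coordinates, [famP x] is the boundary of [famP v]; subtracting it leaves
   [famK kap] as the boundary of [z2], which can then be deformed into the cone. *)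
pose z2 := fam_sub z (famP v); have z2i : fam_hom (i + 1) z2 by apply: fam_homB => //;
  exact: famP_hom.
have [bA bD bY] := wdB z (famP v).
have dA m B : famA (wd z2) m B = famA (famK kap) m B.
  apply: etrans (bA m B) _; apply: etrans (congr2 (fun u v => u - v) (zA m B) (vA m B)) _.
  by rewrite subr0; exact: add0r.
have dD m B : famD (wd z2) m B = famD (famK kap) m B.
  apply: etrans (bD m B) _; apply: etrans (congr2 (fun u v => u - v) (zD m B) (vD m B)) _.
  by rewrite subr0; exact: add0r.
have dK : in_K (wd z2).
  split=> [m B|m B|a B]; [exact: dA | exact: dD |].
  apply: etrans (bY a B) _; apply: etrans (congr2 (fun u v => u - v) (zY a B) (vY a B)) _.
  apply: etrans (congr1 (fun y => y - _) (addr0 _)) _.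
  by rewrite -[famY _ _ _]/(PY a B i x) -raddfB ex addrK; exact: PY_filt.
have [z3 z3i [yA yD yY]] := word_deform_K z2i dK.
pose y := fam_sub z2 (wd z3).
have [eA eD _] := wd_sub_wd z2 z3.
have [hA hD _] : fam_hom (i + 1) y by apply: fam_homB; [exact: z2i | apply: wd_hom; exact: z3i].
have [||k' [k'A k'D]] := kap_surj T_full T_faithful JR_full JR_faithful JRT
  (k := k + 1) (zA := fun m => famA y m 0) (zD := fun m => famD y m 0).
- by move=> m km; apply: hA; lia.
- by move=> m km; apply: hD; lia.
(* The minus sign compensates the anticommutation of [kapA] and [kapD] with the differentials. *)
apply/image_grpP; exists (- k'); apply/esym/eqP; rewrite -subr_eq0; apply/eqP.
apply: kap_eq0 => m; rewrite !raddfN opprK [LHS]raddfD.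
  rewrite (kapA_d JRT m k' erefl) k'A; apply/eqP; rewrite subr_eq0; apply/eqP.
  apply: etrans (esym (dA m 0%N)) _; apply: etrans (esym (eA m 0%N)) _.
  rewrite -[LHS]/(a1 jc jdE A m 0 (famA y m.+1 0%N) + a2 jc jdE A m 0 (famA y m 1%N)).
  by rewrite [X in a2 _ _ _ _ _ X]yA raddf0 addr0.
rewrite (kapD_d JRT m k' erefl) k'A k'D; apply/eqP; rewrite subr_eq0; apply/eqP.
apply: etrans (esym (dD m 0%N)) _; apply: etrans (esym (eD m 0%N)) _.
rewrite -[LHS]/(d1 jc jdE A m 0 (famD y m.+1 0%N) + uA jc jdE A m 0 (famA y m 0%N) +
  d2 jc jdE A m 0 (famD y m 1%N)).
by rewrite [X in d2 _ _ _ _ _ X]yD raddf0 addr0.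
Qed.

Lemma related_boundary_r (x : M i) (kap : K k) : related x kap -> x \in filt A inCD i ->
  kap \in image_grp (cxd K (k + 1) k) ->
  exists2 w, w \in filt A inC i &
    exists2 v, v \in filt A inCD (i + 1) & x = w + cxd M (i + 1) i v.
Proof.
move=> [z zi [zA zD zY]] xF /image_grpP[k' ek].
have [kA0 kD0 kA1 kD1 kY] := wd_famK k' (erefl : k + 1 = k + 1).
have khom : fam_hom (i + 1) (famK k') by rewrite -ki; exact: famK_hom.
(* The boundary of [famK k'] is minus [famK kap], so adding it cancels the cone part of the boundary
   of [z]. *)
pose z2 := fam_add z (famK k'); have z2i : fam_hom (i + 1) z2 by exact: fam_homD.
have [bA bD bY] := wdD z (famK k').
have dY : in_Y (wd z2).
  split=> m B.
    apply: etrans (bA m B) _; apply: etrans (congr1 (fun u => u + _) (zA m B)) _.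
    apply: etrans (congr1 (fun u => u + _) (add0r _)) _; case: B => [|B].
      by rewrite [X in _ + X]kA0 ek; exact: subrr.
    by rewrite [X in _ + X]kA1; exact: addr0.
  apply: etrans (bD m B) _; apply: etrans (congr1 (fun u => u + _) (zD m B)) _.
  apply: etrans (congr1 (fun u => u + _) (add0r _)) _; case: B => [|B].
    by rewrite [X in _ + X]kD0 ek; exact: subrr.
  by rewrite [X in _ + X]kD1; exact: addr0.
have [z3 z3i [yA yD]] := word_deform_Y z2i dY.
pose y := fam_sub z2 (wd z3).
have [_ _ eY] := wd_sub_wd z2 z3.
have [_ _ hY] : fam_hom (i + 1) y by apply: fam_homB; [exact: z2i | apply: wd_hom; exact: z3i].
have [v vF vY] := PY_surj hY.
exists (x - cxd M (i + 1) i v); last by exists v; rewrite ?subrK.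
apply: PY_kernel => [|a B]; first by apply: rpredB; [exact: xF | exact: filt_cxd vF].
apply: etrans (raddfB (PY a B i) _ _) _; apply/eqP; rewrite subr_eq0; apply/eqP.
rewrite (PY_d a B erefl vF) !vY.
have -> : PY a B i x = famY (wd y) a B.
  apply/esym; apply: etrans (eY a B) _; apply: etrans (bY a B) _.
  apply: etrans (congr2 (fun u v => u + v) (zY a B) (kY a B)) _.
  exact: etrans (addr0 _) (addr0 _).
case: a => [|a].
  rewrite -[LHS]/(y1 jc jdE A 0 B (famY y 1 B) + y2 jc jdE A 0 B (famY y 0%N B.+1) +
      fD jc jdE A B (famD y 0%N B.+1)).
  by rewrite [X in fD _ _ _ _ X]yD [fD _ _ _ _ _]raddf0 addr0.
rewrite -[LHS]/(y1 jc jdE A a.+1 B (famY y a.+2 B) + y2 jc jdE A a.+1 B (famY y a.+1 B.+1) +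
    fA jc jdE A a B (famA y a B.+1)).
by rewrite [X in fA _ _ _ _ _ X]yA [fA _ _ _ _ _ _]raddf0 addr0.
Qed.

(** [Z] and [B] stand for the numerator and denominator of $E^1$, with [inC] and [inCD] as
    consecutive filtration steps; the subquotient is the homology of the graded piece. *)
Lemma graded_iso (Z B : zmodClosed (M i)) :
  (forall x, x \in Z <-> x \in filt A inCD i /\ cxd M i k x \in filt A inC k) ->
  (forall x, x \in B <-> exists2 w, w \in filt A inC i &
    exists2 v, v \in filt A inCD (i + 1) & x = w + cxd M (i + 1) i v) ->
  inhabited (zmod_iso (subquot Z B) (homology K k)).
Proof.
move=> ZP BP; constructor.
have [| | | |phi _] := @subquot_rel_iso _ _ Z B (kernel (cxd K k (k - 1)))
  (image_grp (cxd K (k + 1) k)) (@related i k); last exact: phi.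
- by move=> x x' y y'; exact: relatedB.
- by move=> x /ZP[xF dxF]; exact: related_l.
- by move=> kap /related_r[x xZ xk]; exists x => //; exact/ZP.
move=> x kap /ZP[xF _] _ xk; split=> [/BP[w wF [v vF ex]]|kB].
  exact: related_boundary_l xk wF vF ex.
by apply/BP; exact: related_boundary_r xk xF kB.
Qed.
End Iso.
End GradedIso.

(** * The filtration of a colimit *)

Section ColimitFiltration.
Variables (Q : nat -> category) (T : forall n, functor (Q n) (Q n.+1)) (L : category).
Variable J : forall n, functor (Q n) L.
Hypothesis T_cellular : forall n, cellular (T n).
Hypothesis colim : is_naive_colimit T J.
Variable A : zmodType.
Notation M := (tensor_complex (sset_complex (nerve L)) A).

(** Negative levels are empty, which extends the filtration by zero; at level 0 it vanishes because
    [Q 0] has no objects. *)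
Definition level (p : int) : L -> Prop :=
  match p with Posz n => level_le J n | Negz _ => fun _ => False end.

Definition colim_filt (p i : int) : zmodClosed (M i) := filt A (level p) i.

Lemma colim_filt_mono p i (x : M i) : x \in colim_filt p i -> x \in colim_filt (p + 1) i.
Proof.
move=> xF; apply: filt_sub xF => v; case: p => [n|n] //.
rewrite -PoszD addn1; exact: (level_leS colim).
Qed.

Lemma colim_filt_cxd p i j (x : M i) : x \in colim_filt p i -> cxd M i j x \in colim_filt p j.
Proof.
by move=> xF; apply: filt_cxd xF => v w h; case: p => //= n;
  exact: (level_sieve T_cellular colim h).
Qed.

Lemma colim_filt_exhaust i (x : M i) : exists p, x \in colim_filt p i.
Proof.
have [n v||n xn] := filt_exhaust (G := level_le J) x; first exact: (level_leS colim).
  by move=> v; have [n [c cv]] := colim_ob_surj colim v; exists n, c.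
by exists n.
Qed.

Lemma colim_filt_bound : (Q 0%N -> False) ->
  forall p i (x : M i), p <= 0 -> x \in colim_filt p i -> x = 0.
Proof.
move=> Q0 p i x p0 xF; apply: filt_empty xF => v; case: p p0 => [n n0|n _ []].
by have -> : n = 0%N; [lia | case=> c _; exact: Q0 c].
Qed.

Lemma level_succ p : level p.+1 = inCD (J p) (@outer_ob _ _ _ (T p) (J p.+1)).
Proof.
apply: functional_extensionality_dep => x; apply: propositional_extensionality; split.
  move=> [d <-]; have [[c ec]|nd] := pselect (in_image (T p) d).
    by left; exists c; rewrite -ec (colim_ob colim).
  by right; exists (exist _ d nd).
by case=> [[c <-]|[d <-]]; [exists (T p c); exact: colim_ob | exists (sval d)].
Qed.

Lemma colim_graded_iso (p : nat) (i : int) (k : int) : k + 1 = i ->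
  inhabited (zmod_iso (subquot (zcyc colim_filt 1 p.+1 i) (bcyc colim_filt 1 p.+1 i))
    (reduced_homology (cf_precomp (comma_cf (T p)) (complement_incl (T p))) A k)).
Proof.
move=> ki; have [T_ff _] := T_cellular p.
have pE : p.+1%:Z - 1 = p by lia.
have Fp j : colim_filt (p.+1%:Z - 1) j = filt A (inC (J p)) j by rewrite pE.
have FpS j : colim_filt p.+1 j = filt A (inCD (J p) (@outer_ob _ _ _ (T p) (J p.+1))) j.
  by rewrite /colim_filt level_succ.
apply: (@graded_iso _ _ _ (T p) (J p) (J p.+1)) => //.
- by move=> x y g; have [f _ fK] := T_ff x y; exists (f g).
- by move=> x y; have [f gK _] := T_ff x y; exact: can_inj gK.
- by move=> x y g; exact: (J_full T_cellular colim).
- by move=> x y f g; exact: (J_faithful T_cellular colim).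
- exact: colim_ob.
(* Disjointness inside the colimit, where objects may have been identified, is what
   [complement_level] provides. *)
- move=> x [c ec] [d ed]; apply: ((complement_level T_cellular colim _).1 (svalP d)).
  by exists c; exact: etrans ec (esym ed).
- by move=> v w h; exact: (level_sieve T_cellular colim h).
- by move=> v w h; rewrite -level_succ; exact: (level_sieve T_cellular colim h).
- move=> x; rewrite -FpS -Fp; split=> [/zcycP[xF dx]|[xF dx]]; first by split.
  apply/zcycP; split=> // j; have [<- //|jk] := eqVneq k j.
  by rewrite cx_deg ?rpred0 //; lia.
move=> x; rewrite -FpS -Fp;
  split=> [/bcycP[w /zcycP[wF _] [j <- [v /zcycP[vF _] ->]]]|[w wF [v vF ->]]].
  exists w; first exact: wF.
  by exists v; [move: vF; rewrite addrK | reflexivity].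
(* The filtration consists of subcomplexes, so $Z^0_p=F_p$ and the denominator of $E^1_{p+1}$ is
   $F_p+dF_{p+1}$. *)
apply/bcycP; exists w; first by apply/zcycP; split=> [|j]; first (exact: wF);
  rewrite subrr subr0; exact: colim_filt_cxd.
exists (i + 1); first by [].
exists v; last by []; rewrite addrK subrr.
apply/zcycP; split=> [|j]; first exact: vF.
by rewrite subr0; exact: colim_filt_cxd.
Qed.
End ColimitFiltration.

(* [Q 0] is the empty category, and [T n] is the functor from [Q n] to [Q n.+1]. *)
Theorem theorem2p4p1
  (Q : nat -> category) (T : forall n : nat, functor (Q n) (Q n.+1))
  (Qoo : category) (J : forall n : nat, functor (Q n) Qoo) (A : zmodType)
  (Q0_empty : Q 0%N -> False)
  (T_cellular : forall n : nat, cellular (T n))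
  (Qoo_colim : is_naive_colimit T J) :
  exists E : spectral_sequence,
    [/\ forall (p : nat) (q : int),
          inhabited (zmod_iso (E 1%N p.+1%:Z q)
            (reduced_homology (cf_precomp (comma_cf (T p)) (complement_incl (T p)))
               A (p.+1%:Z + q - 1))),
        forall p q : int, p <= 0 -> forall x : E 1%N p q, x = 0
      & converges E (cat_homology Qoo A)].
Proof.
pose E := filtered_ss (colim_filt_mono Qoo_colim (A := A)).
have bound := colim_filt_bound (L := Qoo) (J := J) (A := A) Q0_empty.
exists E; split.
- move=> p q; apply: (colim_graded_iso T_cellular Qoo_colim A); exact: subrK.
- by move=> p q p0 x; exact: (fpage_vanish bound x p0).
apply: filtered_ss_converges bound _ => i x; exact: (colim_filt_exhaust Qoo_colim x).
Qed.
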